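(* Let $q,\tilde q\in C(T)$ be (complex-valued) potentials, and let $\{\lambda_n\}_{n\ge 0}$ and $\{\tilde\lambda_n\}_{n\ge0}$ be the spectra (counted with multiplicity) of the boundary value problem $$-y^{\Delta\Delta}(t)+y(\gamma)q(t)=\lambda y(\sigma(t)),\ t\in T,\qquad y(0)=y(b)=0,$$ with the potential $q$ and of the same problem with $q$ replaced by $\tilde q$, respectively. Suppose that the functions $$c_2(\lambda)=d\cos\rho l+\frac{1-d^2\lambda}{\rho}\sin\rho l,\qquad s(\lambda)=\frac{\sin\rho\gamma}{\rho}\qquad(\lambda=\rho^2)$$ do not have common zeros. Then $\{\lambda_n\}_{n\ge0}=\{\tilde\lambda_n\}_{n\ge0}$ implies $q=\tilde q$ on $T$.
   Context: Fix $0<\gamma<a<b$ and let $T=[0,\gamma]\cup[a,b]$, $d:=a-\gamma>0$, $l:=b-a>0$. $C(T)$ is the space of continuous functions on $T$. The jump function is $\sigma(t)=t$ for $t\in T\setminus\{\gamma\}$, $\sigma(\gamma)=a$. The $\Delta$-derivative of a function $f$ on $T$ is $f^\Delta(t)=f'(t)$ (classical derivative along the segments, one-sided at $0,a,b$) for $t\in[0,\gamma)\cup[a,b]$ and $f^\Delta(\gamma)=(f(a)-f(\gamma))/d$ (with $f$ continuous on $T$); when $f^\Delta$ is continuous on $T$, also $f'(\gamma)=f^\Delta(\gamma)$. Solutions $y$ are functions whose second $\Delta$-derivative exists and is continuous on $T$. Equivalently, $y\in C^2[0,\gamma]\cap C^2[a,b]$, $-y''(x)+q(x)y(\gamma)=\lambda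 y(x)$ for $x\in[0,\gamma]$ and for $x\in[a,b]$, and $y(a)=y(\gamma)+d\,y'(\gamma)$, $y'(a)=d(q(\gamma)-\lambda)y(\gamma)+(1-\lambda d^2)y'(\gamma)$. The characteristic function of the problem (whose zeros are exactly the eigenvalues $\lambda$, i.e. those for which a non-zero solution with $y(0)=y(b)=0$ exists) is the entire function $$\Delta(\lambda)=-\frac{\sin\rho\gamma}{\rho}\Big(\cos\rho l+\big[dq(\gamma)-d\lambda\big]\frac{\sin\rho l}{\rho}+\int_a^b\frac{\sin\rho(b-t)}{\rho}q(t)\,dt\Big)-c_2(\lambda)\Big(\cos\rho\gamma+\int_0^\gamma\frac{\sin\rho t}{\rho}q(t)\,dt\Big),$$ where $\lambda=\rho^2$ and $c_2(\lambda)=d\cos\rho l+\frac{1-d^2\lambda}{\rho}\sin\rho l$. The spectrum is the sequence of all zeros of $\Delta(\lambda)$ counted with multiplicity; equality of spectra means equality as multisets. *)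

(* Defs.v *)
From Stdlib Require Import Reals Lra Psatz List FinFun.
From Coquelicot Require Import Coquelicot.

Open Scope R_scope.

Definition Csin (z : C) : C :=
  (sin (Re z) * cosh (Im z), cos (Re z) * sinh (Im z)).

Definition Ccos (z : C) : C :=
  (cos (Re z) * cosh (Im z), - (sin (Re z) * sinh (Im z))).

(** Principal square root. *)
Definition Csqrt (z : C) : C :=
  (sqrt ((Cmod z + Re z) / 2),
   (if Rle_dec 0 (Im z) then 1 else -1) * sqrt ((Cmod z - Re z) / 2)).

(** [cos (rho x)] and [sin (rho x) / rho] as functions of [lambda = rho ^ 2].
    Both are even in [rho], so the choice of the root is immaterial
    (see [cosr_sqr] and [sinr_sqr]); the second one is [x] at [lambda = 0]. *)
Definition cosr (lambda : C) (x : R) : C := Ccos (Csqrt lambda * x)%C.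

Definition sinr (lambda : C) (x : R) : C :=
  if Ceq_dec lambda 0 then RtoC x
  else (Csin (Csqrt lambda * x) / Csqrt lambda)%C.

Definition T (gamma a b t : R) : Prop := 0 <= t <= gamma \/ a <= t <= b.

Definition sigma_T (gamma a t : R) : R := if Req_EM_T t gamma then a else t.

Definition continuous_T (gamma a b : R) (f : R -> C) : Prop :=
  continuous_on (T := R_UniformSpace) (U := C_UniformSpace) (T gamma a b) f.

(** [l] is the Delta-derivative of [f] at the point [t] of [T].  Away from
    [gamma] this is the derivative along [T], hence one-sided at [0], [a], [b]. *)
Definition is_delta_derive (gamma a b : R) (f : R -> C) (t : R) (l : C) : Prop :=
  (t <> gamma ->
     filterlim (fun s => ((f s - f t) / RtoC (s - t))%C)
       (within (T gamma a b) (locally' t)) (locally (T := C_UniformSpace) l)) /\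
  (t = gamma ->
     filterlim f (within (T gamma a b) (locally gamma))
       (locally (T := C_UniformSpace) (f gamma)) /\
     l = ((f a - f gamma) / RtoC (a - gamma))%C).

(** Continuity of a second Delta-derivative: on each of the two segments, where
    on [[0, gamma]] the value at the right-scattered point [gamma] is replaced by
    the limit from the left.  (Since [y \o sigma_T] jumps at [gamma], so does
    [y^DeltaDelta] for a solution [y] of the equation; plain continuity at [gamma]
    would contradict the equation unless [lambda * (y a - y gamma) = 0].)  Thus
    a solution belongs to [C^2[0, gamma]] and to [C^2[a, b]]. *)
Definition rd_continuous (gamma a b : R) (f : R -> C) : Prop :=
  (forall t, T gamma a b t -> t <> gamma ->
     filterlim f (within (T gamma a b) (locally t))
       (locally (T := C_UniformSpace) (f t))) /\
  exists l : C,
    filterlim f (within (T gamma a b) (locally' gamma))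
      (locally (T := C_UniformSpace) l).

(** [- y^DeltaDelta + y(gamma) q = lambda y(sigma_T)] on [T]. *)
Definition is_solution (gamma a b : R) (q : R -> C) (lambda : C) (y : R -> C) : Prop :=
  exists y1 y2 : R -> C,
    (forall t, T gamma a b t -> is_delta_derive gamma a b y t (y1 t)) /\
    (forall t, T gamma a b t -> is_delta_derive gamma a b y1 t (y2 t)) /\
    rd_continuous gamma a b y2 /\
    (forall t, T gamma a b t ->
       (- y2 t + y gamma * q t)%C = (lambda * y (sigma_T gamma a t))%C).

Definition is_eigenvalue (gamma a b : R) (q : R -> C) (lambda : C) : Prop :=
  exists y : R -> C,
    is_solution gamma a b q lambda y /\
    y 0 = RtoC 0 /\ y b = RtoC 0 /\
    exists t, T gamma a b t /\ y t <> RtoC 0.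

Definition s_fun (gamma : R) (lambda : C) : C := sinr lambda gamma.

Definition c2_fun (gamma a b : R) (lambda : C) : C :=
  let d := a - gamma in let l := b - a in
  (d * cosr lambda l + (1 - d ^ 2 * lambda) * sinr lambda l)%C.

Definition char_fun (gamma a b : R) (q : R -> C) (lambda : C) : C :=
  let d := a - gamma in let l := b - a in
  (- sinr lambda gamma *
     (cosr lambda l + (d * q gamma - d * lambda) * sinr lambda l
      + RInt (V := C_R_CompleteNormedModule) (fun t => sinr lambda (b - t) * q t) a b)
   - c2_fun gamma a b lambda *
     (cosr lambda gamma
      + RInt (V := C_R_CompleteNormedModule) (fun t => sinr lambda t * q t) 0 gamma))%C.

(** [z0] is a zero of [f] of order exactly [m] ([m = 0] when [f z0 <> 0]). *)
Definition is_zero_order (f : C -> C) (z0 : C) (m : nat) : Prop :=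
  exists g : C -> C,
    locally (T := C_UniformSpace) z0
      (fun z => ex_derive (K := C_AbsRing) (V := C_NormedModule) g z) /\
    g z0 <> RtoC 0 /\
    locally (T := C_UniformSpace) z0 (fun z => f z = ((z - z0) ^ m * g z)%C).

Definition occurs (u : nat -> C) (z : C) (m : nat) : Prop :=
  exists ks : list nat,
    NoDup ks /\ length ks = m /\ (forall k, In k ks <-> u k = z).

(** The eigenvalues of the boundary value problem, each repeated according to its
    multiplicity as a zero of the characteristic function.  The first clause is
    implied by the second one, see [is_spectrum_char_fun] and [char_fun_eq0]. *)
Definition is_spectrum (gamma a b : R) (q : R -> C) (lambda : nat -> C) : Prop :=
  (forall mu, (exists n, lambda n = mu) <-> is_eigenvalue gamma a b q mu) /\
  (forall mu, exists m,
     occurs lambda mu m /\ is_zero_order (char_fun gamma a b q) mu m).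

Definition same_multiset (u v : nat -> C) : Prop :=
  exists phi : nat -> nat, Bijective phi /\ forall n, v (phi n) = u n.

Lemma C_ext (z w : C) : Re z = Re w -> Im z = Im w -> z = w.
Proof. destruct z, w; simpl; intros; subst; reflexivity. Qed.

Lemma Csqrt_sqr z : (Csqrt z * Csqrt z)%C = z.
Proof.
  assert (H1 := Rmax_Cmod z). assert (H2 := Cmod2_alt z).
  destruct z as [x y]. simpl in *.
  set (m := Cmod (x, y)) in *. assert (Hm : 0 <= m) by apply Cmod_ge_0.
  assert (Hx : Rabs x <= m) by (eapply Rle_trans; [apply Rmax_l | apply H1]).
  assert (Hxx := Rle_abs x). assert (Hxm : - x <= Rabs x) by (rewrite <- Rabs_Ropp; apply Rle_abs).
  set (u := sqrt ((m + x) / 2)). set (v := sqrt ((m - x) / 2)).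
  assert (Hu : u * u = (m + x) / 2) by (apply sqrt_sqrt; lra).
  assert (Hv : v * v = (m - x) / 2) by (apply sqrt_sqrt; lra).
  assert (Hu0 : 0 <= u) by apply sqrt_pos. assert (Hv0 : 0 <= v) by apply sqrt_pos.
  assert (Huv : 2 * (u * v) = Rabs y).
  { rewrite <- (Rabs_pos_eq (2 * (u * v))) by nra.
    apply Rsqr_eq_abs_0. unfold Rsqr.
    replace (2 * (u * v) * (2 * (u * v))) with (4 * ((u * u) * (v * v))) by ring.
    rewrite Hu, Hv. nra. }
  unfold Csqrt; simpl; fold m; fold u; fold v.
  apply C_ext; simpl; destruct (Rle_dec 0 y) as [Hy|Hy].
  - nra.
  - nra.
  - rewrite Rabs_pos_eq in Huv by lra. nra.
  - rewrite Rabs_left in Huv by lra. nra.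
Qed.

Lemma C_sqr_eq (u v : C) : (u * u)%C = (v * v)%C -> u = v \/ u = (- v)%C.
Proof.
  intros H. destruct (Ceq_dec u v) as [|n]; [left; assumption|right].
  destruct (Ceq_dec (u + v)%C 0) as [e|n'].
  - replace u with ((u + v) - v)%C by ring. rewrite e. ring.
  - exfalso. apply (Cmult_neq_0 (u - v) (u + v)).
    + intros E. apply n. apply Ceq_minus. exact E.
    + exact n'.
    + replace ((u - v) * (u + v))%C with (u * u - v * v)%C by ring. rewrite H. ring.
Qed.

Lemma cosh_opp y : cosh (- y) = cosh y.
Proof. unfold cosh. rewrite Ropp_involutive. field. Qed.

Lemma sinh_opp y : sinh (- y) = - sinh y.
Proof. unfold sinh. rewrite Ropp_involutive. field. Qed.

Lemma Ccos_opp z : Ccos (- z) = Ccos z.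
Proof. destruct z as [x y]. apply C_ext; unfold Ccos, Csin; simpl; rewrite ?sin_neg, ?cos_neg, ?cosh_opp, ?sinh_opp; ring. Qed.

Lemma Csin_opp z : Csin (- z) = (- Csin z)%C.
Proof. destruct z as [x y]. apply C_ext; unfold Ccos, Csin; simpl; rewrite ?sin_neg, ?cos_neg, ?cosh_opp, ?sinh_opp; ring. Qed.

Lemma Ccos2_Csin2 z : (Ccos z * Ccos z + Csin z * Csin z)%C = 1.
Proof.
  destruct z as [x y].
  assert (H := sin2_cos2 x). unfold Rsqr in H.
  assert (E : cosh y * cosh y - sinh y * sinh y = 1).
  { unfold cosh, sinh. assert (exp y * exp (- y) = 1) by (rewrite <- exp_plus, Rplus_opp_r; apply exp_0). nra. }
  apply C_ext; unfold Ccos, Csin; simpl.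
  - replace 1 with ((sin x * sin x + cos x * cos x) * (cosh y * cosh y - sinh y * sinh y)) by (rewrite H, E; ring).
    ring.
  - ring.
Qed.

Lemma cosr_sqr (rho : C) (x : R) : cosr (rho * rho) x = Ccos (rho * x).
Proof.
  unfold cosr. destruct (C_sqr_eq _ _ (Csqrt_sqr (rho * rho))) as [E|E]; rewrite E.
  - reflexivity.
  - replace (- rho * x)%C with (- (rho * x))%C by ring. apply Ccos_opp.
Qed.

Lemma sinr_sqr (rho : C) (x : R) :
  rho <> RtoC 0 -> sinr (rho * rho) x = (Csin (rho * x) / rho)%C.
Proof.
  intros Hr. unfold sinr. destruct (Ceq_dec (rho * rho) 0) as [E|_].
  - exfalso. exact (Cmult_neq_0 _ _ Hr Hr E).
  - destruct (C_sqr_eq _ _ (Csqrt_sqr (rho * rho))) as [E|E]; rewrite E.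
    + reflexivity.
    + replace (- rho * x)%C with (- (rho * x))%C by ring. rewrite Csin_opp.
      field. exact Hr.
Qed.

Lemma Csqrt_neq0 z : z <> RtoC 0 -> Csqrt z <> RtoC 0.
Proof. intros H E. apply H. rewrite <- (Csqrt_sqr z), E. ring. Qed.

Definition dC (f : R -> C) (x : R) (l : C) : Prop :=
  is_derive (fun t => Re (f t)) x (Re l) /\ is_derive (fun t => Im (f t)) x (Im l).

Lemma dC_eq f x l l' : dC f x l -> l = l' -> dC f x l'.
Proof. intros; subst; assumption. Qed.

Lemma dC_const c x : dC (fun _ => c) x 0.
Proof. split; apply is_derive_Reals; apply derivable_pt_lim_const. Qed.

Lemma dC_plus f g x l m : dC f x l -> dC g x m -> dC (fun t => f t + g t)%C x (l + m)%C.
Proof. intros [A B] [A' B']; split; [exact (is_derive_plus _ _ _ _ _ A A')|exact (is_derive_plus _ _ _ _ _ B B')]. Qed.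

Lemma dC_minus f g x l m : dC f x l -> dC g x m -> dC (fun t => f t - g t)%C x (l - m)%C.
Proof. intros [A B] [A' B']; split; [exact (is_derive_minus _ _ _ _ _ A A')|exact (is_derive_minus _ _ _ _ _ B B')]. Qed.

Lemma is_derive_eq (f : R -> R) x l l' : is_derive f x l -> l = l' -> is_derive f x l'.
Proof. intros; subst; assumption. Qed.

Lemma dC_mult f g x l m : dC f x l -> dC g x m ->
  dC (fun t => f t * g t)%C x (l * g x + f x * m)%C.
Proof.
  intros [A B] [A' B']; split.
  - eapply is_derive_eq.
    exact (is_derive_minus _ _ _ _ _ (Derive.is_derive_mult _ _ _ _ _ A A') (Derive.is_derive_mult _ _ _ _ _ B B')).
    unfold minus, plus, opp, Re, Im; simpl. ring.
  - eapply is_derive_eq.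
    exact (is_derive_plus _ _ _ _ _ (Derive.is_derive_mult _ _ _ _ _ A B') (Derive.is_derive_mult _ _ _ _ _ B A')).
    unfold minus, plus, opp, Re, Im; simpl. ring.
Qed.

Lemma dC_comp (f : R -> C) (g : R -> R) x l dg : dC f (g x) l -> is_derive g x dg ->
  dC (fun t => f (g t)) x (dg * l)%C.
Proof.
  intros [A B] G; split; eapply is_derive_eq.
  - exact (is_derive_comp _ _ _ _ _ A G).
  - unfold scal; simpl; unfold mult; simpl. unfold Re, Im; ring.
  - exact (is_derive_comp _ _ _ _ _ B G).
  - unfold scal; simpl; unfold mult; simpl. unfold Re, Im; ring.
Qed.

Lemma Ccos_0 : Ccos 0 = 1.
Proof.
  unfold Ccos. replace (Re 0) with 0 by reflexivity. replace (Im 0) with 0 by reflexivity.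
  rewrite cos_0, sin_0, cosh_0. apply C_ext; unfold Re, Im, RtoC, fst, snd; ring.
Qed.

Lemma Csin_0 : Csin 0 = 0.
Proof.
  unfold Csin. replace (Re 0) with 0 by reflexivity. replace (Im 0) with 0 by reflexivity.
  rewrite cos_0, sin_0, sinh_0. apply C_ext; unfold Re, Im, RtoC, fst, snd; ring.
Qed.

Lemma cosr_0 lam : cosr lam 0 = 1.
Proof. unfold cosr. rewrite Cmult_0_r. exact Ccos_0. Qed.

Lemma sinr_0 lam : sinr lam 0 = 0.
Proof.
  unfold sinr. destruct Ceq_dec; [reflexivity|]. rewrite Cmult_0_r, Csin_0.
  field. now apply Csqrt_neq0.
Qed.

Lemma cosr_opp lam x : cosr lam (- x) = cosr lam x.
Proof. unfold cosr. rewrite RtoC_opp. replace (Csqrt lam * - x)%C with (- (Csqrt lam * x))%C by ring. apply Ccos_opp. Qed.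
Lemma sinr_opp lam x : sinr lam (- x) = (- sinr lam x)%C.
Proof. unfold sinr. destruct Ceq_dec. apply RtoC_opp.
 rewrite RtoC_opp. replace (Csqrt lam * - x)%C with (- (Csqrt lam * x))%C by ring. rewrite Csin_opp. field. now apply Csqrt_neq0. Qed.

Lemma Ccos_lin rho x : dC (fun t => Ccos (rho * t)) x (- rho * Csin (rho * x))%C.
Proof.
  destruct rho as [r s]; unfold Ccos, Csin, cosh, sinh; split; simpl; auto_derive; auto; simpl;
   unfold Re, Im, Rdiv; simpl; rewrite ?Rmult_0_r, ?Rminus_0_r, ?Ropp_0, ?Rplus_0_l, ?Rplus_0_r; ring.
Qed.
Lemma Csin_lin rho x : dC (fun t => Csin (rho * t)) x (rho * Ccos (rho * x))%C.
Proof.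
  destruct rho as [r s]; unfold Ccos, Csin, cosh, sinh; split; simpl; auto_derive; auto; simpl;
   unfold Re, Im, Rdiv; simpl; rewrite ?Rmult_0_r, ?Rminus_0_r, ?Ropp_0, ?Rplus_0_l, ?Rplus_0_r; ring.
Qed.
Lemma dC_ext f g x l : (forall t, f t = g t) -> dC f x l -> dC g x l.
Proof. intros E [A B]; split; eapply is_derive_ext; try eassumption; intros t; simpl; now rewrite E. Qed.

Lemma dC_sinr lam x : dC (sinr lam) x (cosr lam x).
Proof.
  destruct (Ceq_dec lam 0) as [->|n].
  - eapply dC_ext. { intros t. unfold sinr. destruct Ceq_dec; [reflexivity|congruence]. }
    replace (cosr 0 x) with (RtoC 1).
    + split; simpl; auto_derive; auto.
    + unfold cosr. assert (Csqrt 0 = 0) as ->.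
      { destruct (Ceq_dec (Csqrt 0) 0) as [|n']; auto. exfalso. exact (Cmult_neq_0 _ _ n' n' (Csqrt_sqr 0)). }
      rewrite Cmult_0_l, <- (cosr_0 0). unfold cosr. now rewrite Cmult_0_r.
  - eapply dC_ext. { intros t. unfold sinr. destruct Ceq_dec; [congruence|reflexivity]. }
    eapply dC_eq. { apply dC_mult; [apply Csin_lin|apply (dC_const (/ Csqrt lam)%C)]. }
    unfold cosr. field. now apply Csqrt_neq0.
Qed.
Lemma dC_cosr lam x : dC (cosr lam) x (- lam * sinr lam x)%C.
Proof.
  eapply dC_eq. apply Ccos_lin. unfold sinr. destruct Ceq_dec as [->|n].
  - assert (Csqrt 0 = 0) as ->.
      { destruct (Ceq_dec (Csqrt 0) 0) as [|n']; auto. exfalso. exact (Cmult_neq_0 _ _ n' n' (Csqrt_sqr 0)). }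
    ring.
  - rewrite <- (Csqrt_sqr lam) at 3. field. now apply Csqrt_neq0.
Qed.
Lemma trig1 lam x : (cosr lam x * cosr lam x + lam * (sinr lam x * sinr lam x))%C = 1.
Proof.
  unfold sinr. destruct Ceq_dec as [->|n].
  - unfold cosr. assert (Csqrt 0 = 0) as ->.
      { destruct (Ceq_dec (Csqrt 0) 0) as [|n']; auto. exfalso. exact (Cmult_neq_0 _ _ n' n' (Csqrt_sqr 0)). }
    rewrite Cmult_0_l. change (Ccos 0) with (Ccos 0). assert (Ccos 0 = 1) as ->.
    { rewrite <- (cosr_0 0). unfold cosr. now rewrite Cmult_0_r. } ring.
  - rewrite <- (Ccos2_Csin2 (Csqrt lam * x)). unfold cosr. 
    rewrite <- (Csqrt_sqr lam) at 3. field. now apply Csqrt_neq0.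
Qed.

Local Opaque cosr sinr.
Lemma limC_Re (F : (R -> Prop) -> Prop) (f : R -> C) (l : C) :
  filterlim f F (locally (T := C_UniformSpace) l) ->
  filterlim (fun t => Re (f t)) F (locally (Re l)).
Proof.
  intros H P [eps HP]. apply (H (fun z => P (Re z))). exists eps. intros z [Hz _]. apply HP, Hz.
Qed.

Lemma limC_Im (F : (R -> Prop) -> Prop) (f : R -> C) (l : C) :
  filterlim f F (locally (T := C_UniformSpace) l) ->
  filterlim (fun t => Im (f t)) F (locally (Im l)).
Proof.
  intros H P [eps HP]. apply (H (fun z => P (Im z))). exists eps. intros z [_ Hz]. apply HP, Hz.
Qed.

Lemma limC_pair (F : (R -> Prop) -> Prop) {FF : Filter F} (f : R -> C) (l : C) :
  filterlim (fun t => Re (f t)) F (locally (Re l)) ->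
  filterlim (fun t => Im (f t)) F (locally (Im l)) ->
  filterlim f F (locally (T := C_UniformSpace) l).
Proof.
  intros H1 H2 P [eps HP].
  assert (A : F (fun t => ball (Re l) eps (Re (f t)))) by exact (H1 _ (locally_ball _ _)).
  assert (B : F (fun t => ball (Im l) eps (Im (f t)))) by exact (H2 _ (locally_ball _ _)).
  generalize (filter_and _ _ A B). unfold filtermap.
  apply filter_imp. intros t [A' B']. apply HP. split; assumption.
Qed.

Definition cw (D : R -> Prop) (f : R -> R) (t : R) : Prop :=
  filterlim f (within D (locally t)) (locally (f t)).
Definition cwC (D : R -> Prop) (f : R -> C) (t : R) : Prop :=
  cw D (fun s => Re (f s)) t /\ cw D (fun s => Im (f s)) t.

Lemma cw_plus D f g t : cw D f t -> cw D g t -> cw D (fun s => f s + g s) t.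
Proof. intros A B. eapply filterlim_comp_2; [exact A|exact B|exact (filterlim_plus (V := R_NormedModule) (f t) (g t))]. Qed.
Lemma cw_opp D f t : cw D f t -> cw D (fun s => - f s) t.
Proof. intros A. eapply filterlim_comp; [exact A|exact (filterlim_opp (V := R_NormedModule) (f t))]. Qed.
Lemma cw_mult D f g t : cw D f t -> cw D g t -> cw D (fun s => f s * g s) t.
Proof. intros A B. eapply filterlim_comp_2; [exact A|exact B|exact (filterlim_mult (K := R_AbsRing) (f t) (g t))]. Qed.
Lemma cwC_plus D f g t : cwC D f t -> cwC D g t -> cwC D (fun s => f s + g s)%C t.
Proof. intros [] []; split; now apply cw_plus. Qed.
Lemma cwC_minus D f g t : cwC D f t -> cwC D g t -> cwC D (fun s => f s - g s)%C t.
Proof. intros [A B] [A' B']; split; apply cw_plus; auto; now apply cw_opp. Qed.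
Lemma cwC_mult D f g t : cwC D f t -> cwC D g t -> cwC D (fun s => f s * g s)%C t.
Proof.
  intros [A B] [A' B']; split.
  - exact (cw_plus _ _ _ _ (cw_mult _ _ _ _ A A') (cw_opp _ _ _ (cw_mult _ _ _ _ B B'))).
  - exact (cw_plus _ _ _ _ (cw_mult _ _ _ _ A B') (cw_mult _ _ _ _ B A')).
Qed.
Lemma cwC_const D c t : cwC D (fun _ => c) t.
Proof. split; apply filterlim_const. Qed.
Lemma cw_sub (D D' : R -> Prop) f t : (forall s, D' s -> D s) -> cw D f t -> cw D' f t.
Proof.
  intros S H P HP. generalize (H P HP). unfold within, filtermap. apply filter_imp. auto.
Qed.
Lemma cwC_sub (D D' : R -> Prop) f t : (forall s, D' s -> D s) -> cwC D f t -> cwC D' f t.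
Proof. intros S [A B]; split; eapply cw_sub; eauto. Qed.
Lemma cw_cont D f t : continuous f t -> cw D f t.
Proof. intros H P HP. generalize (H P HP). unfold within, filtermap. apply filter_imp. auto. Qed.
Lemma dC_cwC D f t l : dC f t l -> cwC D f t.
Proof.
  intros [A B]; split; apply cw_cont; apply (ex_derive_continuous (K := R_AbsRing) (V := R_NormedModule)); eexists; eassumption.
Qed.
Lemma cwC_lim (D : R -> Prop) (f : R -> C) (t : R) : cwC D f t -> filterlim f (within D (locally t)) (locally (T := C_UniformSpace) (f t)).
Proof. intros [A B]. apply limC_pair; auto with typeclass_instances. Qed.
Lemma lim_cwC (D : R -> Prop) (f : R -> C) (t : R) : filterlim f (within D (locally t)) (locally (T := C_UniformSpace) (f t)) -> cwC D f t.
Proof. intros A. split; [exact (limC_Re _ _ _ A)|exact (limC_Im _ _ _ A)]. Qed.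

Definition seg (u v t : R) : Prop := u <= t <= v.
Definition clip (u v t : R) : R := Rmax u (Rmin v t).
Lemma clip_seg u v t : u <= v -> seg u v (clip u v t).
Proof. intros; unfold seg, clip, Rmax, Rmin; repeat destruct Rle_dec; lra. Qed.
Lemma clip_id u v t : seg u v t -> clip u v t = t.
Proof. unfold seg, clip, Rmax, Rmin; intros; repeat destruct Rle_dec; lra. Qed.
Lemma clip_lip u v t s : u <= v -> Rabs (clip u v s - clip u v t) <= Rabs (s - t).
Proof. intros; unfold clip, Rmax, Rmin, Rabs; repeat destruct Rle_dec; repeat destruct Rcase_abs; lra. Qed.
Lemma cw_clip u v f : u <= v -> (forall t, seg u v t -> cw (seg u v) f t) ->
  forall t, continuous (fun s => f (clip u v s)) t.
Proof.
  intros uv H t P HP.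
  destruct (H _ (clip_seg u v t uv) P HP) as [eps He].
  exists eps. intros s Hs. apply He; [|now apply clip_seg].
  change (Rabs (clip u v s - clip u v t) < eps). eapply Rle_lt_trans; [now apply clip_lip|exact Hs].
Qed.

Lemma FTC_w (W g : R -> R) u v : u <= v ->
  (forall t, u < t < v -> is_derive W t (g t)) ->
  (forall t, seg u v t -> cw (seg u v) W t) ->
  (forall t, seg u v t -> cw (seg u v) g t) ->
  is_RInt g u v (W v - W u).
Proof.
  intros uv HD HW Hg. destruct (Req_dec u v) as [<-|ne].
  { rewrite Rminus_diag_eq by reflexivity. exact (is_RInt_point (V := R_NormedModule) g u). }
  set (W' := fun s => W (clip u v s)). set (g' := fun s => g (clip u v s)).
  assert (cW : forall t, continuous W' t) by (apply cw_clip; auto).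
  assert (cg : forall t, continuous g' t) by (apply cw_clip; auto).
  assert (RI : forall x, is_RInt g' u x (RInt g' u x)).
  { intros x. apply (RInt_correct (V := R_CompleteNormedModule)). apply (ex_RInt_continuous (V := R_CompleteNormedModule)). auto. }
  assert (dI : forall x, is_derive (RInt g' u) x (g' x)).
  { intros x. apply (is_derive_RInt (V := R_NormedModule) g' _ u); auto. apply filter_forall. auto. }
  destruct (MVT_gen (fun t => W' t - RInt g' u t) u v (fun _ => 0)) as [c [_ Hc]].
  - intros x Hx. rewrite Rmin_left, Rmax_right in Hx by lra.
    apply (is_derive_eq _ _ (minus (g x) (g' x))).
    + apply (is_derive_minus (V := R_NormedModule)); [|apply dI].
      apply (is_derive_ext_loc W); [|now apply HD].
      assert (0 < Rmin (x - u) (v - x)) as Hp by (apply Rmin_glb_lt; lra).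
      exists (mkposreal _ Hp). intros s Hs. change (Rabs (s - x) < Rmin (x - u) (v - x)) in Hs.
      unfold W'. rewrite clip_id; [reflexivity|].
      assert (A := Rmin_l (x - u) (v - x)). assert (B := Rmin_r (x - u) (v - x)).
      apply Rabs_def2 in Hs. unfold seg; lra.
    + unfold g'. rewrite clip_id by (unfold seg; lra). unfold minus, plus, opp; simpl; ring.
  - intros x Hx. apply continuity_pt_filterlim.
    apply (continuous_minus (V := R_NormedModule)); [apply cW|].
    apply (ex_derive_continuous (K := R_AbsRing) (V := R_NormedModule)). eexists; apply dI.
  - apply (is_RInt_ext g').
    + intros x Hx. rewrite Rmin_left, Rmax_right in Hx by lra. unfold g'. rewrite clip_id; auto. unfold seg; lra.
    + replace (W v - W u) with (RInt g' u v); [apply RI|].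
      unfold W' in Hc. rewrite !clip_id in Hc by (unfold seg; lra).
      rewrite RInt_point in Hc. unfold zero in Hc; simpl in Hc. lra.
Qed.

Definition IC (f : R -> C) (u v : R) (l : C) : Prop :=
  is_RInt (fun t => Re (f t)) u v (Re l) /\ is_RInt (fun t => Im (f t)) u v (Im l).

Lemma IC_RInt f u v l : IC f u v l -> RInt (V := C_R_CompleteNormedModule) f u v = l.
Proof.
  intros [A B]. apply is_RInt_unique. destruct l as [l1 l2].
  exact (is_RInt_fct_extend_pair (U := R_NormedModule) (V := R_NormedModule) f u v l1 l2 A B).
Qed.

Lemma IC_unique f u v l l' : IC f u v l -> IC f u v l' -> l = l'.
Proof. intros A B. rewrite <- (IC_RInt _ _ _ _ A). now apply IC_RInt. Qed.

Lemma IC_ext f g u v l : (forall t, f t = g t) -> IC f u v l -> IC g u v l.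
Proof. intros E [A B]; split; eapply is_RInt_ext; try eassumption; intros; simpl; now rewrite E. Qed.

Lemma IC_scal f u v l c : IC f u v l -> IC (fun t => c * f t)%C u v (c * l)%C.
Proof.
  intros [A B]; split.
  - exact (is_RInt_minus _ _ _ _ _ _ (is_RInt_scal _ _ _ (Re c) _ A) (is_RInt_scal _ _ _ (Im c) _ B)).
  - exact (is_RInt_plus _ _ _ _ _ _ (is_RInt_scal _ _ _ (Re c) _ B) (is_RInt_scal _ _ _ (Im c) _ A)).
Qed.

Lemma ex_IC f u v : u <= v -> (forall t, seg u v t -> cwC (seg u v) f t) ->
  IC f u v (RInt (V := C_R_CompleteNormedModule) f u v).
Proof.
  intros uv H.
  assert (X : exists l, IC f u v l).
  { assert (Y : forall g, (forall t, seg u v t -> cw (seg u v) g t) -> ex_RInt g u v).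
    { intros g Hg. apply (ex_RInt_ext (fun s => g (clip u v s))).
      - intros x Hx. rewrite Rmin_left, Rmax_right in Hx by lra. rewrite clip_id; auto. unfold seg; lra.
      - apply (ex_RInt_continuous (V := R_CompleteNormedModule)). intros. now apply cw_clip. }
    destruct (Y (fun t => Re (f t))) as [l1 A]. { intros t Ht; exact (proj1 (H t Ht)). }
    destruct (Y (fun t => Im (f t))) as [l2 B]. { intros t Ht; exact (proj2 (H t Ht)). }
    exists (l1, l2). split; assumption. }
  destruct X as [l Hl]. now rewrite (IC_RInt _ _ _ _ Hl).
Qed.

Lemma dC_S_rev lam x0 t : dC (fun s => sinr lam (x0 - s)) t (- cosr lam (x0 - t))%C.
Proof.
  eapply dC_eq. eapply (dC_comp (sinr lam) (fun s => x0 - s) t _ (-1)). apply dC_sinr.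
  auto_derive; auto; ring. ring.
Qed.
Lemma dC_C_rev lam x0 t : dC (fun s => cosr lam (x0 - s)) t (lam * sinr lam (x0 - t))%C.
Proof.
  eapply dC_eq. eapply (dC_comp (cosr lam) (fun s => x0 - s) t _ (-1)). apply dC_cosr.
  auto_derive; auto; ring. ring.
Qed.

Lemma segment lam c (y y1 Q : R -> C) u v x0 I : u <= v ->
  (forall t, u < t < v -> dC y t (y1 t)) ->
  (forall t, u < t < v -> dC y1 t (c * Q t - lam * y t)%C) ->
  (forall t, seg u v t -> cwC (seg u v) y t) ->
  (forall t, seg u v t -> cwC (seg u v) y1 t) ->
  (forall t, seg u v t -> cwC (seg u v) Q t) ->
  IC (fun t => sinr lam (x0 - t) * Q t)%C u v I ->
  (y1 v * sinr lam (x0 - v) + y v * cosr lam (x0 - v)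
   - (y1 u * sinr lam (x0 - u) + y u * cosr lam (x0 - u)) = c * I)%C.
Proof.
  intros uv Hy Hy1 Cy Cy1 CQ HI.
  set (W := fun t => (y1 t * sinr lam (x0 - t) + y t * cosr lam (x0 - t))%C).
  set (g := fun t => (c * (sinr lam (x0 - t) * Q t))%C).
  assert (dW : forall t, u < t < v -> dC W t (g t)).
  { intros t Ht. eapply dC_eq.
    apply dC_plus; apply dC_mult; eauto using dC_S_rev, dC_C_rev. unfold g; ring. }
  assert (cWC : forall t, seg u v t -> cwC (seg u v) W t).
  { intros t Ht. apply cwC_plus; apply cwC_mult; eauto using dC_cwC, dC_S_rev, dC_C_rev. }
  assert (cg : forall t, seg u v t -> cwC (seg u v) g t).
  { intros t Ht. unfold g. apply cwC_mult; [apply cwC_const|]. apply cwC_mult; [|now apply CQ].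
    eapply dC_cwC. apply dC_S_rev. }
  apply (IC_unique g u v); [|now apply IC_scal].
  split.
  - exact (FTC_w (fun t => Re (W t)) (fun t => Re (g t)) u v uv (fun t H => proj1 (dW t H))
      (fun t H => proj1 (cWC t H)) (fun t H => proj1 (cg t H))).
  - exact (FTC_w (fun t => Im (W t)) (fun t => Im (g t)) u v uv (fun t H => proj2 (dW t H))
      (fun t H => proj2 (cWC t H)) (fun t H => proj2 (cg t H))).
Qed.

Lemma exists_Y lam c A B p (Q : R -> C) :
  (forall t, continuous (fun s => Re (Q s)) t) -> (forall t, continuous (fun s => Im (Q s)) t) ->
  exists Y Y1 : R -> C, Y p = A /\ Y1 p = B /\
    (forall t, dC Y t (Y1 t)) /\ (forall t, dC Y1 t (c * Q t - lam * Y t)%C).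
Proof.
  intros Q1 Q2.
  assert (P : forall g : R -> C, (forall t, cwC (fun _ => True) g t) ->
     exists J : R -> C, J p = 0 /\ forall t, dC J t (g t)).
  { intros g Hg.
    assert (X : forall h : R -> R, (forall t, cw (fun _ => True) h t) -> RInt h p p = 0 /\ forall t, is_derive (RInt h p) t (h t)).
    { intros h Hh. assert (Hc : forall t, continuous h t).
      { intros t P HP. generalize (Hh t P HP). unfold filtermap, within. apply filter_imp. auto. }
      split. now rewrite RInt_point.
      intros t. apply (is_derive_RInt (V := R_NormedModule) h _ p); auto. apply filter_forall. intros x.
      apply (RInt_correct (V := R_CompleteNormedModule)). apply (ex_RInt_continuous (V := R_CompleteNormedModule)). auto. }
    destruct (X (fun t => Re (g t)) (fun t => proj1 (Hg t))) as [z1 d1].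
    destruct (X (fun t => Im (g t)) (fun t => proj2 (Hg t))) as [z2 d2].
    exists (fun x => (RInt (fun t => Re (g t)) p x, RInt (fun t => Im (g t)) p x)).
    split. { rewrite z1, z2. reflexivity. }
    intros t; split; [apply d1|apply d2]. }
  assert (cQ : forall t, cwC (fun _ => True) Q t).
  { intros t; split; apply cw_cont; auto. }
  destruct (P (fun t => cosr lam t * Q t)%C) as [I1 [I10 dI1]]; auto.
  { intros t. apply cwC_mult; eauto using dC_cwC, dC_cosr. }
  destruct (P (fun t => sinr lam t * Q t)%C) as [I2 [I20 dI2]]; auto.
  { intros t. apply cwC_mult; eauto using dC_cwC, dC_sinr. }
  assert (dS : forall t, dC (fun s => sinr lam (s - p)) t (cosr lam (t - p))).
  { intros t. eapply dC_eq. eapply (dC_comp (sinr lam) (fun s => s - p) t _ 1). apply dC_sinr. auto_derive; auto; ring. ring. }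
  assert (dK : forall t, dC (fun s => cosr lam (s - p)) t (- lam * sinr lam (t - p))%C).
  { intros t. eapply dC_eq. eapply (dC_comp (cosr lam) (fun s => s - p) t _ 1). apply dC_cosr. auto_derive; auto; ring. ring. }
  exists (fun t => A * cosr lam (t - p) + B * sinr lam (t - p) + c * (sinr lam t * I1 t - cosr lam t * I2 t))%C.
  exists (fun t => B * cosr lam (t - p) - A * (lam * sinr lam (t - p)) + c * (cosr lam t * I1 t + lam * (sinr lam t * I2 t)))%C.
  rewrite I10, I20, Rminus_diag_eq by reflexivity. rewrite cosr_0, sinr_0.
  split; [ring|split; [ring|split; intros t]].
  - eapply dC_eq.
    exact (dC_plus _ _ _ _ _
      (dC_plus _ _ _ _ _ (dC_mult _ _ _ _ _ (dC_const A t) (dK t))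
                         (dC_mult _ _ _ _ _ (dC_const B t) (dS t)))
      (dC_mult _ _ _ _ _ (dC_const c t)
        (dC_minus _ _ _ _ _ (dC_mult _ _ _ _ _ (dC_sinr lam t) (dI1 t))
                            (dC_mult _ _ _ _ _ (dC_cosr lam t) (dI2 t))))).
    cbv beta. ring.
  - eapply dC_eq.
    exact (dC_plus _ _ _ _ _
      (dC_minus _ _ _ _ _ (dC_mult _ _ _ _ _ (dC_const B t) (dK t))
         (dC_mult _ _ _ _ _ (dC_const A t) (dC_mult _ _ _ _ _ (dC_const lam t) (dS t))))
      (dC_mult _ _ _ _ _ (dC_const c t)
        (dC_plus _ _ _ _ _ (dC_mult _ _ _ _ _ (dC_cosr lam t) (dI1 t))
           (dC_mult _ _ _ _ _ (dC_const lam t) (dC_mult _ _ _ _ _ (dC_sinr lam t) (dI2 t)))))).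
    cbv beta.
    replace (c * Q t)%C with (c * Q t * (cosr lam t * cosr lam t + lam * (sinr lam t * sinr lam t)))%C by (rewrite trig1; ring).
    ring.
Qed.

Lemma Re_quot (z : C) (h : R) : h <> 0 -> Re (z / h)%C = Re z / h.
Proof. intros. destruct z as [u v]. unfold Cdiv, Cinv, Cmult, Re, Im, RtoC; simpl. field. auto. Qed.
Lemma Im_quot (z : C) (h : R) : h <> 0 -> Im (z / h)%C = Im z / h.
Proof. intros. destruct z as [u v]. unfold Cdiv, Cinv, Cmult, Re, Im, RtoC; simpl. field. auto. Qed.

Lemma within_locally' (D : R -> Prop) t (P : R -> Prop) :
  within D (locally' t) P <-> within D (locally t) (fun s => s <> t -> P s).
Proof. unfold within, locally', within. split; apply filter_imp; auto. Qed.

Lemma filterlim_locally'_ext (D : R -> Prop) t (f g : R -> R) l :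
  (forall s, s <> t -> f s = g s) ->
  filterlim f (within D (locally' t)) (locally l) -> filterlim g (within D (locally' t)) (locally l).
Proof.
  intros E H P HP. apply within_locally'. generalize (proj1 (within_locally' D t _) (H P HP)).
  unfold within. apply filter_imp. intros s A B C'. rewrite <- E by auto. now apply A.
Qed.

Definition quot_lim (D : R -> Prop) (f : R -> R) t l :=
  filterlim (fun s => (f s - f t) / (s - t)) (within D (locally' t)) (locally l).

Lemma quotC_Re (D : R -> Prop) (f : R -> C) t l :
  filterlim (fun s => ((f s - f t) / RtoC (s - t))%C) (within D (locally' t)) (locally (T := C_UniformSpace) l) ->
  quot_lim D (fun s => Re (f s)) t (Re l).
Proof.
  intros H. apply limC_Re in H. eapply filterlim_locally'_ext; [|exact H].
  intros s Hs. apply Re_quot. lra.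
Qed.
Lemma quotC_Im (D : R -> Prop) (f : R -> C) t l :
  filterlim (fun s => ((f s - f t) / RtoC (s - t))%C) (within D (locally' t)) (locally (T := C_UniformSpace) l) ->
  quot_lim D (fun s => Im (f s)) t (Im l).
Proof.
  intros H. apply limC_Im in H. eapply filterlim_locally'_ext; [|exact H].
  intros s Hs. apply Im_quot. lra.
Qed.

Global Instance within_locally'_filter (D : R -> Prop) (t : R) : Filter (within D (locally' t)).
Proof. apply within_filter. apply within_filter. apply locally_filter. Qed.

Lemma quotC_pair (D : R -> Prop) (f : R -> C) t l :
  quot_lim D (fun s => Re (f s)) t (Re l) -> quot_lim D (fun s => Im (f s)) t (Im l) ->
  filterlim (fun s => ((f s - f t) / RtoC (s - t))%C) (within D (locally' t)) (locally (T := C_UniformSpace) l).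
Proof.
  intros A B. apply limC_pair. apply within_locally'_filter.
  - eapply filterlim_locally'_ext; [|exact A]. intros s Hs. symmetry. apply Re_quot. lra.
  - eapply filterlim_locally'_ext; [|exact B]. intros s Hs. symmetry. apply Im_quot. lra.
Qed.

Lemma quot_derive (D : R -> Prop) f t l u v : u < t < v -> (forall s, u < s < v -> D s) ->
  quot_lim D f t l -> is_derive f t l.
Proof.
  intros Ht HD H. apply is_derive_Reals. intros eps He.
  destruct (H _ (locally_ball l (mkposreal _ He))) as [d Hd].
  assert (0 < Rmin d (Rmin (t - u) (v - t))) as Hp.
  { repeat apply Rmin_glb_lt; try lra. apply cond_pos. }
  exists (mkposreal _ Hp). intros h Hh Hh'. simpl in Hh'.
  assert (A1 := Rmin_l d (Rmin (t - u) (v - t))). assert (A2 := Rmin_r d (Rmin (t - u) (v - t))).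
  assert (A3 := Rmin_l (t - u) (v - t)). assert (A4 := Rmin_r (t - u) (v - t)).
  assert (A5 : Rabs h < t - u) by lra. assert (A6 : Rabs h < v - t) by lra.
  apply Rabs_def2 in A5. apply Rabs_def2 in A6.
  assert (X := Hd (t + h)). 
  assert (Rabs ((f (t + h) - f t) / (t + h - t) - l) < eps).
  { apply X. change (Rabs (t + h - t) < d). replace (t + h - t) with h by ring. lra.
    lra. apply HD; lra. }
  replace (t + h - t) with h in H0 by ring. exact H0.
Qed.

Lemma derive_quot (D : R -> Prop) (f g : R -> R) (t l : R) : within D (locally t) (fun s => f s = g s) -> f t = g t ->
  is_derive g t l -> quot_lim D f t l.
Proof.
  intros Hl Hfg H. apply is_derive_Reals in H. intros P [eps HP].
  destruct (H eps (cond_pos eps)) as [d Hd].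
  unfold filtermap. apply within_locally'.
  assert (B : locally t (fun s => Rabs (s - t) < d)) by (exists d; intros s Hs; exact Hs).
  unfold within in Hl. generalize (filter_and _ _ Hl B). unfold within. apply filter_imp.
  intros s [E Hs] Ds ne. apply HP. cbv beta. rewrite E, Hfg by assumption.
  change (Rabs ((g s - g t) / (s - t) - l) < eps).
  assert (X := Hd (s - t)). rewrite (Rplus_minus t s) in X. apply X; [apply Rminus_eq_contra; exact ne|exact Hs].
Qed.

Lemma quot_cw (D : R -> Prop) f t l : quot_lim D f t l -> cw D f t.
Proof.
  intros H P [eps HP].
  destruct (H _ (locally_ball l (mkposreal 1 Rlt_0_1))) as [d Hd].
  assert (Hm : 0 < eps / (Rabs l + 1)).
  { apply Rdiv_lt_0_compat. apply cond_pos. assert (X := Rabs_pos l). lra. }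
  assert (Hp : 0 < Rmin d (eps / (Rabs l + 1))) by (apply Rmin_glb_lt; [apply cond_pos|exact Hm]).
  exists (mkposreal _ Hp). intros s Hs Ds. apply HP.
  change (Rabs (s - t) < Rmin d (eps / (Rabs l + 1))) in Hs.
  assert (A1 := Rmin_l d (eps / (Rabs l + 1))). assert (A2 := Rmin_r d (eps / (Rabs l + 1))).
  change (Rabs (f s - f t) < eps).
  destruct (Req_dec s t) as [->|ne].
  { rewrite Rminus_diag_eq, Rabs_R0 by reflexivity. apply cond_pos. }
  assert (X : Rabs ((f s - f t) / (s - t) - l) < 1).
  { apply (Hd s); auto. change (Rabs (s - t) < d). lra. }
  set (k := (f s - f t) / (s - t)) in *.
  replace (f s - f t) with (k * (s - t)) by (unfold k; field; lra).
  rewrite Rabs_mult.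
  assert (Hk : Rabs k < Rabs l + 1).
  { replace k with ((k - l) + l) by ring. eapply Rle_lt_trans. apply Rabs_triang. lra. }
  assert (Rabs (s - t) < eps / (Rabs l + 1)) by lra.
  assert (Y := Rabs_pos l). assert (Y' := Rabs_pos (s - t)).
  apply Rle_lt_trans with ((Rabs l + 1) * Rabs (s - t)).
  { apply Rmult_le_compat_r; lra. }
  replace (pos eps) with ((Rabs l + 1) * (eps / (Rabs l + 1))) by (field; lra).
  apply Rmult_lt_compat_l; lra.
Qed.

Section BVP.
Variables (gamma a b : R) (Hg : 0 < gamma) (Ha : gamma < a) (Hb : a < b).
Local Notation D := (T gamma a b).

Lemma delta_dC f t l u v : u < t < v -> (forall s, u < s < v -> D s) -> t <> gamma ->
  is_delta_derive gamma a b f t l -> dC f t l.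
Proof.
  intros Ht HD ne [H _]. specialize (H ne). split.
  - exact (quot_derive _ _ _ _ _ _ Ht HD (quotC_Re _ f _ _ H)).
  - exact (quot_derive _ _ _ _ _ _ Ht HD (quotC_Im _ f _ _ H)).
Qed.

Lemma delta_cwC f t l : is_delta_derive gamma a b f t l -> cwC D f t.
Proof.
  intros [H1 H2]. destruct (Req_dec t gamma) as [E|ne].
  - destruct (H2 E) as [H _]. subst t. now apply lim_cwC.
  - specialize (H1 ne). split; eapply quot_cw; [exact (quotC_Re _ f _ _ H1)|exact (quotC_Im _ f _ _ H1)].
Qed.

Lemma dC_delta f g t l : within D (locally t) (fun s => f s = g s) -> f t = g t -> t <> gamma ->
  dC g t l -> is_delta_derive gamma a b f t l.
Proof.
  intros E Et ne [A B]. split; [intros _|congruence].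
  apply quotC_pair.
  - apply (derive_quot _ _ (fun s => Re (g s))); auto.
    + revert E. unfold within. apply filter_imp. intros s X Y. now rewrite X.
    + now rewrite Et.
  - apply (derive_quot _ _ (fun s => Im (g s))); auto.
    + revert E. unfold within. apply filter_imp. intros s X Y. now rewrite X.
    + now rewrite Et.
Qed.

Variables (q : R -> C) (Hq : continuous_T gamma a b q) (lam : C).

Lemma q_cwC u v t : (forall s, seg u v s -> D s) -> seg u v t -> cwC (seg u v) q t.
Proof. intros S Ht. apply (cwC_sub D); auto. apply lim_cwC. apply Hq. auto. Qed.

Lemma seg1 u v s : 0 <= u -> v <= gamma -> seg u v s -> D s.
Proof. unfold seg, T; lra. Qed.
Lemma seg2 u v s : a <= u -> v <= b -> seg u v s -> D s.
Proof. unfold seg, T; lra. Qed.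

Let I1 := RInt (V := C_R_CompleteNormedModule) (fun t => sinr lam t * q t)%C 0 gamma.
Let I2 := RInt (V := C_R_CompleteNormedModule) (fun t => sinr lam (b - t) * q t)%C a b.

Lemma IC1 : IC (fun t => sinr lam (0 - t) * q t)%C 0 gamma (- I1)%C.
Proof.
  replace (- I1)%C with ((- (1)) * I1)%C by ring.
  apply (IC_ext (fun t => (- (1)) * (sinr lam t * q t))%C).
  { intros t. rewrite Rminus_0_l, sinr_opp. ring. }
  apply IC_scal. apply ex_IC; [lra|]. intros t Ht. apply cwC_mult.
  - eapply dC_cwC, dC_sinr.
  - apply q_cwC; auto. intros s. apply seg1; lra.
Qed.
Lemma IC2 : IC (fun t => sinr lam (b - t) * q t)%C a b I2.
Proof.
  apply ex_IC; [lra|]. intros t Ht. apply cwC_mult.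
  - eapply dC_cwC, dC_S_rev.
  - apply q_cwC; auto. intros s. apply seg2; lra.
Qed.

Let d := RtoC (a - gamma).
Let A := (cosr lam (b - a) + (d * q gamma - d * lam) * sinr lam (b - a) + I2)%C.
Let B := (cosr lam gamma + I1)%C.
Let S := sinr lam gamma.
Let c2 := c2_fun gamma a b lam.

Lemma char_AB : char_fun gamma a b q lam = (- S * A - c2 * B)%C.
Proof. reflexivity. Qed.

Lemma d_neq0 : d <> 0.
Proof. intros E. apply (f_equal Re) in E. unfold d in E. simpl in E. lra. Qed.

Lemma eigenvalue_char : is_eigenvalue gamma a b q lam -> char_fun gamma a b q lam = 0.
Proof.
  intros [y [[y1 [y2 [H1 [H2 [_ H3]]]]] [Hy0 [Hyb [t0 [Ht0 Hnz]]]]]].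
  set (c := y gamma) in *. set (e := y1 gamma).
  assert (Dg : D gamma) by (unfold T; lra).
  assert (Dd : forall u v, u < v -> (forall s, u < s < v -> D s /\ s <> gamma) ->
     (forall t, u < t < v -> dC y t (y1 t)) /\
     (forall t, u < t < v -> dC y1 t (c * q t - lam * y t)%C)).
  { intros u v uv S'. split; intros t Ht; destruct (S' t Ht) as [Dt ne].
    - apply (delta_dC y t (y1 t) u v Ht (fun s Hs => proj1 (S' s Hs)) ne). auto.
    - apply (dC_eq _ _ (y2 t)); [apply (delta_dC y1 t (y2 t) u v Ht (fun s Hs => proj1 (S' s Hs)) ne); auto|].
      generalize (H3 t Dt). unfold sigma_T. destruct (Req_EM_T t gamma); [contradiction|].
      intros <-. ring. }
  assert (Cy : forall u v t, (forall s, seg u v s -> D s) -> seg u v t -> cwC (seg u v) y t).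
  { intros u v t S' Ht. apply (cwC_sub D); auto. eapply delta_cwC. apply H1. auto. }
  assert (Cy1 : forall u v t, (forall s, seg u v s -> D s) -> seg u v t -> cwC (seg u v) y1 t).
  { intros u v t S' Ht. apply (cwC_sub D); auto. eapply delta_cwC. apply H2. auto. }
  assert (SEG : forall u v x0 I, u <= v -> (forall s, seg u v s -> D s) -> (forall s, u < s < v -> s <> gamma) ->
     IC (fun t => sinr lam (x0 - t) * q t)%C u v I ->
     (y1 v * sinr lam (x0 - v) + y v * cosr lam (x0 - v)
      - (y1 u * sinr lam (x0 - u) + y u * cosr lam (x0 - u)) = c * I)%C).
  { intros u v x0 I uv S' S'' HI.
    destruct (Req_dec u v) as [E|ne].
    - apply (segment lam c y y1 q u v x0 I); auto using q_cwC; intros; lra.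
    - destruct (Dd u v) as [X Y]; [lra| |apply (segment lam c y y1 q u v x0 I); auto using q_cwC].
      intros s Hs. split; auto. apply S'. unfold seg; lra. }
  assert (Ea : y a = (c + d * e)%C).
  { destruct (proj2 (H1 gamma Dg) eq_refl) as [_ E]. fold e d c in E. rewrite E. field. apply d_neq0. }
  assert (Ea1 : y1 a = (e + d * (c * q gamma - lam * y a))%C).
  { destruct (proj2 (H2 gamma Dg) eq_refl) as [_ E]. fold e d in E.
    generalize (H3 gamma Dg). unfold sigma_T. destruct (Req_EM_T gamma gamma); [|congruence]. intros <-.
    fold c. rewrite E. field. apply d_neq0. }
  assert (E1 : (e * S = c * B)%C).
  { assert (X := SEG 0 gamma 0 _ (Rlt_le _ _ Hg) (fun s => seg1 0 gamma s (Rle_refl _) (Rle_refl _))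
      (fun s Hs => Rlt_not_eq _ _ (proj2 Hs)) IC1).
    rewrite Rminus_0_l, Rminus_0_r, Hy0, sinr_0, sinr_opp, cosr_opp in X. fold c e S in X.
    unfold B. transitivity (c * cosr lam gamma - c * - I1)%C; [|ring]. rewrite <- X. ring. }
  assert (E2 : (c * A + e * c2 = 0)%C).
  { assert (X : (y1 b * sinr lam (b - b) + y b * cosr lam (b - b)
      - (y1 a * sinr lam (b - a) + y a * cosr lam (b - a)) = c * I2)%C).
    { apply SEG; [lra|intros s; apply seg2; lra|intros; lra|apply IC2]. }
    rewrite (Rminus_diag_eq b b eq_refl), Hyb, sinr_0 in X.
    unfold A, c2, c2_fun; fold d.
    replace (c * (cosr lam (b - a) + (d * q gamma - d * lam) * sinr lam (b - a) + I2))%C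
      with (c * (cosr lam (b - a) + (d * q gamma - d * lam) * sinr lam (b - a)) + c * I2)%C by ring.
    rewrite <- X, Ea1, Ea. unfold d. rewrite ?RtoC_minus. simpl Cpow. ring. }
  rewrite char_AB.
  destruct (Ceq_dec (- S * A - c2 * B)%C 0) as [|ne]; auto. exfalso.
  assert (c0 : c = 0).
  { destruct (Ceq_dec c 0) as [|n]; auto. exfalso. apply (Cmult_neq_0 _ _ n ne).
    transitivity (- S * (c * A + e * c2) + c2 * (e * S - c * B))%C; [ring|]. rewrite E1, E2. ring. }
  assert (e0 : e = 0).
  { destruct (Ceq_dec e 0) as [|n]; auto. exfalso. apply (Cmult_neq_0 _ _ n ne).
    transitivity (- A * (e * S - c * B) - B * (c * A + e * c2))%C; [ring|]. rewrite E1, E2. ring. }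
  assert (a0 : y a = 0) by (rewrite Ea, c0, e0; ring).
  assert (a1 : y1 a = 0) by (rewrite Ea1, a0, c0, e0; ring).
  apply Hnz. destruct Ht0 as [Ht|Ht].
  - assert (HI : IC (fun t => sinr lam (t0 - t) * q t)%C t0 gamma
      (RInt (V := C_R_CompleteNormedModule) (fun t => sinr lam (t0 - t) * q t)%C t0 gamma)).
    { apply ex_IC; [lra|]. intros t Ht'. apply cwC_mult.
      - eapply dC_cwC, dC_S_rev.
      - apply q_cwC; auto. intros s. apply seg1; lra. }
    assert (X := SEG _ _ _ _ (proj2 Ht) (fun s => seg1 t0 gamma s (proj1 Ht) (Rle_refl _))
      (fun s Hs => Rlt_not_eq _ _ (proj2 Hs)) HI).
    fold c e in X. rewrite c0, e0, (Rminus_diag_eq t0 t0 eq_refl), sinr_0, cosr_0 in X.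
    transitivity (- (0 * sinr lam (t0 - gamma) + 0 * cosr lam (t0 - gamma) - (y1 t0 * 0 + y t0 * 1)))%C; [ring|].
    rewrite X. ring.
  - assert (HI : IC (fun t => sinr lam (t0 - t) * q t)%C a t0
      (RInt (V := C_R_CompleteNormedModule) (fun t => sinr lam (t0 - t) * q t)%C a t0)).
    { apply ex_IC; [lra|]. intros t Ht'. apply cwC_mult.
      - eapply dC_cwC, dC_S_rev.
      - apply q_cwC; auto. intros s. apply seg2; lra. }
    assert (X : (y1 t0 * sinr lam (t0 - t0) + y t0 * cosr lam (t0 - t0)
      - (y1 a * sinr lam (t0 - a) + y a * cosr lam (t0 - a)) = c * RInt (V := C_R_CompleteNormedModule) (fun t => sinr lam (t0 - t) * q t)%C a t0)%C).
    { apply SEG; [lra|intros s; apply seg2; lra|intros; lra|exact HI]. }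
    rewrite a0, a1, c0, (Rminus_diag_eq t0 t0 eq_refl), sinr_0, cosr_0 in X.
    transitivity (y1 t0 * 0 + y t0 * 1 - (0 * sinr lam (t0 - a) + 0 * cosr lam (t0 - a)))%C; [ring|].
    rewrite X. ring.
Qed.

Lemma kernel_vector : (- S * A - c2 * B = 0)%C ->
  exists c e : C, (e * S = c * B)%C /\ (c * A + e * c2 = 0)%C /\ (c <> 0 \/ e <> 0).
Proof.
  intros H.
  assert (H' : (S * A + c2 * B = 0)%C).
  { transitivity (- (- S * A - c2 * B))%C; [ring|rewrite H; ring]. }
  destruct (Ceq_dec S 0) as [s0|sn].
  - destruct (Ceq_dec c2 0) as [c0|cn].
    + exists 0, 1. rewrite s0, c0. repeat split; try ring. right. exact C1_nz.
    + exists c2, (- A)%C. repeat split; [|ring|now left].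
      transitivity (c2 * B - (S * A + c2 * B))%C; [ring|rewrite H'; ring].
  - exists S, B. repeat split; [ring| |now left]. rewrite <- H'. ring.
Qed.

Lemma clip_cont u v : u <= v -> (forall s, seg u v s -> D s) ->
  (forall t, continuous (fun s => Re (q (clip u v s))) t) /\
  (forall t, continuous (fun s => Im (q (clip u v s))) t).
Proof.
  intros uv S'. split; intros t.
  - apply (cw_clip u v (fun s => Re (q s)) uv). intros s Hs. exact (proj1 (q_cwC u v s S' Hs)).
  - apply (cw_clip u v (fun s => Im (q s)) uv). intros s Hs. exact (proj2 (q_cwC u v s S' Hs)).
Qed.

Lemma near_l t : t <= gamma -> within D (locally t) (fun s => s <= gamma).
Proof.
  intros Ht. assert (Hp : 0 < a - gamma) by lra. exists (mkposreal _ Hp). intros s Hs Ds.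
  change (Rabs (s - t) < a - gamma) in Hs. apply Rabs_def2 in Hs. unfold T in Ds. lra.
Qed.
Lemma near_r t : a <= t -> within D (locally t) (fun s => gamma < s).
Proof.
  intros Ht. assert (Hp : 0 < a - gamma) by lra. exists (mkposreal _ Hp). intros s Hs Ds.
  change (Rabs (s - t) < a - gamma) in Hs. apply Rabs_def2 in Hs. unfold T in Ds. lra.
Qed.

Lemma char_eigenvalue : char_fun gamma a b q lam = 0 -> is_eigenvalue gamma a b q lam.
Proof.
  rewrite char_AB. intros H. destruct (kernel_vector H) as [c [e [E1 [E2 nz]]]].
  assert (S1 : forall s, seg 0 gamma s -> D s) by (intros s; apply seg1; lra).
  assert (S2 : forall s, seg a b s -> D s) by (intros s; apply seg2; lra).
  destruct (clip_cont 0 gamma ltac:(lra) S1) as [C1 C2].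
  destruct (clip_cont a b ltac:(lra) S2) as [C3 C4].
  destruct (exists_Y lam c c e gamma (fun s => q (clip 0 gamma s)) C1 C2) as [yl [yl1 [L0 [L1 [L2 L3]]]]].
  set (ya := (c + d * e)%C). set (ya1 := (e + d * (c * q gamma - lam * ya))%C).
  destruct (exists_Y lam c ya ya1 a (fun s => q (clip a b s)) C3 C4) as [yr [yr1 [R0 [R1 [R2 R3]]]]].
  assert (L3' : forall t, seg 0 gamma t -> dC yl1 t (c * q t - lam * yl t)%C).
  { intros t Ht. generalize (L3 t). cbv beta. now rewrite (clip_id _ _ _ Ht). }
  assert (R3' : forall t, seg a b t -> dC yr1 t (c * q t - lam * yr t)%C).
  { intros t Ht. generalize (R3 t). cbv beta. now rewrite (clip_id _ _ _ Ht). }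
  set (y := fun t => if Rle_dec t gamma then yl t else yr t).
  set (y1 := fun t => if Rle_dec t gamma then yl1 t else yr1 t).
  set (y2 := fun t => (c * q t - lam * y (sigma_T gamma a t))%C).
  assert (yL : forall t, t <= gamma -> y t = yl t) by (intros t Ht; unfold y; destruct (Rle_dec t gamma); [reflexivity|lra]).
  assert (yR : forall t, gamma < t -> y t = yr t) by (intros t Ht; unfold y; destruct (Rle_dec t gamma); [lra|reflexivity]).
  assert (y1L : forall t, t <= gamma -> y1 t = yl1 t) by (intros t Ht; unfold y1; destruct (Rle_dec t gamma); [reflexivity|lra]).
  assert (y1R : forall t, gamma < t -> y1 t = yr1 t) by (intros t Ht; unfold y1; destruct (Rle_dec t gamma); [lra|reflexivity]).
  assert (sg : sigma_T gamma a gamma = a) by (unfold sigma_T; destruct (Req_EM_T gamma gamma); [reflexivity|congruence]).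
  assert (sn : forall t, t <> gamma -> sigma_T gamma a t = t) by (intros t Ht; unfold sigma_T; destruct (Req_EM_T t gamma); [contradiction|reflexivity]).
  assert (wl : forall (f g : R -> C) t, (forall s, s <= gamma -> f s = g s) -> t <= gamma -> within D (locally t) (fun s => f s = g s)).
  { intros f g t E Ht. generalize (near_l t Ht). unfold within. apply filter_imp. auto. }
  assert (wr : forall (f g : R -> C) t, (forall s, gamma < s -> f s = g s) -> a <= t -> within D (locally t) (fun s => f s = g s)).
  { intros f g t E Ht. generalize (near_r t Ht). unfold within. apply filter_imp. auto. }
  assert (DY : forall f fl fr, (forall s, s <= gamma -> f s = fl s) -> (forall s, gamma < s -> f s = fr s) ->
    forall t l, D t -> t <> gamma -> (t < gamma -> dC fl t l) -> (a <= t -> dC fr t l) ->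
    is_delta_derive gamma a b f t l).
  { intros f fl fr El Er t l [Dt|Dt] ne dl dr.
    - apply (dC_delta f fl); auto; [apply wl; auto; lra|apply El; lra|apply dl; lra].
    - apply (dC_delta f fr); auto; [apply wr; auto; lra|apply Er; lra|apply dr; lra]. }
  assert (CG : forall (f fl : R -> C) l, (forall s, s <= gamma -> f s = fl s) -> dC fl gamma l ->
    filterlim f (within D (locally gamma)) (locally (T := C_UniformSpace) (f gamma))).
  { intros f fl l El dl. rewrite (El gamma (Rle_refl _)).
    apply (filterlim_ext_loc fl).
    - apply (filter_imp (fun s => s <= gamma) _ (fun s Hs => eq_sym (El s Hs))). apply near_l; lra.
    - apply cwC_lim. eapply dC_cwC; exact dl. }
  assert (Z : forall (f : R -> C) t l, D t -> dC f t l ->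
    filterlim (fun s => (c * q s - lam * f s)%C) (within D (locally t)) (locally (T := C_UniformSpace) (c * q t - lam * f t)%C)).
  { intros f t l Dt df. apply (cwC_lim D (fun s => (c * q s - lam * f s)%C) t). apply cwC_minus; apply cwC_mult; try apply cwC_const.
    - apply lim_cwC. now apply Hq.
    - eapply dC_cwC; exact df. }
  exists y. split; [exists y1, y2; split; [|split; [|split]]|split; [|split]].
  - intros t Dt. destruct (Req_dec t gamma) as [->|ne].
    + split; [congruence|intros _]. split; [apply (CG y yl _ yL (L2 gamma))|].
      rewrite (y1L gamma), (yR a), (yL gamma), L0, L1, R0 by lra. fold d. unfold ya. field. apply d_neq0.
    + apply (DY y yl yr); auto.
      * intros. rewrite y1L by lra. apply L2.
      * intros. rewrite y1R by lra. apply R2.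
  - intros t Dt. destruct (Req_dec t gamma) as [->|ne].
    + split; [congruence|intros _]. split; [apply (CG y1 yl1 _ y1L (L3 gamma))|].
      unfold y2. rewrite sg, (y1L gamma), (y1R a), (yR a), L1, R1, R0 by lra. fold d. unfold ya1. field. apply d_neq0.
    + unfold y2. rewrite sn by auto. apply (DY y1 yl1 yr1); auto.
      * intros. rewrite yL by lra. apply L3'. destruct Dt; unfold seg; lra.
      * intros. rewrite yR by lra. apply R3'. destruct Dt; unfold seg; lra.
  - split.
    + intros t Dt ne. destruct Dt as [Ht|Ht].
      * assert (Ey : y2 t = (c * q t - lam * yl t)%C) by (unfold y2; rewrite sn, yL by lra; reflexivity).
        rewrite Ey. apply (filterlim_ext_loc (fun s => (c * q s - lam * yl s)%C)).
        -- assert (Hp : 0 < gamma - t) by lra. exists (mkposreal _ Hp). intros s Hs _.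
           change (Rabs (s - t) < gamma - t) in Hs. apply Rabs_def2 in Hs.
           unfold y2. rewrite sn, yL by lra. reflexivity.
        -- eapply Z; [now left|apply L2].
      * assert (Ey : y2 t = (c * q t - lam * yr t)%C) by (unfold y2; rewrite sn, yR by lra; reflexivity).
        rewrite Ey. apply (filterlim_ext_loc (fun s => (c * q s - lam * yr s)%C)).
        -- generalize (near_r t (proj1 Ht)). apply filter_imp. intros s Hs.
           unfold y2. rewrite sn, yR by lra. reflexivity.
        -- eapply Z; [now right|apply R2].
    + exists (c * q gamma - lam * yl gamma)%C.
      apply (filterlim_ext_loc (fun s => (c * q s - lam * yl s)%C)).
      * apply within_locally'. generalize (near_l gamma (Rle_refl _)). apply filter_imp. intros s Hs ne.
        unfold y2. rewrite sn, yL by lra. reflexivity.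
      * intros P HP. apply within_locally'.
        assert (Dg : D gamma) by (unfold T; lra).
        generalize (Z yl gamma _ Dg (L2 gamma) P HP). unfold filtermap. apply filter_imp. auto.
  - intros t Dt. unfold y2. rewrite (yL gamma), L0 by lra. ring.
  - rewrite yL by lra.
    assert (X : (yl1 gamma * sinr lam (0 - gamma) + yl gamma * cosr lam (0 - gamma)
      - (yl1 0 * sinr lam (0 - 0) + yl 0 * cosr lam (0 - 0)) = c * - I1)%C).
    { apply (segment lam c yl yl1 q 0 gamma 0); [lra|auto| | | |intros; now apply q_cwC|apply IC1].
      - intros t Ht. apply L3'. unfold seg; lra.
      - intros t Ht. eapply dC_cwC, L2.
      - intros t Ht. eapply dC_cwC, L3. }
    rewrite L0, L1, Rminus_0_l, Rminus_0_r, sinr_0, sinr_opp, cosr_opp, cosr_0 in X. fold S in X.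
    transitivity (- (e * - S + c * cosr lam gamma - (yl1 0 * 0 + yl 0 * 1)) - e * S + c * cosr lam gamma)%C; [ring|].
    rewrite X, E1. unfold B. ring.
  - rewrite yR by lra.
    assert (X : (yr1 b * sinr lam (b - b) + yr b * cosr lam (b - b)
      - (yr1 a * sinr lam (b - a) + yr a * cosr lam (b - a)) = c * I2)%C).
    { apply (segment lam c yr yr1 q a b b); [lra|auto| | | |intros; now apply q_cwC|apply IC2].
      - intros t Ht. apply R3'. unfold seg; lra.
      - intros t Ht. eapply dC_cwC, R2.
      - intros t Ht. eapply dC_cwC, R3. }
    rewrite R0, R1, (Rminus_diag_eq b b eq_refl), sinr_0, cosr_0 in X.
    transitivity ((yr1 b * 0 + yr b * 1 - (ya1 * sinr lam (b - a) + ya * cosr lam (b - a))) + (ya1 * sinr lam (b - a) + ya * cosr lam (b - a)))%C; [ring|].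
    rewrite X, <- E2. unfold A, c2, c2_fun, ya1, ya; fold d. unfold d. rewrite ?RtoC_minus. simpl Cpow. ring.
  - destruct (Ceq_dec c 0) as [c0|cn].
    + exists a. split; [unfold T; lra|]. rewrite yR, R0 by lra. unfold ya. rewrite c0, Cplus_0_l.
      apply Cmult_neq_0; [apply d_neq0|]. destruct nz; [contradiction|assumption].
    + exists gamma. split; [unfold T; lra|]. rewrite yL, L0 by lra. exact cn.
Qed.
End BVP.

Lemma char_fun_eq0 (gamma a b : R) (q : R -> C) (mu : C) :
  0 < gamma -> gamma < a -> a < b -> continuous_T gamma a b q ->
  char_fun gamma a b q mu = RtoC 0 <-> is_eigenvalue gamma a b q mu.
Proof.
  intros Hg Ha Hb Hq. split.
  - now apply char_eigenvalue.
  - now apply eigenvalue_char.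
Qed.

Lemma is_spectrum_char_fun (gamma a b : R) (q : R -> C) (lambda : nat -> C) :
  0 < gamma -> gamma < a -> a < b -> continuous_T gamma a b q ->
  is_spectrum gamma a b q lambda <->
  forall mu, exists m,
    occurs lambda mu m /\ is_zero_order (char_fun gamma a b q) mu m.
Proof.
  intros Hg Ha Hb Hq. split; [intros H; apply H|intros H; split; [intros mu|exact H]].
  rewrite <- (char_fun_eq0 gamma a b q mu) by assumption.
  destruct (H mu) as [m [[ks [_ [Hlen Hks]]] [g [_ [Hg0 Hloc]]]]].
  assert (E := locally_singleton _ _ Hloc). cbv beta in E. rewrite E.
  replace (mu - mu)%C with (RtoC 0) by ring.
  destruct m as [|m].
  - destruct ks; [|discriminate]. split.
    + intros [n Hn]. exfalso. now apply Hks in Hn.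
    + simpl. intros E'. exfalso. apply Hg0. rewrite <- E'. ring.
  - destruct ks as [|k ks]; [discriminate|]. split.
    + intros _. simpl. ring.
    + intros _. exists k. apply Hks. now left.
Qed.

(* Main.v *)
Require Import Defs.
From Stdlib Require Import Reals Lra List FinFun ClassicalEpsilon.
From Coquelicot Require Import Coquelicot.

(** Put [E(rho) = rho^2 * char_fun(rho^2)], an explicit entire function of [rho]
    with leading part [d^2 rho^3 sin(rho l) cos(rho gamma)], and let [F] be the
    same function for the second potential.  Equal spectra make [E / F - 1] an
    entire function (up to removable singularities); it is [O(1 / rho)] on large
    squares avoiding the zeros of [sin(rho l) cos(rho gamma)], so it vanishes by
    the maximum principle.  Hence, with [p] the difference of the potentials,
    [s * (d p(gamma) sin(rho l) / rho + J2) + c2 * J1 = 0], where [J1], [J2] are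
    the sine transforms of [p] over the two segments.  At the zeros [pi n / gamma]
    of [s] the function [c2] does not vanish, so all sine coefficients of [p] on
    [[0, gamma]] are zero and [p = 0] there; then [s * J2 = 0] gives [J2 = 0] and
    [p = 0] on [[a, b]]. *)

(** * Second-order expansions *)

(** The leading part is the product of [d^2 rho^2 sin(rho l)] from [c2] with [rho cos(rho gamma)].
    It does not involve the potential, so [E] and [F] share it and [E - F] is smaller by one power
    of [rho]. Comparing the two functions directly also fixes the constant factor, which the zeros
    alone leave free, and replaces a factorization over the zeros. The obstacle is that near a zero
    of [F] the quotient is only known to be bounded. Neither contour integrals nor a removable
    singularity theorem are used: the maximum principle rests on a mean over four points, and the
    behaviour at the zeros of [F] is handled by a weight. The order of the last two steps matters.
    At a zero of [s] the whole bracket with [p(gamma)] and [J2] is multiplied by 0, so [J1] can be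
    isolated. The resulting [p = 0] on the first segment includes [t = gamma], which removes the
    [p(gamma)] term before [J2] is treated. *)

Definition near0 (P : C -> Prop) : Prop :=
  exists e, 0 < e /\ forall h, Cmod h < e -> P h.

Definition bounded0 (r : C -> C) : Prop :=
  exists M, near0 (fun h => Cmod (r h) <= M).

Definition contC (f : C -> C) (z : C) : Prop :=
  forall eta, 0 < eta -> near0 (fun h => Cmod (f (z + h) - f z)%C < eta).

(** Unlike complex differentiability, this pointwise condition controls the
    second-order term, which is what makes the maximum principle elementary. *)
Definition taylor2 (f : C -> C) (z : C) : Prop :=
  exists (u v : C) (r : C -> C), bounded0 r /\
    near0 (fun h => f (z + h)%C = (f z + u * h + v * (h * h) + h * (h * h) * r h)%C).

Lemma near0_and P Q : near0 P -> near0 Q -> near0 (fun h => P h /\ Q h).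
Proof.
  intros [e [He H]] [e' [He' H']]. exists (Rmin e e'). split; [now apply Rmin_glb_lt|].
  intros h Hh. assert (A := Rmin_l e e'). assert (B := Rmin_r e e').
  split; [apply H|apply H']; lra.
Qed.

Lemma near0_imp (P Q : C -> Prop) : (forall h, P h -> Q h) -> near0 P -> near0 Q.
Proof. intros I [e [He H]]. exists e. split; auto. Qed.

Lemma near0_at0 P : near0 P -> P 0.
Proof. intros [e [He H]]. apply H. now rewrite Cmod_0. Qed.

Lemma near0_small e : 0 < e -> near0 (fun h => Cmod h < e).
Proof. intros He. now exists e. Qed.

Lemma bounded0_const c : bounded0 (fun _ => c).
Proof. exists (Cmod c). exists 1. split; [lra|]. intros; apply Rle_refl. Qed.

Lemma bounded0_id : bounded0 (fun h => h).
Proof. exists 1, 1. split; [lra|]. intros; lra. Qed.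

Lemma bounded0_plus r s : bounded0 r -> bounded0 s -> bounded0 (fun h => r h + s h)%C.
Proof.
  intros [M H] [M' H']. exists (M + M'). generalize (near0_and _ _ H H').
  apply near0_imp. intros h [A B]. eapply Rle_trans; [apply Cmod_triangle|lra].
Qed.

Lemma bounded0_opp r : bounded0 r -> bounded0 (fun h => - r h)%C.
Proof. intros [M H]. exists M. revert H. apply near0_imp. intros h. now rewrite Cmod_opp. Qed.

Lemma bounded0_mult r s : bounded0 r -> bounded0 s -> bounded0 (fun h => r h * s h)%C.
Proof.
  intros [M H] [M' H']. exists (M * M'). generalize (near0_and _ _ H H').
  apply near0_imp. intros h [A B]. rewrite Cmod_mult.
  apply Rmult_le_compat; auto using Cmod_ge_0.
Qed.

Lemma bounded0_ext r s : near0 (fun h => r h = s h) -> bounded0 r -> bounded0 s.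
Proof.
  intros E [M H]. exists M. generalize (near0_and _ _ E H). apply near0_imp.
  intros h [A B]. now rewrite <- A.
Qed.

Ltac bounded0 := repeat first
  [ assumption | apply bounded0_const | apply bounded0_id | apply bounded0_plus
  | apply bounded0_opp | apply bounded0_mult | unfold Cminus ].

Lemma taylor2_lip f z : taylor2 f z ->
  exists r, bounded0 r /\ near0 (fun h => f (z + h)%C = (f z + h * r h)%C).
Proof.
  intros [u [v [r [Hr E]]]]. exists (fun h => u + v * h + h * h * r h)%C. split.
  - bounded0.
  - revert E. apply near0_imp. intros h ->. ring.
Qed.

Lemma taylor2_cont f z : taylor2 f z -> contC f z.
Proof.
  intros H eta He. destruct (taylor2_lip f z H) as [r [[M HM] E]].
  assert (Hp : 0 < eta / (Rabs M + 1)) by (apply Rdiv_lt_0_compat; generalize (Rabs_pos M); lra).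
  generalize (near0_and _ _ (near0_and _ _ HM E) (near0_small _ Hp)). apply near0_imp.
  intros h [[A ->] B]. replace (f z + h * r h - f z)%C with (h * r h)%C by ring.
  rewrite Cmod_mult. assert (X := Rle_abs M). assert (Y := Cmod_ge_0 h). assert (Z := Cmod_ge_0 (r h)).
  apply Rle_lt_trans with (Cmod h * (Rabs M + 1)); [apply Rmult_le_compat_l; lra|].
  apply Rmult_lt_compat_r with (r := Rabs M + 1) in B; [|lra].
  replace (eta / (Rabs M + 1) * (Rabs M + 1)) with eta in B by (field; lra). exact B.
Qed.

Lemma contC_bounded f z : contC f z -> bounded0 (fun h => f (z + h)%C).
Proof.
  intros H. apply (bounded0_ext (fun h => f z + (f (z + h) - f z))%C).
  - exists 1. split; [lra|]. intros; ring.
  - apply bounded0_plus; [apply bounded0_const|]. exists 1.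
    generalize (H 1 Rlt_0_1). apply near0_imp. intros; lra.
Qed.

Lemma contC_neq0 f z : contC f z -> f z <> 0 ->
  near0 (fun h => Cmod (f z) / 2 <= Cmod (f (z + h)%C)).
Proof.
  intros H nz. apply Cmod_gt_0 in nz. assert (He : 0 < Cmod (f z) / 2) by lra.
  generalize (H _ He). apply near0_imp. intros h A.
  assert (X := Cmod_triangle (f (z + h)%C) (- (f (z + h) - f z))%C).
  rewrite Cmod_opp in X. replace (f (z + h) + - (f (z + h) - f z))%C with (f z) in X by ring. lra.
Qed.

Lemma taylor2_const c z : taylor2 (fun _ => c) z.
Proof. exists 0, 0, (fun _ => RtoC 0). split; [bounded0|]. exists 1. split; [lra|]. intros; ring. Qed.

Lemma taylor2_id z : taylor2 (fun w => w) z.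
Proof. exists 1, 0, (fun _ => RtoC 0). split; [bounded0|]. exists 1. split; [lra|]. intros; ring. Qed.

Lemma taylor2_plus f g z : taylor2 f z -> taylor2 g z -> taylor2 (fun w => f w + g w)%C z.
Proof.
  intros [u [v [r [Hr E]]]] [u' [v' [r' [Hr' E']]]].
  exists (u + u')%C, (v + v')%C, (fun h => r h + r' h)%C. split; [bounded0|].
  generalize (near0_and _ _ E E'). apply near0_imp. intros h [-> ->]. ring.
Qed.

Lemma taylor2_mult f g z : taylor2 f z -> taylor2 g z -> taylor2 (fun w => f w * g w)%C z.
Proof.
  intros [u [v [r [Hr E]]]] [u' [v' [r' [Hr' E']]]].
  exists (u * g z + f z * u')%C, (v * g z + u * u' + f z * v')%C,
   (fun h => u * v' + v * u' + h * (v * v') + r h * (g z + u' * h + v' * (h * h) + h * (h * h) * r' h)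
       + (f z + u * h + v * (h * h)) * r' h)%C.
  split; [bounded0|].
  generalize (near0_and _ _ E E'). apply near0_imp. intros h [-> ->]. ring.
Qed.

Lemma taylor2_opp f z : taylor2 f z -> taylor2 (fun w => - f w)%C z.
Proof.
  intros [u [v [r [Hr E]]]]. exists (- u)%C, (- v)%C, (fun h => - r h)%C.
  split; [bounded0|]. revert E. apply near0_imp. intros h ->. ring.
Qed.

Lemma taylor2_minus f g z : taylor2 f z -> taylor2 g z -> taylor2 (fun w => f w - g w)%C z.
Proof. intros A B. apply taylor2_plus; [exact A|now apply taylor2_opp]. Qed.

Lemma taylor2_pow f z n : taylor2 f z -> taylor2 (fun w => f w ^ n)%C z.
Proof.
  intros H. induction n as [|n IH]; [exact (taylor2_const 1 z)|].
  exact (taylor2_mult _ _ _ H IH).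
Qed.

Lemma taylor2_inv f z : taylor2 f z -> f z <> 0 -> taylor2 (fun w => / f w)%C z.
Proof.
  intros H nz. assert (L := contC_neq0 f z (taylor2_cont f z H) nz).
  assert (nz' := proj1 (Cmod_gt_0 (f z)) nz).
  assert (nzh : near0 (fun h => f (z + h)%C <> 0)).
  { revert L. apply near0_imp. intros h A. apply Cmod_gt_0. lra. }
  assert (BI : bounded0 (fun h => / f (z + h))%C).
  { exists (/ (Cmod (f z) / 2)). generalize (near0_and _ _ L nzh). apply near0_imp.
    intros h [A B]. rewrite Cmod_inv by assumption. apply Rinv_le_contravar; lra. }
  destruct H as [u [v [r [Hr E]]]].
  (* [k], [u'], [v'] are the Taylor coefficients of [1 / f], so one minus the product of their
     polynomial with [f (z + h)] has order [h^3]. Dividing by [f (z + h)], which stays away from 0,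
     gives the remainder. *)
  set (k := (/ f z)%C). set (u' := (- (u * (k * k)))%C). set (v' := (u * u * (k * (k * k)) - v * (k * k))%C).
  exists u', v', (fun h => - (u * v' + v * u' + h * (v * v') + r h * (k + u' * h + v' * (h * h))) * / f (z + h))%C.
  split; [bounded0|].
  generalize (near0_and _ _ nzh E). apply near0_imp. intros h [A B]. fold k.
  set (w := f (z + h)%C) in *.
  assert (X : (/ w - (k + u' * h + v' * (h * h)) = (1 - (k + u' * h + v' * (h * h)) * w) * / w)%C) by (field; exact A).
  assert (Y : (1 - (k + u' * h + v' * (h * h)) * w =
    - (h * (h * h)) * (u * v' + v * u' + h * (v * v') + r h * (k + u' * h + v' * (h * h))))%C).
  { rewrite B. unfold u', v', k. field. exact nz. }
  rewrite Y in X.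
  transitivity ((k + u' * h + v' * (h * h)) + (/ w - (k + u' * h + v' * (h * h))))%C; [ring|].
  rewrite X. ring.
Qed.

Lemma taylor2_ext f g z : (forall w, f w = g w) -> taylor2 f z -> taylor2 g z.
Proof.
  intros E [u [v [r [Hr H]]]]. exists u, v, r. split; [exact Hr|].
  revert H. apply near0_imp. intros h. now rewrite !E.
Qed.

(** * The maximum principle on squares *)

Definition square (S : R) (z : C) : Prop := Rabs (Re z) <= S /\ Rabs (Im z) <= S.

Lemma Cmod_le_sum (z : C) : Cmod z <= Rabs (Re z) + Rabs (Im z).
Proof.
  assert (E : z = (RtoC (Re z) + RtoC (Im z) * Ci)%C) by (apply C_ext; simpl; ring).
  rewrite E at 1. eapply Rle_trans; [apply Cmod_triangle|].
  rewrite Cmod_mult, !Cmod_R, Cmod_Ci, Rmult_1_r. apply Rle_refl.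
Qed.

(** Compactness with a gauge that serves two purposes: [delta] at a point is both a radius on which
    [f] is bounded and the reciprocal of such a bound. A uniform lower bound [d] of the gauge then
    yields the global bound [/ d]. *)
Lemma square_bounded (S : R) (f : C -> R) :
  (forall z, square S z -> exists M, near0 (fun h => f (z + h)%C <= M)) ->
  exists B, forall z, square S z -> f z <= B.
Proof.
  intros H.
  assert (L : forall x y, exists d : posreal, square S (x, y) ->
    forall h, Cmod h < 2 * d -> f ((x, y) + h)%C <= / d).
  { intros x y. destruct (classic (square S (x, y))) as [Hs|Hs].
    - destruct (H _ Hs) as [M [e [He E]]].
      assert (Hm : 0 < / (Rabs M + 1)) by (apply Rinv_0_lt_compat; generalize (Rabs_pos M); lra).
      assert (Hp : 0 < Rmin (e / 2) (/ (Rabs M + 1))) by (apply Rmin_glb_lt; lra).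
      exists (mkposreal _ Hp). intros _ h Hh. simpl in *.
      assert (A := Rmin_l (e / 2) (/ (Rabs M + 1))). assert (B := Rmin_r (e / 2) (/ (Rabs M + 1))).
      apply Rle_trans with M; [apply E; lra|].
      apply Rle_trans with (Rabs M + 1); [generalize (Rle_abs M); lra|].
      apply Rle_trans with (/ / (Rabs M + 1)); [rewrite Rinv_inv; apply Rle_refl|].
      apply Rinv_le_contravar; assumption.
    - exists (mkposreal 1 Rlt_0_1). tauto. }
  pose (delta := fun x y => proj1_sig (constructive_indefinite_description _ (L x y))).
  destruct (compactness_value_2d (- S) S (- S) S delta) as [d Hd].
  exists (/ d). intros [x y] [Hx Hy]. simpl in Hx, Hy.
  apply Rabs_le_between in Hx. apply Rabs_le_between in Hy.
  apply NNPP. intros N. apply (Hd x y Hx Hy). intros [u [v [Hu [Hv [Hxu [Hyv Hduv]]]]]]. apply N.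
  unfold delta in *. destruct (constructive_indefinite_description _ (L u v)) as [e He]. simpl in *.
  apply Rle_trans with (/ e); [|apply Rinv_le_contravar; [apply cond_pos|exact Hduv]].
  replace (x, y) with ((u, v) + ((x - u)%R, (y - v)%R))%C.
  - apply He; [split; simpl; now apply Rabs_le_between|].
    eapply Rle_lt_trans; [apply Cmod_le_sum|]. simpl. lra.
  - apply C_ext; simpl; ring.
Qed.

(** Upper semicontinuity suffices. If the supremum [m] were not attained, [1 / (m - u)] would be
    locally bounded, hence bounded on the square, and [u] would stay below [m] by a fixed amount. *)
Lemma square_max (S : R) (u : C -> R) : 0 <= S ->
  (forall z, square S z -> forall c, u z < c -> near0 (fun h => u (z + h)%C < c)) ->
  exists z0, square S z0 /\ forall z, square S z -> u z <= u z0.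
Proof.
  intros HS H.
  destruct (square_bounded S u) as [B HB].
  { intros z Hz. exists (u z + 1). assert (X : u z < u z + 1) by lra.
    generalize (H z Hz _ X). apply near0_imp. intros; lra. }
  destruct (completeness (fun y => exists z, square S z /\ y = u z)) as [m [Hm1 Hm2]].
  { exists B. intros y [z [Hz ->]]. now apply HB. }
  { exists (u 0), 0. split; [|reflexivity]. split; simpl; rewrite Rabs_R0; exact HS. }
  destruct (classic (exists z0, square S z0 /\ m <= u z0)) as [[z0 [Hz0 Hm]]|N].
  { exists z0. split; [exact Hz0|]. intros z Hz. apply Rle_trans with m; [|exact Hm].
    apply Hm1. now exists z. }
  exfalso.
  assert (lt : forall z, square S z -> u z < m).
  { intros z Hz. apply Rnot_le_lt. intros X. apply N. now exists z. }
  destruct (square_bounded S (fun z => / (m - u z))) as [K HK].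
  { intros z Hz. exists (/ ((m - u z) / 2)). assert (X := lt z Hz).
    assert (Y : u z < (u z + m) / 2) by lra.
    generalize (H z Hz _ Y). apply near0_imp. intros h Hh. apply Rinv_le_contravar; lra. }
  assert (K1 : 0 < Rmax K 1) by (generalize (Rmax_r K 1); lra).
  assert (X : m <= m - / Rmax K 1).
  { apply Hm2. intros y [z [Hz ->]]. assert (X := lt z Hz).
    assert (Y : / Rmax K 1 <= m - u z).
    { rewrite <- (Rinv_inv (m - u z)). apply Rinv_le_contravar.
      - apply Rinv_0_lt_compat; lra.
      - eapply Rle_trans; [now apply HK|apply Rmax_l]. }
    lra. }
  assert (Y := Rinv_0_lt_compat _ K1). lra.
Qed.

Lemma Cmod_sqr (z : C) : Cmod z ^ 2 = Re z * Re z + Im z * Im z.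
Proof. rewrite Cmod2_alt. ring. Qed.

Lemma Cmod_sqr_plus_ge (p e : C) : Cmod p ^ 2 - 2 * Cmod p * Cmod e <= Cmod (p + e)%C ^ 2.
Proof.
  assert (X := Cmod_triangle (p + e)%C (- e)%C). rewrite Cmod_opp in X.
  replace (p + e + - e)%C with p in X by ring.
  assert (A := Cmod_ge_0 p). assert (B := Cmod_ge_0 e). assert (D := Cmod_ge_0 (p + e)%C).
  destruct (Rle_lt_dec (Cmod e) (Cmod p)); [|nra].
  assert (Y : (Cmod p - Cmod e) ^ 2 <= Cmod (p + e)%C ^ 2) by (apply pow_incr; lra). nra.
Qed.

(* The cross terms cancel because [t], [-t], [it], [-it] and their squares sum to 0. *)
Lemma four_points (k u v : C) (t : R) :
  Cmod (k + u * t + v * (t * t))%C ^ 2 + Cmod (k + u * (- t) + v * (- t * - t))%C ^ 2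
  + Cmod (k + u * (t * Ci) + v * ((t * Ci) * (t * Ci)))%C ^ 2
  + Cmod (k + u * (- (t * Ci)) + v * (- (t * Ci) * - (t * Ci)))%C ^ 2
  = 4 * Cmod k ^ 2 + 4 * Cmod u ^ 2 * t ^ 2 + 4 * Cmod v ^ 2 * t ^ 4.
Proof. rewrite !Cmod_sqr. destruct k, u, v. simpl. ring. Qed.

(** Averaging over the increments [t], [-t], [it], [-it], the quadratic part of [K] does not lower
    the mean of [|K|^2], the weight raises the mean by [eps t^2], and the remainder costs at most
    [2 A M t^3]. For small [t] the mean exceeds the value at [z]. *)
Lemma no_strict_max (K : C -> C) (z : C) (eps : R) : 0 < eps -> taylor2 K z ->
  near0 (fun h => Cmod (K (z + h)%C) ^ 2 + eps * Cmod (z + h)%C ^ 2 <= Cmod (K z) ^ 2 + eps * Cmod z ^ 2) ->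
  False.
Proof.
  intros He [u [v [r [[M HM] E]]]] H.
  set (k := K z) in *.
  destruct (near0_and _ _ HM (near0_and _ _ E H)) as [e [Hep HE]].
  set (A := Cmod k + Cmod u + Cmod v).
  assert (A0 : 0 <= A) by (unfold A; generalize (Cmod_ge_0 k) (Cmod_ge_0 u) (Cmod_ge_0 v); lra).
  assert (M0 : 0 <= M).
  { eapply Rle_trans; [apply Cmod_ge_0|]. apply (HE 0). now rewrite Cmod_0. }
  assert (AM : 0 <= A * M) by now apply Rmult_le_pos.
  (* [t < e] keeps the four points in the neighbourhood, [t <= 1] bounds the quadratic part by [A],
     and the last term makes [2 A M t < eps]. *)
  set (t := Rmin (Rmin (e / 2) 1) (eps / (4 * (A * M) + 1))).
  assert (Hq : 0 < eps / (4 * (A * M) + 1)) by (apply Rdiv_lt_0_compat; lra).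
  assert (t0 : 0 < t) by (repeat apply Rmin_glb_lt; lra).
  assert (te : t < e).
  { assert (X := Rmin_l (Rmin (e / 2) 1) (eps / (4 * (A * M) + 1))). assert (Y := Rmin_l (e / 2) 1). fold t in X. lra. }
  assert (t1 : t <= 1).
  { assert (X := Rmin_l (Rmin (e / 2) 1) (eps / (4 * (A * M) + 1))). assert (Y := Rmin_r (e / 2) 1). fold t in X. lra. }
  assert (tq : t * (4 * (A * M) + 1) <= eps).
  { assert (X := Rmin_r (Rmin (e / 2) 1) (eps / (4 * (A * M) + 1))). fold t in X.
    apply Rmult_le_compat_r with (r := 4 * (A * M) + 1) in X; [|lra].
    replace (eps / (4 * (A * M) + 1) * (4 * (A * M) + 1)) with eps in X by (field; lra). exact X. }
  assert (P : forall h, Cmod h = t ->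
    Cmod (k + u * h + v * (h * h))%C ^ 2 - 2 * (A * M) * t ^ 3 + eps * Cmod (z + h)%C ^ 2
    <= Cmod k ^ 2 + eps * Cmod z ^ 2).
  { intros h Hh. destruct (HE h) as [B1 [B2 B3]]; [lra|]. rewrite B2 in B3.
    assert (X := Cmod_sqr_plus_ge (k + u * h + v * (h * h))%C (h * (h * h) * r h)%C).
    assert (Y : Cmod (k + u * h + v * (h * h))%C <= A).
    { eapply Rle_trans; [apply Cmod_triangle|]. rewrite !Cmod_mult, Hh.
      assert (Z := Cmod_triangle k (u * h)%C). rewrite Cmod_mult, Hh in Z.
      assert (Z1 : Cmod u * t <= Cmod u * 1) by (apply Rmult_le_compat_l; [apply Cmod_ge_0|exact t1]).
      assert (Z2 : Cmod v * (t * t) <= Cmod v * 1) by (apply Rmult_le_compat_l; [apply Cmod_ge_0|nra]).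
      unfold A. lra. }
    assert (W : Cmod (h * (h * h) * r h)%C <= t ^ 3 * M).
    { rewrite !Cmod_mult, Hh. replace (t ^ 3) with (t * (t * t)) by ring.
      apply Rmult_le_compat_l; [nra|exact B1]. }
    assert (V : Cmod (k + u * h + v * (h * h))%C * Cmod (h * (h * h) * r h)%C <= A * (t ^ 3 * M)).
    { apply Rmult_le_compat; auto using Cmod_ge_0. }
    lra. }
  assert (N1 : Cmod (RtoC t) = t) by (rewrite Cmod_R; apply Rabs_pos_eq; lra).
  assert (N2 : Cmod (t * Ci)%C = t) by (rewrite Cmod_mult, Cmod_Ci, N1; ring).
  assert (P1 := P _ N1). assert (P2 := P _ N2).
  assert (P3 := P _ (eq_trans (Cmod_opp _) N1)). assert (P4 := P _ (eq_trans (Cmod_opp _) N2)).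
  assert (F := four_points k u v t).
  assert (G : Cmod (z + t)%C ^ 2 + Cmod (z + - t)%C ^ 2 + Cmod (z + t * Ci)%C ^ 2 + Cmod (z + - (t * Ci))%C ^ 2
    = 4 * Cmod z ^ 2 + 4 * t ^ 2).
  { rewrite !Cmod_sqr. destruct z. simpl. ring. }
  assert (0 <= Cmod u ^ 2 * t ^ 2) by (rewrite <- Rpow_mult_distr; apply pow2_ge_0).
  assert (0 <= Cmod v ^ 2 * t ^ 4).
  { replace (Cmod v ^ 2 * t ^ 4) with ((Cmod v * t ^ 2) ^ 2) by ring. apply pow2_ge_0. }
  assert (X : 4 * eps * t ^ 2 <= 8 * (A * M) * t ^ 3).
  { assert (Y := f_equal (Rmult eps) G). lra. }
  assert (Z : t ^ 2 * eps <= t ^ 2 * (2 * (A * M) * t)) by lra.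
  apply Rmult_le_reg_l in Z; [|apply pow_lt; exact t0]. nra.
Qed.

(** At an interior maximum of [|K|^2 + eps |z|^2] the function [K] must vanish,
    which gives the bound up to [O(eps)]. *)
Lemma maximum_principle (S B : R) (K : C -> C) : 0 < S ->
  (forall z, taylor2 K z \/ (K z = 0 /\ contC K z)) ->
  (forall z, square S z -> Rabs (Re z) = S \/ Rabs (Im z) = S -> Cmod (K z) <= B) ->
  forall z, square S z -> Cmod (K z) <= B.
Proof.
  intros HS HK HB z Hz.
  assert (B0 : 0 <= B).
  { eapply Rle_trans; [apply Cmod_ge_0|]. apply (HB (S, 0)).
    - split; simpl; rewrite ?Rabs_R0, ?(Rabs_pos_eq S); lra.
    - left; simpl. apply Rabs_pos_eq; lra. }
  assert (contK : forall w, contC K w).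
  { intros w. destruct (HK w) as [A|[_ A]]; [now apply taylor2_cont|exact A]. }
  assert (Q : forall eps, 0 < eps -> Cmod (K z) ^ 2 <= B ^ 2 + 2 * eps * S ^ 2).
  { intros eps He. set (u := fun w => Cmod (K w) ^ 2 + eps * Cmod w ^ 2).
    assert (bd : forall w, square S w -> eps * Cmod w ^ 2 <= 2 * eps * S ^ 2).
    { intros w [Hw1 Hw2]. rewrite Cmod_sqr.
      assert (X : Re w * Re w <= S ^ 2).
      { apply Rabs_le_between in Hw1. nra. }
      assert (Y : Im w * Im w <= S ^ 2) by (apply Rabs_le_between in Hw2; nra).
      nra. }
    destruct (square_max S u) as [z0 [Hz0 Hmax]]; [lra| |].
    { intros w _ c Hc.
      (* For [d <= 1], changing [K w] and [w] by at most [d] raises [u] by at most [d * m], because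
         [(x + d)^2 <= x^2 + d (2 x + 1)]. *)
      set (m := 2 * Cmod (K w) + 1 + eps * (2 * Cmod w + 1)).
      assert (A := Cmod_ge_0 (K w)). assert (A' := Cmod_ge_0 w).
      assert (m0 : 0 < m) by (unfold m; nra).
      assert (Hd : 0 < (c - u w) / m) by (apply Rdiv_lt_0_compat; lra).
      set (d := Rmin 1 ((c - u w) / m)). assert (d0 : 0 < d) by (apply Rmin_glb_lt; lra).
      assert (d1 : d <= 1) by apply Rmin_l.
      assert (dm : d * m <= c - u w).
      { apply Rle_trans with ((c - u w) / m * m); [|right; field; lra].
        apply Rmult_le_compat_r; [lra|apply Rmin_r]. }
      generalize (near0_and _ _ (contK w d d0) (near0_small _ d0)). apply near0_imp. intros h [H1 H2].
      assert (X := Cmod_triangle (K w) (K (w + h) - K w)%C).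
      replace (K w + (K (w + h) - K w))%C with (K (w + h)%C) in X by ring.
      assert (Y := Cmod_triangle w h). assert (X0 := Cmod_ge_0 (K (w + h)%C)). assert (Y0 := Cmod_ge_0 (w + h)%C).
      assert (X1 : Cmod (K (w + h)%C) ^ 2 < (Cmod (K w) + d) ^ 2) by nra.
      assert (Y1 : Cmod (w + h)%C ^ 2 <= (Cmod w + d) ^ 2) by (apply pow_incr; lra).
      assert (Y2 := Rmult_le_compat_l eps _ _ (Rlt_le _ _ He) Y1).
      assert (Z : d * d <= d) by nra. assert (Z' := Rmult_le_compat_l eps _ _ (Rlt_le _ _ He) Z).
      apply Rlt_le_trans with (u w + d * m); [|lra]. unfold u, m. lra. }
    assert (M1 := Hmax z Hz). unfold u in M1 at 1.
    assert (E0 : 0 <= eps * Cmod z ^ 2) by (apply Rmult_le_pos; [lra|apply pow2_ge_0]).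
    assert (bz := bd z0 Hz0).
    destruct (classic (Rabs (Re z0) = S \/ Rabs (Im z0) = S)) as [onb|inn].
    - assert (X := HB z0 Hz0 onb). assert (Y := Cmod_ge_0 (K z0)). unfold u in M1.
      assert (Cmod (K z0) ^ 2 <= B ^ 2) by (apply pow_incr; lra). lra.
    - destruct (HK z0) as [T2|[Kz _]].
      + exfalso. apply (no_strict_max K z0 eps He T2).
        destruct Hz0 as [Hr Hi].
        assert (Hr' : Rabs (Re z0) < S) by (destruct Hr; tauto).
        assert (Hi' : Rabs (Im z0) < S) by (destruct Hi; tauto).
        exists (Rmin (S - Rabs (Re z0)) (S - Rabs (Im z0))). split; [apply Rmin_glb_lt; lra|].
        intros h Hh. apply (Hmax (z0 + h)%C).
        assert (X := Rmin_l (S - Rabs (Re z0)) (S - Rabs (Im z0))).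
        assert (Y := Rmin_r (S - Rabs (Re z0)) (S - Rabs (Im z0))).
        assert (A1 := re_le_Cmod h). assert (A2 := Rmax_Cmod h).
        assert (A3 := Rmax_r (Rabs (fst h)) (Rabs (snd h))).
        split; simpl; (eapply Rle_trans; [apply Rabs_triang|]); unfold Re, Im in *; lra.
      + unfold u in M1. rewrite Kz, Cmod_0 in M1. assert (Y := pow2_ge_0 B). lra. }
  apply Rnot_lt_le. intros N.
  assert (X : 0 < Cmod (K z) ^ 2 - B ^ 2) by nra.
  assert (Y : 0 < 4 * S ^ 2) by nra.
  (* With this [eps] the error [2 eps S^2] is half of the supposed excess over [B ^ 2]. *)
  assert (He : 0 < (Cmod (K z) ^ 2 - B ^ 2) / (4 * S ^ 2)) by (apply Rdiv_lt_0_compat; assumption).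
  assert (Z := Q _ He).
  replace (2 * ((Cmod (K z) ^ 2 - B ^ 2) / (4 * S ^ 2)) * S ^ 2) with ((Cmod (K z) ^ 2 - B ^ 2) / 2) in Z by (field; lra).
  lra.
Qed.

(** * Complex sine and cosine *)

Lemma Csin_plus z w : Csin (z + w) = (Csin z * Ccos w + Ccos z * Csin w)%C.
Proof.
  destruct z as [x y], w as [x' y']. unfold Csin, Ccos; apply C_ext; simpl;
    rewrite ?sin_plus, ?cos_plus; unfold cosh, sinh; rewrite Ropp_plus_distr, !exp_plus; field.
Qed.

Lemma cosh2_sinh2 y : cosh y * cosh y = 1 + sinh y * sinh y.
Proof.
  unfold cosh, sinh. assert (exp y * exp (- y) = 1) by (rewrite <- exp_plus, Rplus_opp_r; apply exp_0). nra.
Qed.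

Lemma cosh_ge_1 y : 1 <= cosh y.
Proof.
  assert (A := cosh2_sinh2 y).
  assert (B : 0 < cosh y) by (unfold cosh; generalize (exp_pos y) (exp_pos (- y)); lra). nra.
Qed.

Lemma cosh_le x y : 0 <= x <= y -> cosh x <= cosh y.
Proof.
  intros [H0 H]. unfold cosh.
  assert (A : exp x <= exp y) by (destruct H as [H| ->]; [left; now apply exp_increasing|right; reflexivity]).
  assert (B : 1 <= exp x) by (rewrite <- exp_0; destruct H0 as [H0|<-]; [left; now apply exp_increasing|right; reflexivity]).
  assert (exp y * exp (- y) = 1) by (rewrite <- exp_plus, Rplus_opp_r; apply exp_0).
  assert (exp x * exp (- x) = 1) by (rewrite <- exp_plus, Rplus_opp_r; apply exp_0).
  assert (P := exp_pos (- y)). assert (P' := exp_pos (- x)).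
  (* The loss in [exp (- x)] is at most the gain in [exp x], since the factor
     [exp (- x) * exp (- y)] is at most 1. *)
  assert (D : exp (- x) - exp (- y) = (exp y - exp x) * (exp (- x) * exp (- y))).
  { transitivity ((exp y * exp (- y)) * exp (- x) - (exp x * exp (- x)) * exp (- y)); [rewrite H1, H2; ring|ring]. }
  assert (exp (- x) <= 1) by nra. assert (exp (- y) <= 1) by nra.
  assert (exp (- x) * exp (- y) <= 1) by nra.
  assert ((exp y - exp x) * (exp (- x) * exp (- y)) <= (exp y - exp x) * 1) by (apply Rmult_le_compat_l; lra).
  lra.
Qed.

Lemma cosh_le_abs x y : Rabs x <= Rabs y -> cosh x <= cosh y.
Proof.
  assert (E : forall u, cosh (Rabs u) = cosh u).
  { intros u. unfold Rabs. destruct Rcase_abs; [apply cosh_opp|reflexivity]. }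
  intros H. rewrite <- (E x), <- (E y). apply cosh_le. split; [apply Rabs_pos|exact H].
Qed.

Lemma Cmod_Csin z : Cmod (Csin z) ^ 2 = sin (Re z) ^ 2 + sinh (Im z) ^ 2.
Proof.
  destruct z as [x y]. rewrite Cmod_sqr. simpl.
  assert (A := sin2_cos2 x). unfold Rsqr in A. assert (B := cosh2_sinh2 y).
  transitivity (sin x * sin x * (cosh y * cosh y) + cos x * cos x * (sinh y * sinh y)); [ring|].
  rewrite B. replace (cos x * cos x) with (1 - sin x * sin x) by lra. ring.
Qed.

Lemma Cmod_Ccos z : Cmod (Ccos z) ^ 2 = cos (Re z) ^ 2 + sinh (Im z) ^ 2.
Proof.
  destruct z as [x y]. rewrite Cmod_sqr. simpl.
  assert (A := sin2_cos2 x). unfold Rsqr in A. assert (B := cosh2_sinh2 y).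
  transitivity (cos x * cos x * (cosh y * cosh y) + sin x * sin x * (sinh y * sinh y)); [ring|].
  rewrite B. replace (sin x * sin x) with (1 - cos x * cos x) by lra. ring.
Qed.

Lemma Cmod_Csin_le z : Cmod (Csin z) <= cosh (Im z).
Proof.
  assert (A := Cmod_Csin z). assert (B := cosh2_sinh2 (Im z)). assert (D := cosh_ge_1 (Im z)).
  assert (E := SIN_bound (Re z)). assert (F := Cmod_ge_0 (Csin z)).
  apply Rsqr_incr_0_var; [unfold Rsqr; nra|lra].
Qed.

Lemma Cmod_Ccos_le z : Cmod (Ccos z) <= cosh (Im z).
Proof.
  assert (A := Cmod_Ccos z). assert (B := cosh2_sinh2 (Im z)). assert (D := cosh_ge_1 (Im z)).
  assert (E := COS_bound (Re z)). assert (F := Cmod_ge_0 (Ccos z)).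
  apply Rsqr_incr_0_var; [unfold Rsqr; nra|lra].
Qed.

Lemma cosh_Im_le (rho : C) t L : 0 <= t <= L -> cosh (Im (rho * t)%C) <= cosh (Im rho * L).
Proof.
  intros H. apply cosh_le_abs. simpl. rewrite Rmult_0_r, Rplus_0_l, !Rabs_mult.
  apply Rmult_le_compat_l; [apply Rabs_pos|]. rewrite !Rabs_pos_eq; lra.
Qed.

(** The mean value theorem holds for the real and imaginary parts separately, hence the factor 2;
    the same splitting gives the 2 in [IC_bound]. *)
Lemma dC_bound (f g : R -> C) M :
  (forall s, 0 <= s <= 1 -> dC f s (g s)) -> (forall s, 0 <= s <= 1 -> Cmod (g s) <= M) ->
  forall s, 0 <= s <= 1 -> Cmod (f s - f 0%R)%C <= 2 * M.
Proof.
  intros D B s Hs.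
  assert (M0 : 0 <= M) by (eapply Rle_trans; [apply Cmod_ge_0|apply (B s Hs)]).
  assert (X : forall p p' : R -> R, (forall x, 0 <= x <= 1 -> is_derive p x (p' x)) ->
    (forall x, 0 <= x <= 1 -> Rabs (p' x) <= M) -> Rabs (p s - p 0) <= M).
  { intros p p' Hp Hb. destruct (MVT_gen p 0 s p') as [c [Hc E]].
    - intros x Hx. rewrite Rmin_left, Rmax_right in Hx by lra. apply Hp; lra.
    - intros x Hx. rewrite Rmin_left, Rmax_right in Hx by lra. apply continuity_pt_filterlim.
      apply (ex_derive_continuous (K := R_AbsRing) (V := R_NormedModule)). eexists. apply Hp; lra.
    - rewrite Rmin_left, Rmax_right in Hc by lra. rewrite E, Rminus_0_r, Rabs_mult, (Rabs_pos_eq s) by lra.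
      assert (Y := Hb c ltac:(lra)). generalize (Rabs_pos (p' c)). nra. }
  eapply Rle_trans; [apply Cmod_le_sum|].
  assert (A1 := X (fun x => Re (f x)) (fun x => Re (g x)) (fun x Hx => proj1 (D x Hx))
    (fun x Hx => Rle_trans _ _ _ (re_le_Cmod _) (B x Hx))).
  assert (A2 := X (fun x => Im (f x)) (fun x => Im (g x)) (fun x Hx => proj2 (D x Hx))
    (fun x Hx => Rle_trans _ _ _ (Rle_trans _ _ _ (Rmax_r _ _) (Rmax_Cmod _)) (B x Hx))).
  simpl in A1, A2. unfold Rminus in A1, A2. simpl. unfold Re, Im in *. lra.
Qed.

Lemma dC_lin (w : C) s : dC (fun x => w * x)%C s w.
Proof.
  split; simpl; auto_derive; auto; simpl; unfold Re, Im; simpl; ring.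
Qed.

(** Starting from the bound [cosh 1] for the cosine along the segment from 0 to [w], each use of
    [dC_bound] gains one Taylor order and a factor [2 |w|]. The sine needs three uses and the cosine
    four, so [16 * cosh 1] serves both when [|w| <= 1]. *)
Lemma Csin_Ccos_small : exists c, 0 <= c /\ forall w, Cmod w <= 1 ->
  Cmod (Csin w - w)%C <= c * Cmod w ^ 3 /\ Cmod (Ccos w - 1 + w * w / 2)%C <= c * Cmod w ^ 3.
Proof.
  set (c := cosh 1). assert (c1 : 1 <= c) by apply cosh_ge_1.
  exists (16 * c). split; [lra|]. intros w Hw. assert (w0 := Cmod_ge_0 w).
  assert (B : forall s, 0 <= s <= 1 -> cosh (Im (w * s)%C) <= c).
  { intros s Hs. apply cosh_le_abs. simpl. rewrite Rmult_0_r, Rplus_0_l, Rabs_mult, (Rabs_pos_eq s), Rabs_R1 by lra.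
    assert (X := Rle_trans _ _ _ (Rmax_r _ _) (Rmax_Cmod w)).
    change (Rabs (Im w) <= Cmod w) in X. generalize (Rabs_pos (Im w)). unfold Im in *. nra. }
  assert (z0 : (w * RtoC 0)%C = 0) by ring.
  assert (S1 : forall s, 0 <= s <= 1 -> Cmod (Csin (w * s)) <= 2 * (Cmod w * c)).
  { intros s Hs. replace (Csin (w * s)) with (Csin (w * s) - Csin (w * 0))%C by (rewrite z0, Csin_0; ring).
    apply (dC_bound (fun s => Csin (w * s)) (fun s => w * Ccos (w * s))%C); auto.
    - intros; apply Csin_lin.
    - intros x Hx. rewrite Cmod_mult. apply Rmult_le_compat_l; [exact w0|].
      eapply Rle_trans; [apply Cmod_Ccos_le|now apply B]. }
  assert (S2 : forall s, 0 <= s <= 1 -> Cmod (Ccos (w * s) - 1)%C <= 2 * (Cmod w * (2 * (Cmod w * c)))).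
  { intros s Hs. replace (Ccos (w * s) - 1)%C with (Ccos (w * s) - Ccos (w * 0))%C by (rewrite z0, Ccos_0; ring).
    apply (dC_bound (fun s => Ccos (w * s)) (fun s => - w * Csin (w * s))%C); auto.
    - intros; apply Ccos_lin.
    - intros x Hx. rewrite Cmod_mult, Cmod_opp. apply Rmult_le_compat_l; [exact w0|]. now apply S1. }
  assert (S3 : forall s, 0 <= s <= 1 -> Cmod (Csin (w * s) - w * s)%C <= 2 * (Cmod w * (2 * (Cmod w * (2 * (Cmod w * c)))))).
  { intros s Hs. replace (Csin (w * s) - w * s)%C with ((Csin (w * s) - w * s) - (Csin (w * 0) - w * 0))%C
      by (rewrite z0, Csin_0; ring).
    apply (dC_bound (fun s => Csin (w * s) - w * s)%C (fun s => w * (Ccos (w * s) - 1))%C); auto.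
    - intros x _. eapply dC_eq; [apply dC_minus; [apply Csin_lin|apply dC_lin]|]. ring.
    - intros x Hx. rewrite Cmod_mult. apply Rmult_le_compat_l; [exact w0|]. now apply S2. }
  assert (S4 : forall s, 0 <= s <= 1 -> Cmod (Ccos (w * s) - 1 + (w * s) * (w * s) / 2)%C
      <= 2 * (Cmod w * (2 * (Cmod w * (2 * (Cmod w * (2 * (Cmod w * c)))))))).
  { intros s Hs. replace (Ccos (w * s) - 1 + (w * s) * (w * s) / 2)%C
      with ((Ccos (w * s) + (w * s) * (w * s) * / 2) - (Ccos (w * 0) + (w * 0) * (w * 0) * / 2))%C
      by (rewrite z0, Ccos_0; unfold Cdiv; ring).
    apply (dC_bound (fun s => Ccos (w * s) + (w * s) * (w * s) * / 2)%C (fun s => - w * (Csin (w * s) - w * s))%C); auto.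
    - intros x _. eapply dC_eq; [apply dC_plus; [apply Ccos_lin|
        apply dC_mult; [apply dC_mult; apply dC_lin|apply (dC_const (/ 2)%C)]]|].
      assert (E2 : (/ 2 + / 2)%C = 1) by (apply C_ext; simpl; field).
      transitivity (- w * Csin (w * x) + w * w * x * (/ 2 + / 2))%C; [ring|rewrite E2; ring].
    - intros x Hx. rewrite Cmod_mult, Cmod_opp. apply Rmult_le_compat_l; [exact w0|]. now apply S3. }
  assert (X3 := S3 1 ltac:(lra)). assert (X4 := S4 1 ltac:(lra)).
  rewrite Cmult_1_r in X3, X4.
  assert (Y : 0 <= Cmod w ^ 3) by now apply pow_le.
  assert (Y' : c * Cmod w ^ 3 * Cmod w <= c * Cmod w ^ 3 * 1) by (apply Rmult_le_compat_l; nra).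
  split; nra.
Qed.

(** * Sine transforms *)

Definition contR (f : R -> C) : Prop := forall t, cwC (fun _ => True) f t.

Lemma contR_mult f g : contR f -> contR g -> contR (fun t => f t * g t)%C.
Proof. intros A B t. now apply cwC_mult. Qed.

Lemma contR_dC f g : (forall t, dC f t (g t)) -> contR f.
Proof. intros H t. eapply dC_cwC, H. Qed.

Lemma cw_True_continuous (f : R -> R) t : cw (fun _ => True) f t -> continuous f t.
Proof. intros H P HP. generalize (H P HP). unfold filtermap, within. apply filter_imp. auto. Qed.

Lemma contR_IC f L : contR f -> 0 <= L -> IC f 0 L (RInt (V := C_R_CompleteNormedModule) f 0 L).
Proof. intros H HL. apply ex_IC; [exact HL|]. intros t _. apply (cwC_sub (fun _ => True)); auto. Qed.

Lemma contR_bounded f L : contR f -> 0 <= L -> exists M, 0 <= M /\ forall t, 0 <= t <= L -> Cmod (f t) <= M.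
Proof.
  intros H HL.
  destruct (continuity_ab_maj (fun t => Rabs (Re (f t)) + Rabs (Im (f t))) 0 L HL) as [m [Hm _]].
  { intros c _. apply continuity_pt_filterlim. apply (continuous_plus (V := R_NormedModule) (fun t => Rabs (Re (f t))) (fun t => Rabs (Im (f t)))).
    - apply (continuous_Rabs_comp (fun t => Re (f t))), cw_True_continuous. apply H.
    - apply (continuous_Rabs_comp (fun t => Im (f t))), cw_True_continuous. apply H. }
  exists (Rabs (Re (f m)) + Rabs (Im (f m))). split.
  - generalize (Rabs_pos (Re (f m))) (Rabs_pos (Im (f m))). lra.
  - intros t Ht. eapply Rle_trans; [apply Cmod_le_sum|now apply Hm].
Qed.

Lemma IC_plus f g u v l m : IC f u v l -> IC g u v m -> IC (fun t => f t + g t)%C u v (l + m)%C.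
Proof. intros [A B] [A' B']; split; [exact (is_RInt_plus _ _ _ _ _ _ A A')|exact (is_RInt_plus _ _ _ _ _ _ B B')]. Qed.

Lemma IC_bound f L l M : 0 <= L -> IC f 0 L l -> (forall t, 0 <= t <= L -> Cmod (f t) <= M) -> Cmod l <= 2 * L * M.
Proof.
  intros HL [A B] H. eapply Rle_trans; [apply Cmod_le_sum|].
  assert (X : forall p k, is_RInt p 0 L k -> (forall t, 0 <= t <= L -> Rabs (p t) <= M) -> Rabs k <= L * M).
  { intros p k Hk Hb. rewrite <- (is_RInt_unique _ _ _ _ Hk). rewrite <- (Rminus_0_r L) at 2.
    apply abs_RInt_le_const; [exact HL|eexists; exact Hk|exact Hb]. }
  assert (Y := X _ _ A (fun t Ht => Rle_trans _ _ _ (re_le_Cmod _) (H t Ht))).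
  assert (Z := X _ _ B (fun t Ht => Rle_trans _ _ _ (Rle_trans _ _ _ (Rmax_r _ _) (Rmax_Cmod _)) (H t Ht))).
  lra.
Qed.

Definition sine_int (L : R) (f : R -> C) (rho : C) : C :=
  RInt (V := C_R_CompleteNormedModule) (fun t => Csin (rho * t) * f t)%C 0 L.

Lemma contR_sine f rho : contR f -> contR (fun t => Csin (rho * t) * f t)%C.
Proof. intros H. apply contR_mult; [|exact H]. eapply contR_dC. intros t. apply Csin_lin. Qed.

Lemma IC_sine_int L f rho : 0 <= L -> contR f ->
  IC (fun t => Csin (rho * t) * f t)%C 0 L (sine_int L f rho).
Proof. intros HL H. apply contR_IC; [now apply contR_sine|exact HL]. Qed.

Lemma sine_int_minus L f g rho : 0 <= L -> contR f -> contR g ->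
  sine_int L (fun t => f t - g t)%C rho = (sine_int L f rho - sine_int L g rho)%C.
Proof.
  intros HL Hf Hg. apply IC_RInt.
  replace (sine_int L f rho - sine_int L g rho)%C with (sine_int L f rho + - (1) * sine_int L g rho)%C by ring.
  eapply IC_ext; [|exact (IC_plus _ _ _ _ _ _ (IC_sine_int L f rho HL Hf)
    (IC_scal _ _ _ _ (- (1))%C (IC_sine_int L g rho HL Hg)))].
  intros t. cbv beta. ring.
Qed.

Lemma sine_int_bound L f : 0 <= L -> contR f -> exists M, 0 <= M /\
  forall rho, Cmod (sine_int L f rho) <= M * cosh (Im rho * L).
Proof.
  intros HL H. destruct (contR_bounded f L H HL) as [M [M0 HM]].
  exists (2 * L * M). split; [apply Rmult_le_pos; lra|]. intros rho.
  replace (2 * L * M * cosh (Im rho * L)) with (2 * L * (cosh (Im rho * L) * M)) by ring.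
  apply (IC_bound (fun t => Csin (rho * t) * f t)%C); [exact HL|now apply IC_sine_int|].
  intros t Ht. rewrite Cmod_mult. apply Rmult_le_compat; auto using Cmod_ge_0.
  eapply Rle_trans; [apply Cmod_Csin_le|now apply cosh_Im_le].
Qed.

(** The remainder is taken as the quotient by [h^3]. At [h = 0] the hypothesis makes the numerator
    0, so the quotient is harmless there. *)
Lemma taylor2_intro f z u v M :
  near0 (fun h => Cmod (f (z + h) - (f z + u * h + v * (h * h)))%C <= M * Cmod h ^ 3) -> taylor2 f z.
Proof.
  intros H. exists u, v, (fun h => (f (z + h) - (f z + u * h + v * (h * h))) / (h * (h * h)))%C. split.
  - exists (Rabs M). generalize H. apply near0_imp. intros h Hh.
    destruct (Ceq_dec h 0) as [->|nz].
    + rewrite Cmod_0 in Hh. replace (M * 0 ^ 3) with 0 in Hh by ring.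
      unfold Cdiv. rewrite Cmod_mult.
      assert (X := Cmod_ge_0 (f (z + 0) - (f z + u * 0 + v * (0 * 0)))%C).
      replace (Cmod (f (z + 0) - (f z + u * 0 + v * (0 * 0)))%C) with 0 by lra.
      rewrite Rmult_0_l. apply Rabs_pos.
    + assert (nz3 : (h * (h * h))%C <> 0) by (repeat apply Cmult_neq_0; assumption).
      assert (P := proj1 (Cmod_gt_0 _) nz). rewrite Cmod_div, !Cmod_mult by exact nz3.
      assert (P3 : 0 < Cmod h * (Cmod h * Cmod h)) by (repeat apply Rmult_lt_0_compat; exact P).
      apply Rmult_le_reg_r with (1 := P3). unfold Rdiv. rewrite Rmult_assoc, Rinv_l, Rmult_1_r by lra.
      eapply Rle_trans; [exact Hh|]. replace (Cmod h ^ 3) with (Cmod h * (Cmod h * Cmod h)) by ring.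
      apply Rmult_le_compat_r; [lra|apply Rle_abs].
  - exists 1. split; [lra|]. intros h _. destruct (Ceq_dec h 0) as [->|nz].
    + rewrite !Cplus_0_r. ring_simplify. ring.
    + field. exact nz.
Qed.

(** The expansion is made under the integral: by the addition formula [sin((rho + h) t)] is
    controlled by the small argument [h t], and [|h| < 1 / (L + 1)] ensures [|h t| <= 1]. [U] and
    [- V] are the first derivative and half the second. *)
Lemma taylor2_sine_int L f rho : 0 <= L -> contR f -> taylor2 (sine_int L f) rho.
Proof.
  intros HL H. destruct Csin_Ccos_small as [c [c0 Hc]].
  destruct (contR_bounded f L H HL) as [F [F0 HF]].
  set (G := cosh (Im rho * L)). assert (G1 : 1 <= G) by apply cosh_ge_1.
  assert (cU : contR (fun t => t * Ccos (rho * t) * f t)%C).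
  { apply contR_mult; [|exact H]. apply contR_mult.
    - eapply contR_dC. intros t. eapply dC_ext; [|apply (dC_lin 1)]. intros; cbv beta; ring.
    - eapply contR_dC. intros t. apply Ccos_lin. }
  assert (cV : contR (fun t => (t * t / 2) * Csin (rho * t) * f t)%C).
  { apply contR_mult; [|exact H]. apply contR_mult.
    - apply contR_mult; [|intros t; apply cwC_const].
      assert (X : contR (fun t => RtoC t)).
      { eapply contR_dC. intros t. eapply dC_ext; [|apply (dC_lin 1)]. intros; cbv beta; ring. }
      now apply contR_mult.
    - eapply contR_dC. intros t. apply Csin_lin. }
  set (U := RInt (V := C_R_CompleteNormedModule) (fun t => t * Ccos (rho * t) * f t)%C 0 L).
  set (V := RInt (V := C_R_CompleteNormedModule) (fun t => (t * t / 2) * Csin (rho * t) * f t)%C 0 L).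
  assert (IU := contR_IC _ L cU HL). assert (IV := contR_IC _ L cV HL). fold U in IU. fold V in IV.
  apply (taylor2_intro _ _ U (- V)%C (2 * L * (2 * (G * (c * L ^ 3)) * F))).
  exists (/ (L + 1)). split; [apply Rinv_0_lt_compat; lra|]. intros h Hh.
  assert (h0 := Cmod_ge_0 h).
  assert (hL : Cmod h * L <= 1).
  { apply Rmult_lt_compat_r with (r := L + 1) in Hh; [|lra]. rewrite Rinv_l in Hh by lra. lra. }
  replace (2 * L * (2 * (G * (c * L ^ 3)) * F) * Cmod h ^ 3)
    with (2 * L * (2 * (G * (c * (Cmod h * L) ^ 3)) * F)) by ring.
  apply (IC_bound (fun t => (Csin ((rho + h) * t) - Csin (rho * t) - h * (t * Ccos (rho * t)) + (h * h) * ((t * t / 2) * Csin (rho * t))) * f t)%C); [exact HL| |].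
  - eapply IC_ext; [|replace (sine_int L f (rho + h) - (sine_int L f rho + U * h + - V * (h * h)))%C
      with (sine_int L f (rho + h) + ((- (1)) * sine_int L f rho + ((- h) * U + (h * h) * V)))%C by ring;
      apply IC_plus; [now apply IC_sine_int|apply IC_plus; [apply IC_scal; now apply IC_sine_int|
        apply IC_plus; apply IC_scal; [exact IU|exact IV]]]].
    intros t. cbv beta. ring.
  - intros t Ht. rewrite Cmod_mult. apply Rmult_le_compat; auto using Cmod_ge_0.
    replace ((rho + h) * t)%C with (rho * t + h * t)%C by ring. rewrite Csin_plus.
    set (w := (h * t)%C).
    replace (Csin (rho * t) * Ccos w + Ccos (rho * t) * Csin w - Csin (rho * t) - h * (t * Ccos (rho * t)) + (h * h) * ((t * t / 2) * Csin (rho * t)))%C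
      with (Csin (rho * t) * (Ccos w - 1 + w * w / 2) + Ccos (rho * t) * (Csin w - w))%C by (unfold w, Cdiv; ring).
    assert (wm : Cmod w <= Cmod h * L).
    { unfold w. rewrite Cmod_mult, Cmod_R, (Rabs_pos_eq t) by lra. apply Rmult_le_compat_l; lra. }
    destruct (Hc w) as [X1 X2]; [lra|].
    assert (w3 : c * Cmod w ^ 3 <= c * (Cmod h * L) ^ 3).
    { apply Rmult_le_compat_l; [exact c0|]. apply pow_incr. split; [apply Cmod_ge_0|exact wm]. }
    assert (B1 : Cmod (Csin (rho * t)) <= G) by (eapply Rle_trans; [apply Cmod_Csin_le|now apply cosh_Im_le]).
    assert (B2 : Cmod (Ccos (rho * t)) <= G) by (eapply Rle_trans; [apply Cmod_Ccos_le|now apply cosh_Im_le]).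
    eapply Rle_trans; [apply Cmod_triangle|]. rewrite !Cmod_mult.
    assert (Y1 : Cmod (Csin (rho * t)) * Cmod (Ccos w - 1 + w * w / 2)%C <= G * (c * (Cmod h * L) ^ 3)).
    { apply Rmult_le_compat; auto using Cmod_ge_0. lra. }
    assert (Y2 : Cmod (Ccos (rho * t)) * Cmod (Csin w - w)%C <= G * (c * (Cmod h * L) ^ 3)).
    { apply Rmult_le_compat; auto using Cmod_ge_0. lra. }
    lra.
Qed.

(** The shift [y] is there so that the cosine is covered too, as the sine shifted by [PI / 2]. *)
Lemma taylor2_Csin_affine (x y rho : C) : taylor2 (fun w => Csin (w * x + y)) rho.
Proof.
  destruct Csin_Ccos_small as [c [c0 Hc]].
  set (S := Csin (rho * x + y)). set (K := Ccos (rho * x + y)).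
  apply (taylor2_intro _ _ (x * K)%C (- (x * x / 2) * S)%C ((Cmod S + Cmod K) * (c * Cmod x ^ 3))).
  assert (x0 := Cmod_ge_0 x).
  exists (/ (Cmod x + 1)). split; [apply Rinv_0_lt_compat; lra|]. intros h Hh.
  assert (h0 := Cmod_ge_0 h). set (w := (h * x)%C).
  assert (w1 : Cmod w <= 1).
  { unfold w. rewrite Cmod_mult. apply Rmult_lt_compat_r with (r := Cmod x + 1) in Hh; [|lra].
    rewrite Rinv_l in Hh by lra. lra. }
  replace ((rho + h) * x + y)%C with ((rho * x + y) + w)%C by (unfold w; ring).
  rewrite Csin_plus. fold S K.
  replace (S * Ccos w + K * Csin w - (S + x * K * h + - (x * x / 2) * S * (h * h)))%C
    with (S * (Ccos w - 1 + w * w / 2) + K * (Csin w - w))%C by (unfold w, Cdiv; ring).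
  destruct (Hc w w1) as [X1 X2].
  eapply Rle_trans; [apply Cmod_triangle|]. rewrite !Cmod_mult.
  replace ((Cmod S + Cmod K) * (c * Cmod x ^ 3) * Cmod h ^ 3)
    with (Cmod S * (c * Cmod w ^ 3) + Cmod K * (c * Cmod w ^ 3)) by (unfold w; rewrite Cmod_mult; ring).
  apply Rplus_le_compat; apply Rmult_le_compat_l; auto using Cmod_ge_0.
Qed.

Lemma taylor2_Csin x rho : taylor2 (fun w => Csin (w * x)) rho.
Proof.
  eapply taylor2_ext; [|apply (taylor2_Csin_affine x 0)]. intros w. cbv beta. now rewrite Cplus_0_r.
Qed.

Lemma taylor2_Ccos x rho : taylor2 (fun w => Ccos (w * x)) rho.
Proof.
  eapply taylor2_ext; [|apply (taylor2_Csin_affine x (RtoC (PI / 2)))]. intros w. cbv beta.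
  rewrite Csin_plus.
  assert (E1 : Csin (RtoC (PI / 2)) = 1).
  { apply C_ext; simpl; rewrite ?sin_PI2, ?cos_PI2, ?cosh_0; ring. }
  assert (E2 : Ccos (RtoC (PI / 2)) = 0).
  { apply C_ext; simpl; rewrite ?sin_PI2, ?cos_PI2, ?sinh_0; ring. }
  rewrite E1, E2. ring.
Qed.

(** * Quotients of entire functions *)

Lemma Cinv_0 : (/ 0)%C = 0.
Proof. unfold Cinv. apply C_ext; simpl; unfold Rdiv; ring. Qed.

(** The convention [/ 0 = 0] makes the bound hold at the zeros of [F] as well. *)
Lemma Cmod_quot_le (D F : C) M : 0 <= M -> Cmod D <= M * Cmod F -> Cmod (D * / F)%C <= M.
Proof.
  intros M0 H. destruct (Ceq_dec F 0) as [->|nz].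
  - rewrite Cinv_0, Cmult_0_r, Cmod_0. exact M0.
  - assert (P := proj1 (Cmod_gt_0 _) nz). rewrite Cmod_mult, Cmod_inv by exact nz.
    apply Rmult_le_reg_r with (1 := P). rewrite Rmult_assoc, Rinv_l, Rmult_1_r by lra. exact H.
Qed.

Lemma square_Cmod (z : C) S : Cmod z <= S -> square S z.
Proof.
  intros H. split; [exact (Rle_trans _ _ _ (re_le_Cmod z) H)|].
  exact (Rle_trans _ _ _ (Rle_trans _ _ _ (Rmax_r _ _) (Rmax_Cmod z)) H).
Qed.

(** [D / F] has removable singularities and tends to 0 along large squares.
    The maximum principle is applied to [F * (D / F) ^ N], which is continuous
    (with value 0) at the zeros of [F]; the weight [F] is lost as [N] grows. *)
Lemma dominated_zero (D F : C -> C) :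
  (forall z, taylor2 D z) -> (forall z, taylor2 F z) ->
  (forall z, exists M, near0 (fun h => Cmod (D (z + h)%C) <= M * Cmod (F (z + h)%C))) ->
  (forall eta X, 0 < eta -> exists S, X <= S /\ 0 < S /\
    forall z, square S z -> Rabs (Re z) = S \/ Rabs (Im z) = S -> Cmod (D z) <= eta * Cmod (F z)) ->
  forall z, D z = 0.
Proof.
  intros HD HF Hloc Hsq z.
  destruct (Ceq_dec (D z) 0) as [|nD]; [assumption|exfalso].
  assert (nF : F z <> 0).
  { intros E. destruct (Hloc z) as [M HM]. apply near0_at0 in HM. rewrite Cplus_0_r, E, Cmod_0, Rmult_0_r in HM.
    apply nD, Cmod_eq_0. generalize (Cmod_ge_0 (D z)). lra. }
  assert (D0 := proj1 (Cmod_gt_0 _) nD). assert (F0 := proj1 (Cmod_gt_0 _) nF).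
  set (m := Cmod (D z * / F z)%C).
  assert (m0 : 0 < m).
  { unfold m. rewrite Cmod_mult, Cmod_inv by exact nF. apply Rmult_lt_0_compat; [exact D0|now apply Rinv_0_lt_compat]. }
  destruct (Hsq (m / 2) (Cmod z)) as [S [HzS [S0 HS]]]; [lra|].
  destruct (square_bounded S (fun w => Cmod (F w))) as [B HB].
  { intros w _. destruct (contC_bounded F w (taylor2_cont F w (HF w))) as [M HM]. now exists M. }
  (* On the boundary the quotient is at most half of its modulus [m] at [z]. Dividing by [m ^ N]
     gives [|F z| <= B / 2^N] for every [N], which contradicts [F z <> 0]. *)
  assert (key : forall N, Cmod (F z) * m ^ N <= B * (m / 2) ^ N).
  { intros N. set (K := fun w => (F w * (D w * / F w) ^ N)%C).
    assert (EK : forall w, Cmod (K w) = Cmod (F w) * Cmod (D w * / F w)%C ^ N).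
    { intros w. unfold K. now rewrite Cmod_mult, Cmod_pow. }
    unfold m at 1. rewrite <- (EK z). apply (maximum_principle S); [exact S0| | |now apply square_Cmod].
    - intros w. destruct (Ceq_dec (F w) 0) as [Fw|Fw].
      + right. split; [unfold K; rewrite Fw; ring|]. intros eta He.
        destruct (Hloc w) as [M HM]. set (P := Rabs M ^ N + 1).
        assert (P0 : 0 <= Rabs M ^ N) by apply pow_le, Rabs_pos.
        assert (Hp : 0 < eta / P) by (apply Rdiv_lt_0_compat; unfold P; lra).
        generalize (near0_and _ _ HM (taylor2_cont F w (HF w) _ Hp)). apply near0_imp. intros h [A1 A2].
        unfold K at 2. rewrite Fw in A2 |- *. rewrite Cmult_0_l.
        replace (K (w + h) - 0)%C with (K (w + h)%C) by ring. replace (F (w + h) - 0)%C with (F (w + h)%C) in A2 by ring.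
        rewrite EK. assert (A3 := Cmod_ge_0 (F (w + h)%C)).
        assert (A4 : Cmod (D (w + h) * / F (w + h))%C <= Rabs M).
        { apply Cmod_quot_le; [apply Rabs_pos|]. eapply Rle_trans; [exact A1|].
          apply Rmult_le_compat_r; [exact A3|apply Rle_abs]. }
        apply Rle_lt_trans with (Cmod (F (w + h)%C) * P).
        * apply Rmult_le_compat_l; [exact A3|]. apply Rle_trans with (Rabs M ^ N); [|unfold P; lra].
          apply pow_incr. split; [apply Cmod_ge_0|exact A4].
        * apply Rmult_lt_compat_r with (r := P) in A2; [|unfold P; lra].
          replace (eta / P * P) with eta in A2 by (field; unfold P; lra). exact A2.
      + left. apply taylor2_mult; [apply HF|]. apply (taylor2_pow (fun w => D w * / F w)%C).
        apply taylor2_mult; [apply HD|]. apply taylor2_inv; [apply HF|exact Fw].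
    - intros w Hw Hb. rewrite EK. apply Rmult_le_compat; [apply Cmod_ge_0|apply pow_le, Cmod_ge_0|now apply HB|].
      apply pow_incr. split; [apply Cmod_ge_0|]. apply Cmod_quot_le; [lra|now apply HS]. }
  assert (B0 : 0 < B) by (assert (Y := key 0%nat); rewrite !pow_O in Y; lra).
  destruct (pow_lt_1_zero (/ 2) ltac:(rewrite Rabs_pos_eq; lra) (Cmod (F z) / B)) as [N HN].
  { now apply Rdiv_lt_0_compat. }
  assert (X := HN N (le_n N)). rewrite Rabs_pos_eq in X by (apply pow_le; lra).
  assert (Y := key N). unfold Rdiv in Y at 1. rewrite Rpow_mult_distr in Y.
  assert (mN := pow_lt m N m0).
  assert (Z : Cmod (F z) <= B * (/ 2) ^ N) by (apply Rmult_le_reg_r with (1 := mN); lra).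
  apply Rmult_lt_compat_l with (r := B) in X; [|exact B0].
  replace (B * (Cmod (F z) / B)) with (Cmod (F z)) in X by (field; lra). lra.
Qed.

(** Pigeonhole on [X], [X + h], [X + 2 h]: the sine condition fails at no more than one of them, and
    so does the cosine condition, so one of the three satisfies both. Two failures at distance [s]
    would give [sin s < 2 kappa] by the subtraction formula. The step [h] puts [h l] and [h g] in
    [(0, PI / 4)], where these sines and those of the doubled angles are positive. *)
Lemma good_abscissa (l g : R) : 0 < l -> 0 < g -> exists kappa, 0 < kappa /\
  forall X, exists S, X <= S /\ kappa <= Rabs (sin (S * l)) /\ kappa <= Rabs (cos (S * g)).
Proof.
  intros Hl Hg. assert (P := PI_RGT_0). set (h := PI / (4 * (l + g))).
  assert (h0 : 0 < h) by (apply Rdiv_lt_0_compat; lra).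
  assert (hlg : h * l + h * g = PI / 4) by (unfold h; field; lra).
  assert (hl : 0 < h * l) by nra. assert (hg : 0 < h * g) by nra.
  assert (pos : forall x, 0 < x < PI / 4 -> 0 < sin x /\ 0 < sin (2 * x)) by (intros x Hx; split; apply sin_gt_0; lra).
  destruct (pos (h * l) ltac:(lra)) as [a1 a2]. destruct (pos (h * g) ltac:(lra)) as [a3 a4].
  set (kappa := Rmin (Rmin (sin (h * l)) (sin (2 * (h * l)))) (Rmin (sin (h * g)) (sin (2 * (h * g)))) / 2).
  assert (b1 := Rmin_l (Rmin (sin (h * l)) (sin (2 * (h * l)))) (Rmin (sin (h * g)) (sin (2 * (h * g))))).
  assert (b2 := Rmin_r (Rmin (sin (h * l)) (sin (2 * (h * l)))) (Rmin (sin (h * g)) (sin (2 * (h * g))))).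
  assert (b3 := Rmin_l (sin (h * l)) (sin (2 * (h * l)))). assert (b4 := Rmin_r (sin (h * l)) (sin (2 * (h * l)))).
  assert (b5 := Rmin_l (sin (h * g)) (sin (2 * (h * g)))). assert (b6 := Rmin_r (sin (h * g)) (sin (2 * (h * g)))).
  assert (k0 : 0 < kappa) by (unfold kappa; apply Rdiv_lt_0_compat; [repeat apply Rmin_glb_lt; assumption|lra]).
  assert (K : forall s, 2 * kappa <= sin s -> forall x, (Rabs (sin x) < kappa -> kappa <= Rabs (sin (x + s))) /\
     (Rabs (cos x) < kappa -> kappa <= Rabs (cos (x + s)))).
  { intros s Hs x. assert (Cx := COS_bound x). assert (Sx := SIN_bound x).
    assert (E : sin s = sin (x + s) * cos x - cos (x + s) * sin x) by (rewrite <- sin_minus; f_equal; ring).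
    assert (W : forall u v, Rabs u < kappa -> -1 <= v <= 1 -> Rabs (u * v) < kappa).
    { intros u v Hu Hv. apply Rabs_le in Hv. rewrite Rabs_mult. generalize (Rabs_pos u). nra. }
    assert (Cy := COS_bound (x + s)). assert (Sy := SIN_bound (x + s)).
    split; intros H; apply Rnot_lt_le; intros H'.
    - assert (U := W _ _ H' Cx). assert (V := W _ _ H Cy). apply Rabs_def2 in U. apply Rabs_def2 in V. lra.
    - assert (U := W _ _ H' Sx). assert (V := W _ _ H Sy). apply Rabs_def2 in U. apply Rabs_def2 in V. lra. }
  assert (e1 : 2 * kappa <= sin (h * l)) by (unfold kappa; lra).
  assert (e2 : 2 * kappa <= sin (2 * (h * l))) by (unfold kappa; lra).
  assert (e3 : 2 * kappa <= sin (h * g)) by (unfold kappa; lra).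
  assert (e4 : 2 * kappa <= sin (2 * (h * g))) by (unfold kappa; lra).
  clearbody kappa.
  exists kappa. split; [exact k0|]. intros X.
  assert (K1 := proj1 (K _ e1 (X * l))). assert (K2 := proj1 (K _ e2 (X * l))).
  assert (K3 := proj2 (K _ e3 (X * g))). assert (K4 := proj2 (K _ e4 (X * g))).
  assert (K5 := proj1 (K _ e1 (X * l + h * l))). assert (K6 := proj2 (K _ e3 (X * g + h * g))).
  replace (X * l + h * l) with ((X + h) * l) in * by ring.
  replace (X * g + h * g) with ((X + h) * g) in * by ring.
  replace (X * l + 2 * (h * l)) with ((X + 2 * h) * l) in * by ring.
  replace (X * g + 2 * (h * g)) with ((X + 2 * h) * g) in * by ring.
  replace ((X + h) * l + h * l) with ((X + 2 * h) * l) in * by ring.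
  replace ((X + h) * g + h * g) with ((X + 2 * h) * g) in * by ring.
  destruct (Rle_lt_dec kappa (Rabs (sin (X * l)))) as [A|A];
  destruct (Rle_lt_dec kappa (Rabs (cos (X * g)))) as [B|B].
  - exists X. lra.
  - destruct (Rle_lt_dec kappa (Rabs (sin ((X + h) * l)))) as [A'|A'].
    + exists (X + h). split; [lra|auto].
    + exists (X + 2 * h). split; [lra|auto].
  - destruct (Rle_lt_dec kappa (Rabs (cos ((X + h) * g)))) as [B'|B'].
    + exists (X + h). split; [lra|auto].
    + exists (X + 2 * h). split; [lra|auto].
  - exists (X + h). split; [lra|auto].
Qed.

(** * The characteristic function *)

Lemma sinh_sqr_ge_1 y : 2 <= Rabs y -> 1 <= sinh y ^ 2.
Proof.
  intros H.
  assert (W : forall x, 2 <= x -> 1 <= sinh x).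
  { intros x Hx. unfold sinh. assert (A := exp_ineq1_le x).
    assert (B : exp x * exp (- x) = 1) by (rewrite <- exp_plus, Rplus_opp_r; apply exp_0).
    assert (D := exp_pos (- x)). nra. }
  destruct (Rcase_abs y) as [n|p].
  - rewrite Rabs_left in H by exact n. assert (X := W _ H). rewrite sinh_opp in X. nra.
  - rewrite Rabs_right in H by exact p. assert (X := W _ H). nra.
Qed.

(** The common core of the sine and cosine bounds. The first alternative is for the vertical sides
    of a square, where the abscissa is well chosen; the second is for the horizontal sides, where
    [sinh y ^ 2 >= 1] and [k <= / 2] give [k^2 cosh^2 <= sinh^2]. *)
Lemma trig_modulus_lower (k s y m : R) : 0 <= k <= / 2 -> k <= Rabs s \/ 2 <= Rabs y -> s ^ 2 <= 1 -> 0 <= m ->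
  m ^ 2 = s ^ 2 + sinh y ^ 2 -> k * cosh y <= m.
Proof.
  intros Hk H Hs Hm E. assert (B := cosh2_sinh2 y). assert (D := cosh_ge_1 y).
  apply Rsqr_incr_0_var; [|exact Hm]. unfold Rsqr.
  replace (k * cosh y * (k * cosh y)) with (k ^ 2 * (cosh y * cosh y)) by ring. rewrite B.
  destruct H as [H|H].
  - assert (k ^ 2 <= s ^ 2) by (rewrite <- (pow2_abs s); apply pow_incr; lra). nra.
  - assert (X := sinh_sqr_ge_1 y H). assert (k ^ 2 <= / 4) by nra. nra.
Qed.

Lemma Csin_lower k z : 0 <= k <= / 2 -> k <= Rabs (sin (Re z)) \/ 2 <= Rabs (Im z) ->
  k * cosh (Im z) <= Cmod (Csin z).
Proof.
  intros Hk H. apply (trig_modulus_lower k (sin (Re z))); auto using Cmod_ge_0, Cmod_Csin.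
  assert (X := SIN_bound (Re z)). nra.
Qed.

Lemma Ccos_lower k z : 0 <= k <= / 2 -> k <= Rabs (cos (Re z)) \/ 2 <= Rabs (Im z) ->
  k * cosh (Im z) <= Cmod (Ccos z).
Proof.
  intros Hk H. apply (trig_modulus_lower k (cos (Re z))); auto using Cmod_ge_0, Cmod_Ccos.
  assert (X := COS_bound (Re z)). nra.
Qed.

(** [rho ^ 2] times the characteristic function at [rho ^ 2], where [l] and [g]
    are the lengths of the two segments, [f1] and [f2] the potential on them
    (the second one reversed) and [c] its value at the left end of the gap. *)
Definition entire_char (d l g : R) (c : C) (f1 f2 : R -> C) (rho : C) : C :=
  (- Csin (rho * g) *
     (rho * Ccos (rho * l) + (d * c - d * (rho * rho)) * Csin (rho * l) + sine_int l f2 rho)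
   - (d * rho * Ccos (rho * l) + (1 - d * d * (rho * rho)) * Csin (rho * l)) *
     (rho * Ccos (rho * g) + sine_int g f1 rho))%C.

Lemma taylor2_entire_char d l g c f1 f2 rho : 0 <= l -> 0 <= g -> contR f1 -> contR f2 ->
  taylor2 (entire_char d l g c f1 f2) rho.
Proof.
  intros Hl Hg H1 H2. unfold entire_char.
  repeat first [ apply taylor2_minus | apply taylor2_plus | apply taylor2_mult | apply taylor2_opp
    | apply taylor2_const | apply taylor2_id | apply taylor2_Csin | apply taylor2_Ccos
    | apply taylor2_sine_int; assumption ].
Qed.

Lemma entire_char_main d l g c f1 f2 : 0 < d -> 0 <= l -> 0 <= g -> contR f1 -> contR f2 ->
  exists M, 0 <= M /\ forall rho, 1 <= Cmod rho ->
    Cmod (entire_char d l g c f1 f2 rho - d * d * (rho * (rho * rho)) * (Csin (rho * l) * Ccos (rho * g)))%C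
    <= M * (Cmod rho ^ 2 * (cosh (Im rho * l) * cosh (Im rho * g))).
Proof.
  intros Hd Hl Hg H1 H2.
  destruct (sine_int_bound g f1 Hg H1) as [M1 [M10 B1]]. destruct (sine_int_bound l f2 Hl H2) as [M2 [M20 B2]].
  assert (c0 := Cmod_ge_0 c).
  (* The summands bound, in this order, the seven products in the expansion [E] below. *)
  exists (1 + (d * Cmod c + d) + M2 + d + d * M1 + 1 + (1 + d * d) * M1). split; [nra|].
  intros rho Hrho. set (p := Cmod rho) in *. set (cl := cosh (Im rho * l)). set (cg := cosh (Im rho * g)).
  assert (cl1 : 1 <= cl) by apply cosh_ge_1. assert (cg1 : 1 <= cg) by apply cosh_ge_1.
  assert (Sl : Cmod (Csin (rho * l)) <= cl) by (eapply Rle_trans; [apply Cmod_Csin_le|apply cosh_Im_le; lra]).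
  assert (Kl : Cmod (Ccos (rho * l)) <= cl) by (eapply Rle_trans; [apply Cmod_Ccos_le|apply cosh_Im_le; lra]).
  assert (Sg : Cmod (Csin (rho * g)) <= cg) by (eapply Rle_trans; [apply Cmod_Csin_le|apply cosh_Im_le; lra]).
  assert (Kg : Cmod (Ccos (rho * g)) <= cg) by (eapply Rle_trans; [apply Cmod_Ccos_le|apply cosh_Im_le; lra]).
  assert (J1 := B1 rho). assert (J2 := B2 rho). fold cg in J1. fold cl in J2.
  set (sl := Csin (rho * l)) in *. set (kl := Ccos (rho * l)) in *.
  set (sg := Csin (rho * g)) in *. set (kg := Ccos (rho * g)) in *.
  set (j1 := sine_int g f1 rho) in *. set (j2 := sine_int l f2 rho) in *.
  set (W := p ^ 2 * (cl * cg)).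
  assert (pp : p <= p ^ 2) by nra. assert (pp1 : 1 <= p ^ 2) by nra.
  assert (T : forall (z u v : C) (A P Q : R), 0 <= A -> 0 <= P -> 0 <= Q -> Cmod z <= A * p ^ 2 -> Cmod u <= P * cl -> Cmod v <= Q * cg ->
    Cmod (z * (u * v))%C <= A * P * Q * W).
  { intros z u v A P Q A0 P0 Q0 Hz Hu Hv. rewrite !Cmod_mult. unfold W.
    replace (A * P * Q * (p ^ 2 * (cl * cg))) with ((A * p ^ 2) * ((P * cl) * (Q * cg))) by ring.
    apply Rmult_le_compat; auto using Cmod_ge_0; [apply Rmult_le_pos; apply Cmod_ge_0|].
    apply Rmult_le_compat; auto using Cmod_ge_0. }
  assert (Rd : Cmod (RtoC d) = d) by (rewrite Cmod_R; apply Rabs_pos_eq; lra).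
  assert (E : (entire_char d l g c f1 f2 rho - d * d * (rho * (rho * rho)) * (sl * kg)
    = - (rho * (kl * sg)) + - ((d * c - d * (rho * rho)) * (sl * sg)) + - (1 * (j2 * sg))
      + - (d * (rho * rho) * (kl * kg)) + - (d * rho * (kl * j1)) + - (rho * (sl * kg))
      + - ((1 - d * d * (rho * rho)) * (sl * j1)))%C).
  { unfold entire_char. fold sl kl sg kg j1 j2. ring. }
  rewrite E.
  assert (Z1 : Cmod (rho * (kl * sg))%C <= 1 * 1 * 1 * W) by (apply T; fold p; lra).
  assert (Z2 : Cmod ((d * c - d * (rho * rho)) * (sl * sg))%C <= (d * Cmod c + d) * 1 * 1 * W).
  { assert (dc : 0 <= d * Cmod c) by nra. apply T; try lra. unfold Cminus. eapply Rle_trans; [apply Cmod_triangle|].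
    rewrite Cmod_opp, !Cmod_mult, Rd. fold p.
    assert (d * Cmod c * 1 <= d * Cmod c * p ^ 2) by (apply Rmult_le_compat_l; lra). lra. }
  assert (Z3 : Cmod (1 * (j2 * sg))%C <= 1 * M2 * 1 * W) by (apply T; rewrite ?Cmod_1; lra).
  assert (Z4 : Cmod (d * (rho * rho) * (kl * kg))%C <= d * 1 * 1 * W).
  { apply T; try lra. rewrite !Cmod_mult, Rd. fold p. nra. }
  assert (Z5 : Cmod (d * rho * (kl * j1))%C <= d * 1 * M1 * W).
  { apply T; try lra. rewrite !Cmod_mult, Rd. fold p. nra. }
  assert (Z6 : Cmod (rho * (sl * kg))%C <= 1 * 1 * 1 * W) by (apply T; fold p; lra).
  assert (Z7 : Cmod ((1 - d * d * (rho * rho)) * (sl * j1))%C <= (1 + d * d) * 1 * M1 * W).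
  { apply T; try lra; [nra|]. unfold Cminus. eapply Rle_trans; [apply Cmod_triangle|].
    rewrite Cmod_opp, !Cmod_mult, Rd, Cmod_1. fold p. nra. }
  assert (tri : forall (u v : C) A B, Cmod u <= A -> Cmod v <= B -> Cmod (u + - v)%C <= A + B).
  { intros u v A B Hu Hv. eapply Rle_trans; [apply Cmod_triangle|]. rewrite Cmod_opp. lra. }
  eapply Rle_trans.
  - apply tri; [|exact Z7]. apply tri; [|exact Z6]. apply tri; [|exact Z5]. apply tri; [|exact Z4].
    apply tri; [|exact Z3]. apply tri; [|exact Z2]. rewrite Cmod_opp. exact Z1.
  - lra.
Qed.

(** With [W = |z|^2 cosh cosh], the difference is at most [(A + B) W], whereas the common leading
    part is at least [m S W] on the boundary of a good square, so [|F| >= (m S - B) W]. *)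
Lemma entire_char_unique d l g c f1 f2 c' f1' f2' : 0 < d -> 0 < l -> 0 < g ->
  contR f1 -> contR f2 -> contR f1' -> contR f2' ->
  (forall z, exists M, near0 (fun h => Cmod (entire_char d l g c f1 f2 (z + h)%C)
      <= M * Cmod (entire_char d l g c' f1' f2' (z + h)%C))) ->
  forall rho, entire_char d l g c f1 f2 rho = entire_char d l g c' f1' f2' rho.
Proof.
  intros Hd Hl Hg C1 C2 C1' C2' Hloc rho.
  set (E := entire_char d l g c f1 f2) in *. set (F := entire_char d l g c' f1' f2') in *.
  assert (TE : forall z, taylor2 E z) by (intros; apply taylor2_entire_char; auto; lra).
  assert (TF : forall z, taylor2 F z) by (intros; apply taylor2_entire_char; auto; lra).
  assert (Z : (E rho - F rho = 0)%C).
  2:{ transitivity (E rho - F rho + F rho)%C; [ring|rewrite Z; ring]. }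
  apply (dominated_zero (fun z => E z - F z)%C F).
  { intros z. exact (taylor2_minus E F z (TE z) (TF z)). }
  { exact TF. }
  { intros z. destruct (Hloc z) as [M HM]. exists (M + 1). revert HM. apply near0_imp. intros h Hh.
    unfold Cminus. eapply Rle_trans; [apply Cmod_triangle|]. rewrite Cmod_opp. lra. }
  intros eta X He.
  destruct (entire_char_main d l g c f1 f2 Hd (Rlt_le _ _ Hl) (Rlt_le _ _ Hg) C1 C2) as [A [A0 HA]].
  destruct (entire_char_main d l g c' f1' f2' Hd (Rlt_le _ _ Hl) (Rlt_le _ _ Hg) C1' C2') as [B [B0 HB]].
  fold E in HA. fold F in HB.
  destruct (good_abscissa l g Hl Hg) as [kappa [k0 Hk]].
  set (k := Rmin kappa (/ 2)).
  assert (kk : 0 < k <= / 2) by (split; [apply Rmin_glb_lt; lra|apply Rmin_r]).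
  assert (kka : k <= kappa) by apply Rmin_l.
  set (m := d * d * (k * k)). assert (m0 : 0 < m) by (unfold m; repeat apply Rmult_lt_0_compat; lra).
  (* The bound 1 is for [entire_char_main], [2 / l] and [2 / g] are for the horizontal sides, and
     the last term makes [m S - B >= (A + B) / eta]. *)
  set (Y := Rmax (Rmax X 1) (Rmax (Rmax (2 / l) (2 / g)) ((B + (A + B) / eta) / m))).
  destruct (Hk Y) as [S [HS [Hs Hc]]].
  assert (Y1 : Rmax X 1 <= Y) by apply Rmax_l.
  assert (Y2 : Rmax (Rmax (2 / l) (2 / g)) ((B + (A + B) / eta) / m) <= Y) by apply Rmax_r.
  assert (SX : X <= S) by (generalize (Rmax_l X 1); lra).
  assert (S1 : 1 <= S) by (generalize (Rmax_r X 1); lra).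
  assert (Y3 := Rle_trans _ _ _ (Rmax_l _ _) Y2). assert (Y4 := Rle_trans _ _ _ (Rmax_r _ _) Y2).
  assert (Sl : 2 <= S * l).
  { assert (Q := Rle_trans _ _ _ (Rmax_l _ _) Y3). apply Rle_trans with (2 / l * l); [right; field; lra|].
    apply Rmult_le_compat_r; lra. }
  assert (Sg : 2 <= S * g).
  { assert (Q := Rle_trans _ _ _ (Rmax_r _ _) Y3). apply Rle_trans with (2 / g * g); [right; field; lra|].
    apply Rmult_le_compat_r; lra. }
  assert (Sm : B + (A + B) / eta <= S * m).
  { apply Rle_trans with ((B + (A + B) / eta) / m * m); [right; field; lra|]. apply Rmult_le_compat_r; lra. }
  clearbody Y k. exists S. split; [exact SX|split; [lra|]]. intros z Hz Hb.
  assert (zS : S <= Cmod z).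
  { destruct Hb as [<-|<-]; [apply re_le_Cmod|].
    exact (Rle_trans _ _ _ (Rmax_r _ _) (Rmax_Cmod z)). }
  assert (EA := HA z ltac:(lra)). assert (FB := HB z ltac:(lra)).
  set (main := (d * d * (z * (z * z)) * (Csin (z * l) * Ccos (z * g)))%C) in *.
  set (cl := cosh (Im z * l)) in *. set (cg := cosh (Im z * g)) in *.
  assert (cl1 : 1 <= cl) by apply cosh_ge_1. assert (cg1 : 1 <= cg) by apply cosh_ge_1.
  assert (Imx : forall x : R, Im (z * x)%C = Im z * x) by (intros; simpl; unfold Im; ring).
  assert (Rex : forall x : R, Re (z * x)%C = Re z * x) by (intros; simpl; unfold Re; ring).
  assert (hl : k * cl <= Cmod (Csin (z * l))).
  { unfold cl. rewrite <- Imx. apply Csin_lower; [lra|]. rewrite Imx, Rex. destruct Hb as [Hb|Hb].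
    - left. apply Rle_trans with (1 := kka). destruct (Rcase_abs (Re z)) as [n|p].
      + rewrite Rabs_left in Hb by exact n. replace (Re z * l) with (- (S * l)) by (rewrite <- Hb; ring).
        rewrite sin_neg, Rabs_Ropp. exact Hs.
      + rewrite Rabs_right in Hb by exact p. rewrite Hb. exact Hs.
    - right. rewrite Rabs_mult, Hb, (Rabs_pos_eq l); lra. }
  assert (hg : k * cg <= Cmod (Ccos (z * g))).
  { unfold cg. rewrite <- Imx. apply Ccos_lower; [lra|]. rewrite Imx, Rex. destruct Hb as [Hb|Hb].
    - left. apply Rle_trans with (1 := kka). destruct (Rcase_abs (Re z)) as [n|p].
      + rewrite Rabs_left in Hb by exact n. replace (Re z * g) with (- (S * g)) by (rewrite <- Hb; ring).
        rewrite cos_neg. exact Hc.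
      + rewrite Rabs_right in Hb by exact p. rewrite Hb. exact Hc.
    - right. rewrite Rabs_mult, Hb, (Rabs_pos_eq g); lra. }
  set (p := Cmod z) in *. set (W := p ^ 2 * (cl * cg)) in *.
  assert (W0 : 0 < W) by (unfold W; apply Rmult_lt_0_compat; [apply pow_lt; lra|apply Rmult_lt_0_compat; lra]).
  assert (Hmain : m * S * W <= Cmod main).
  { unfold main. rewrite !Cmod_mult, !Cmod_R, !(Rabs_pos_eq d) by lra. fold p.
    apply Rle_trans with (d * d * (p * (p * p)) * ((k * cl) * (k * cg))).
    - unfold m, W. replace (d * d * (p * (p * p)) * (k * cl * (k * cg))) with (p * ((d * d * (k * k)) * (p ^ 2 * (cl * cg)))) by ring.
      fold m W. replace (m * S * W) with (S * (m * W)) by ring. apply Rmult_le_compat_r; [nra|exact zS].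
    - apply Rmult_le_compat_l; [|apply Rmult_le_compat; nra].
      assert (0 <= p * (p * p)) by (assert (0 <= p * p) by nra; nra). nra. }
  assert (FW : (A + B) / eta * W <= Cmod (F z)).
  { assert (T := Cmod_triangle (F z) (- (F z - main))%C). rewrite Cmod_opp in T.
    replace (F z + - (F z - main))%C with main in T by ring.
    assert (Q := Rmult_le_compat_r W _ _ (Rlt_le _ _ W0) Sm). lra. }
  assert (T := Cmod_triangle (E z - main)%C (- (F z - main))%C). rewrite Cmod_opp in T.
  replace (E z - main + - (F z - main))%C with (E z - F z)%C in T by ring.
  apply Rmult_le_compat_l with (r := eta) in FW; [|lra].
  replace (eta * ((A + B) / eta * W)) with ((A + B) * W) in FW by (field; lra). lra.
Qed.

Lemma IC_ext_seg f g u v l : u <= v -> (forall t, u < t < v -> f t = g t) -> IC f u v l -> IC g u v l.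
Proof.
  intros uv E [A B]. split; eapply is_RInt_ext; try eassumption; intros t Ht;
    rewrite Rmin_left, Rmax_right in Ht by exact uv; cbv beta; now rewrite E.
Qed.

Lemma is_RInt_reverse (f : R -> R) a b I : is_RInt f 0 (b - a) I -> is_RInt (fun y => f (b - y)) a b I.
Proof.
  intros H. apply is_RInt_swap in H.
  assert (X : is_RInt f (-1 * a + b) (-1 * b + b) (opp I)).
  { replace (-1 * a + b) with (b - a) by ring. replace (-1 * b + b) with 0 by ring. exact H. }
  apply is_RInt_comp_lin in X. apply is_RInt_opp in X. rewrite opp_opp in X.
  eapply is_RInt_ext; [|exact X]. intros y _. unfold opp, scal; simpl. unfold mult; simpl.
  replace (-1 * y + b) with (b - y) by ring. ring.
Qed.

Lemma char_fun_entire gamma a b q f1 f2 (rho : C) : 0 < gamma -> gamma < a -> a < b ->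
  contR f1 -> contR f2 ->
  (forall t, 0 <= t <= gamma -> f1 t = q t) -> (forall t, a <= t <= b -> f2 (b - t) = q t) ->
  (rho * rho * char_fun gamma a b q (rho * rho))%C = entire_char (a - gamma) (b - a) gamma (q gamma) f1 f2 rho.
Proof.
  intros Hg Ha Hb C1 C2 E1 E2. destruct (Ceq_dec rho 0) as [->|nz].
  - unfold entire_char. rewrite !Cmult_0_l, Csin_0. ring.
  - assert (I1 : RInt (V := C_R_CompleteNormedModule) (fun t => sinr (rho * rho) t * q t)%C 0 gamma
      = (/ rho * sine_int gamma f1 rho)%C).
    { apply IC_RInt. eapply IC_ext_seg; [lra| |apply IC_scal, (IC_sine_int gamma f1 rho); [lra|exact C1]].
      intros t Ht. cbv beta. rewrite sinr_sqr, E1 by (lra || exact nz). unfold Cdiv. ring. }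
    assert (I2 : RInt (V := C_R_CompleteNormedModule) (fun t => sinr (rho * rho) (b - t) * q t)%C a b
      = (/ rho * sine_int (b - a) f2 rho)%C).
    { apply IC_RInt. apply (IC_ext_seg (fun t => / rho * (Csin (rho * (b - t)%R) * f2 (b - t)%R))%C); [lra| |].
      - intros t Ht. rewrite sinr_sqr, E2 by (lra || exact nz). unfold Cdiv. ring.
      - apply (IC_scal (fun t => Csin (rho * (b - t)%R) * f2 (b - t)%R)%C).
        destruct (IC_sine_int (b - a) f2 rho ltac:(lra) C2) as [A B].
        split; [exact (is_RInt_reverse _ _ _ _ A)|exact (is_RInt_reverse _ _ _ _ B)]. }
    unfold char_fun, c2_fun. rewrite I1, I2, !cosr_sqr, !sinr_sqr by exact nz.
    unfold entire_char. simpl. field. exact nz.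
Qed.

(** * Orders of zeros and equality of spectra *)

Lemma locally_near0 (P : C -> Prop) z : locally (T := C_UniformSpace) z P -> near0 (fun h => P (z + h)%C).
Proof.
  intros [e He]. exists e. split; [apply cond_pos|]. intros h Hh. apply He.
  assert (X := Rmax_Cmod h). assert (X1 := Rmax_l (Rabs (fst h)) (Rabs (snd h))). assert (X2 := Rmax_r (Rabs (fst h)) (Rabs (snd h))).
  split.
  - change (Rabs (fst z + fst h - fst z) < e). replace (fst z + fst h - fst z) with (fst h) by ring. lra.
  - change (Rabs (snd z + snd h - snd z) < e). replace (snd z + snd h - snd z) with (snd h) by ring. lra.
Qed.

Lemma ex_derive_contC g z : ex_derive (K := C_AbsRing) (V := C_NormedModule) g z -> contC g z.
Proof.
  intros H eta He. apply ex_derive_continuous in H.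
  assert (He2 : 0 < eta / 2) by lra.
  destruct (H _ (locally_ball (g z) (mkposreal _ He2))) as [e E].
  exists e. split; [apply cond_pos|]. intros h Hh.
  assert (X : ball (M := C_UniformSpace) (g z) (mkposreal _ He2) (g (z + h)%C)).
  { apply E. change (Cmod (z + h - z)%C < e). replace (z + h - z)%C with h by ring. exact Hh. }
  destruct X as [X1 X2]. change (Rabs (Re (g (z + h)%C) - Re (g z)) < eta / 2) in X1.
  change (Rabs (Im (g (z + h)%C) - Im (g z)) < eta / 2) in X2.
  eapply Rle_lt_trans; [apply Cmod_le_sum|]. simpl. unfold Rminus, Re, Im in *. lra.
Qed.

(** The common power of [h] cancels, leaving a cofactor bounded above over one bounded away from 0.
    This is where multiplicities enter. *)
Lemma zero_order_dominated f g z m : is_zero_order f z m -> is_zero_order g z m ->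
  exists M, near0 (fun h => Cmod (f (z + h)%C) <= M * Cmod (g (z + h)%C)).
Proof.
  intros [u [Du [u0 Eu]]] [v [Dv [v0 Ev]]].
  apply locally_near0 in Eu. apply locally_near0 in Ev.
  apply locally_singleton in Du. apply locally_singleton in Dv.
  assert (Cu := contC_bounded _ _ (ex_derive_contC _ _ Du)). destruct Cu as [M HM].
  assert (Cv := contC_neq0 _ _ (ex_derive_contC _ _ Dv) v0).
  assert (P := proj1 (Cmod_gt_0 _) v0). assert (M0 : 0 <= M).
  { eapply Rle_trans; [apply Cmod_ge_0|exact (near0_at0 _ HM)]. }
  exists (M / (Cmod (v z) / 2)).
  generalize (near0_and _ _ (near0_and _ _ Eu Ev) (near0_and _ _ HM Cv)). apply near0_imp.
  intros h [[-> ->] [A B]]. replace (z + h - z)%C with h by ring. rewrite !Cmod_mult.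
  assert (Q := Cmod_ge_0 (h ^ m)%C).
  apply Rle_trans with (Cmod (h ^ m)%C * M); [now apply Rmult_le_compat_l|].
  replace (M / (Cmod (v z) / 2) * (Cmod (h ^ m)%C * Cmod (v (z + h)%C)))
    with (Cmod (h ^ m)%C * (M * (Cmod (v (z + h)%C) / (Cmod (v z) / 2)))) by (field; lra).
  apply Rmult_le_compat_l; [exact Q|]. rewrite <- (Rmult_1_r M) at 1. apply Rmult_le_compat_l; [exact M0|].
  apply Rmult_le_reg_r with (Cmod (v z) / 2); [lra|]. unfold Rdiv at 2. rewrite Rmult_assoc, Rinv_l by lra. lra.
Qed.

(** Carries domination from [lambda] to [rho]. Only continuity of squaring is involved, so the
    branch point [z = 0] is no exception. *)
Lemma near0_sqr (P : C -> Prop) z : near0 (fun h => P (z * z + h)%C) -> near0 (fun h => P ((z + h) * (z + h))%C).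
Proof.
  intros [e [He H]]. assert (z0 := Cmod_ge_0 z).
  exists (Rmin 1 (e / (2 * Cmod z + 1))).
  assert (Hq : 0 < e / (2 * Cmod z + 1)) by (apply Rdiv_lt_0_compat; lra).
  split; [apply Rmin_glb_lt; lra|]. intros h Hh.
  assert (A := Rmin_l 1 (e / (2 * Cmod z + 1))). assert (B := Rmin_r 1 (e / (2 * Cmod z + 1))).
  replace ((z + h) * (z + h))%C with (z * z + h * (z + z + h))%C by ring. apply H.
  rewrite Cmod_mult. assert (T := Cmod_triangle (z + z)%C h). assert (T' := Cmod_triangle z z).
  assert (h0 := Cmod_ge_0 h).
  apply Rle_lt_trans with (Cmod h * (2 * Cmod z + 1)); [apply Rmult_le_compat_l; lra|].
  apply Rlt_le_trans with (e / (2 * Cmod z + 1) * (2 * Cmod z + 1)); [apply Rmult_lt_compat_r; lra|right; field; lra].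
Qed.

Lemma occurs_unique u z m m' : occurs u z m -> occurs u z m' -> m = m'.
Proof.
  intros [k [N [<- H]]] [k' [N' [<- H']]]. apply Nat.le_antisymm; apply NoDup_incl_length; auto; intros x Hx.
  - now apply H', H.
  - now apply H, H'.
Qed.

Lemma occurs_same_multiset u v z m : same_multiset u v -> occurs u z m -> occurs v z m.
Proof.
  intros [phi [[psi [Hpsi Hphi]] E]] [ks [N [L H]]].
  exists (map phi ks). split; [|split].
  - apply Injective_map_NoDup; [|exact N]. intros x y Hxy. now rewrite <- (Hpsi x), <- (Hpsi y), Hxy.
  - now rewrite length_map.
  - intros k. rewrite in_map_iff. split.
    + intros [x [<- Hx]]. rewrite E. now apply H.
    + intros Hk. exists (psi k). split; [apply Hphi|]. apply H. now rewrite <- E, Hphi.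
Qed.

(** * Completeness of the sines *)

Lemma is_RInt_ext_all (f g : R -> R) a b l : (forall t, f t = g t) -> is_RInt f a b l -> is_RInt g a b l.
Proof. intros E. apply is_RInt_ext. intros; apply E. Qed.

Lemma is_RInt_scal_0 (f : R -> R) a b c : is_RInt f a b 0 -> is_RInt (fun t => c * f t) a b 0.
Proof.
  intros H. replace 0 with (scal c (0 : R)) by (unfold scal; simpl; unfold mult; simpl; ring).
  exact (is_RInt_scal _ _ _ c _ H).
Qed.

Lemma is_RInt_plus_0 (f g : R -> R) a b : is_RInt f a b 0 -> is_RInt g a b 0 ->
  is_RInt (fun t => f t + g t) a b 0.
Proof.
  intros A B. replace 0 with (plus (0 : R) 0) by (unfold plus; simpl; ring).
  exact (is_RInt_plus _ _ _ _ _ _ A B).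
Qed.

(* The even kernels [phi] for which the odd 2L-periodic extension of [f]
   is orthogonal to all translates of [phi]. *)
Definition orth_kernel (f : R -> R) (L : R) (phi : R -> R) : Prop :=
  forall t0, is_RInt (fun t => f t * (phi (PI / L * (t - t0)) - phi (PI / L * (t + t0)))) 0 L 0.

Lemma orth_kernel_lin f L phi psi x y chi :
  (forall u, chi u = x * phi u + y * psi u) ->
  orth_kernel f L phi -> orth_kernel f L psi -> orth_kernel f L chi.
Proof.
  intros E A B t0.
  assert (X := is_RInt_plus_0 _ _ _ _ (is_RInt_scal_0 _ _ _ x (A t0)) (is_RInt_scal_0 _ _ _ y (B t0))).
  eapply is_RInt_ext_all; [|exact X]. intros t. cbv beta. rewrite !E. ring.
Qed.

(** For [phi u = cos (k u)] the kernel difference is [2 sin(k w t) sin(k w t0)] with [w = PI / L],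
    so the hypothesis applies; powers of [1 + cos u] are combinations of such cosines. *)
Lemma orth_kernel_pow f L :
  (forall n : nat, is_RInt (fun t => sin (INR n * (PI / L) * t) * f t) 0 L 0) ->
  forall N, orth_kernel f L (fun u => (1 + cos u) ^ N).
Proof.
  intros H.
  assert (B : forall k : nat, orth_kernel f L (fun u => cos (INR k * u))).
  { intros k t0. assert (X := is_RInt_scal_0 _ _ _ (2 * sin (INR k * (PI / L) * t0)) (H k)).
    eapply is_RInt_ext_all; [|exact X]. intros t. cbv beta.
    replace (INR k * (PI / L * (t - t0))) with (INR k * (PI / L) * t - INR k * (PI / L) * t0) by ring.
    replace (INR k * (PI / L * (t + t0))) with (INR k * (PI / L) * t + INR k * (PI / L) * t0) by ring.
    rewrite cos_minus, cos_plus. ring. }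
  (* The extra factor [cos (k u)] lets the induction on [N] close, because [cos u * cos (k u)] is
     the mean of the cosines with [k - 1] and [k + 1]; [k = 0] is separate. *)
  assert (P : forall N k, orth_kernel f L (fun u => (1 + cos u) ^ N * cos (INR k * u))).
  { induction N as [|N IH]; intros k.
    - apply (orth_kernel_lin f L (fun u => cos (INR k * u)) (fun u => cos (INR k * u)) 1 0); auto.
      intros u. simpl. ring.
    - destruct k as [|k].
      + apply (orth_kernel_lin f L _ _ 1 1 _) with (2 := IH 0%nat) (3 := IH 1%nat).
        intros u. simpl. rewrite !Rmult_0_l, cos_0, !Rmult_1_l. ring.
      + assert (Q := orth_kernel_lin f L _ _ (/ 2) (/ 2) _ (fun u => eq_refl) (IH k) (IH (S (S k)))).
        apply (orth_kernel_lin f L _ _ 1 1 _) with (2 := IH (S k)) (3 := Q).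
        intros u. rewrite !S_INR. simpl pow.
        replace (INR k * u) with ((INR k + 1) * u - u) by ring.
        replace ((INR k + 1 + 1) * u) with ((INR k + 1) * u + u) by ring.
        rewrite cos_minus, cos_plus. field. }
  intros N t0. generalize (P N 0%nat t0). apply is_RInt_ext_all. intros t. simpl. rewrite !Rmult_0_l, cos_0. ring.
Qed.

Lemma is_RInt_ge (g : R -> R) u v I m : u <= v -> is_RInt g u v I -> (forall t, u < t < v -> m <= g t) ->
  m * (v - u) <= I.
Proof.
  intros uv H Hm. apply Rle_trans with (RInt (fun _ => m) u v).
  - rewrite RInt_const. unfold scal; simpl; unfold mult; simpl. lra.
  - rewrite <- (is_RInt_unique _ _ _ _ H). apply RInt_le; auto.
    + eexists. apply (is_RInt_const (V := R_NormedModule)).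
    + eexists. exact H.
Qed.

(* The peaked kernels [((1 + cos u) / (1 + cos theta)) ^ N] stay below 1 away
   from [t0] and blow up around it. *)
Lemma sine_complete_le (f : R -> R) L : 0 < L -> (forall t, continuous f t) ->
  (forall n : nat, is_RInt (fun t => sin (INR n * (PI / L) * t) * f t) 0 L 0) ->
  forall t0, 0 < t0 < L -> f t0 <= 0.
Proof.
  intros HL Cf H t0 Ht0. apply Rnot_lt_le. intros Hf.
  assert (PI0 := PI_RGT_0). set (w := PI / L). assert (w0 : 0 < w) by (apply Rdiv_lt_0_compat; lra).
  assert (wL : w * L = PI) by (unfold w; field; lra).
  set (c := f t0 / 2). assert (c0 : 0 < c) by (unfold c; lra).
  destruct (Cf t0 _ (locally_ball (f t0) (mkposreal _ c0))) as [e He].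
  (* [e / 2] keeps [f >= c] within [eta] of [t0], [L / 4] gives [theta <= PI / 4], and the other two
     keep the angle [w (t + t0)] at distance at least [theta] from 0 and [2 PI], so that the
     reflected kernel has no peak on [[0, L]]. *)
  set (eta := Rmin (Rmin (e / 2) (L / 4)) (Rmin (t0 / 2) ((L - t0) / 2))).
  assert (r1 := Rmin_l (Rmin (e / 2) (L / 4)) (Rmin (t0 / 2) ((L - t0) / 2))).
  assert (r2 := Rmin_r (Rmin (e / 2) (L / 4)) (Rmin (t0 / 2) ((L - t0) / 2))).
  assert (r3 := Rmin_l (e / 2) (L / 4)). assert (r4 := Rmin_r (e / 2) (L / 4)).
  assert (r5 := Rmin_l (t0 / 2) ((L - t0) / 2)). assert (r6 := Rmin_r (t0 / 2) ((L - t0) / 2)).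
  assert (e0 := cond_pos e).
  assert (eta0 : 0 < eta) by (unfold eta; repeat apply Rmin_glb_lt; lra).
  fold eta in r1, r2.
  assert (near : forall t, Rabs (t - t0) <= eta -> c <= f t).
  { intros t Ht. assert (X : ball (f t0) (mkposreal _ c0) (f t)) by (apply He; change (Rabs (t - t0) < e); lra).
    change (Rabs (f t - f t0) < c) in X. apply Rabs_def2 in X. unfold c in *. lra. }
  destruct (continuity_ab_maj (fun t => Rabs (f t)) 0 L (Rlt_le _ _ HL)) as [tm [HF _]].
  { intros t _. apply continuity_pt_filterlim. apply (continuous_Rabs_comp f). apply Cf. }
  set (F := Rabs (f tm)) in HF. assert (F0 : 0 <= F) by apply Rabs_pos.
  set (theta := w * eta).
  assert (th0 : 0 < theta) by (unfold theta; nra).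
  assert (th1 : theta <= PI / 4) by (unfold theta; nra).
  assert (cth : 0 <= cos theta) by (apply cos_ge_0; lra).
  assert (cth2 : cos theta < cos (theta / 2)) by (apply cos_decreasing_1; lra).
  set (k := fun u => (1 + cos u) / (1 + cos theta)).
  assert (kpos : forall u, 0 <= k u).
  { intros u. unfold k. apply Rle_div_r; [lra|]. assert (X := COS_bound u). lra. }
  assert (kle : forall u, cos u <= cos theta -> k u <= 1).
  { intros u Hu. unfold k. apply Rle_div_l; lra. }
  assert (kpow : forall u N, cos u <= cos theta -> 0 <= k u ^ N <= 1).
  { intros u N Hu. split; [apply pow_le, kpos|]. rewrite <- (pow1 N). apply pow_incr. split; [apply kpos|now apply kle]. }
  set (A := k (theta / 2)).
  assert (A1 : 1 < A) by (unfold A, k; apply Rlt_div_r; lra).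
  assert (plus_far : forall t, 0 <= t <= L -> cos (w * (t + t0)) <= cos theta).
  { intros t Ht. destruct (Rle_lt_dec (w * (t + t0)) PI).
    - apply cos_decr_1; unfold theta in *; nra.
    - replace (cos (w * (t + t0))) with (cos (2 * PI - w * (t + t0))).
      + apply cos_decr_1; unfold theta in *; nra.
      + rewrite cos_minus, cos_2PI, sin_2PI. ring. }
  assert (cabs : forall x, cos (w * x) = cos (w * Rabs x)).
  { intros x. unfold Rabs. destruct Rcase_abs; [|reflexivity]. rewrite <- cos_neg. f_equal. ring. }
  assert (minus_far : forall t, 0 <= t <= L -> eta <= Rabs (t - t0) -> cos (w * (t - t0)) <= cos theta).
  { intros t Ht Hx. rewrite cabs. assert (Rabs (t - t0) <= L) by (apply Rabs_le; lra).
    apply cos_decr_1; unfold theta in *; nra. }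
  assert (minus_near : forall t, Rabs (t - t0) <= eta / 2 -> A <= k (w * (t - t0))).
  { intros t Hx. assert (cos (theta / 2) <= cos (w * (t - t0))).
    { rewrite cabs. assert (X := Rabs_pos (t - t0)). apply cos_decr_1; unfold theta in *; nra. }
    unfold A, k. apply Rmult_le_compat_r; [left; apply Rinv_0_lt_compat; lra|lra]. }
  (* The middle interval, of length [eta], contributes at least [(c A^N - F) eta] and the rest at
     least [- 2 F L]; this [N] makes the total positive. *)
  destruct (Pow_x_infinity A ltac:(rewrite Rabs_pos_eq; lra) ((2 * F * L + F * eta + 1) / (c * eta))) as [N HN].
  assert (AN := HN N (le_n N)). rewrite Rabs_pos_eq in AN by (apply pow_le; lra).
  set (g := fun t => f t * (k (w * (t - t0)) ^ N - k (w * (t + t0)) ^ N)).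
  assert (Ig : is_RInt g 0 L 0).
  { assert (X := is_RInt_scal_0 _ _ _ (/ (1 + cos theta) ^ N) (orth_kernel_pow f L H N t0)).
    eapply is_RInt_ext_all; [|exact X]. intros t. unfold g, k. fold w. unfold Rdiv. rewrite !Rpow_mult_distr, pow_inv. ring. }
  assert (fF : forall t, 0 <= t <= L -> - F <= f t <= F) by (intros t Ht; apply Rabs_le_between; now apply HF).
  assert (part2 : forall t, 0 <= t <= L -> - F <= - (f t * k (w * (t + t0)) ^ N)).
  { intros t Ht. assert (X := kpow _ N (plus_far t Ht)). assert (Y := fF t Ht). nra. }
  (* Where the first kernel may exceed 1, [f] is positive, so its contribution is nonnegative. *)
  assert (low : forall t, 0 <= t <= L -> - (2 * F) <= g t).
  { intros t Ht. assert (X := part2 t Ht). unfold g. rewrite Rmult_minus_distr_l.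
    destruct (Rle_lt_dec (Rabs (t - t0)) eta) as [Hx|Hx].
    - assert (Y := near t Hx). assert (Z := pow_le _ N (kpos (w * (t - t0)))). nra.
    - assert (Y := kpow _ N (minus_far t Ht (Rlt_le _ _ Hx))). assert (Z := fF t Ht). nra. }
  assert (high : forall t, 0 <= t <= L -> Rabs (t - t0) <= eta / 2 -> c * A ^ N - F <= g t).
  { intros t Ht Hx. assert (X := part2 t Ht). unfold g. rewrite Rmult_minus_distr_l.
    assert (Y := near t ltac:(lra)). assert (Z : A ^ N <= k (w * (t - t0)) ^ N) by (apply pow_incr; split; [lra|now apply minus_near]).
    assert (0 <= A ^ N) by (apply pow_le; lra).
    assert (c * A ^ N <= f t * k (w * (t - t0)) ^ N) by (apply Rmult_le_compat; lra). lra. }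
  assert (exg : ex_RInt g 0 L) by (eexists; exact Ig).
  set (p := t0 - eta / 2). set (q := t0 + eta / 2).
  assert (ex1 : ex_RInt g 0 p) by (apply (ex_RInt_Chasles_1 (V := R_CompleteNormedModule)) with L; [unfold p; lra|exact exg]).
  assert (ex2 : ex_RInt g p L) by (apply (ex_RInt_Chasles_2 (V := R_CompleteNormedModule)) with 0; [unfold p; lra|exact exg]).
  assert (ex3 : ex_RInt g p q) by (apply (ex_RInt_Chasles_1 (V := R_CompleteNormedModule)) with L; [unfold p, q; lra|exact ex2]).
  assert (ex4 : ex_RInt g q L) by (apply (ex_RInt_Chasles_2 (V := R_CompleteNormedModule)) with p; [unfold p, q; lra|exact ex2]).
  destruct ex1 as [I1 J1]. destruct ex3 as [I2 J2]. destruct ex4 as [I3 J3].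
  assert (E : plus I1 (plus I2 I3) = 0).
  { apply (is_RInt_unique g 0 L) in Ig. rewrite <- Ig. symmetry. apply is_RInt_unique.
    apply is_RInt_Chasles with p; [exact J1|]. apply is_RInt_Chasles with q; assumption. }
  unfold plus in E; simpl in E.
  assert (B1 := is_RInt_ge g 0 p I1 (- (2 * F)) ltac:(unfold p; lra) J1 (fun t Ht => low t ltac:(unfold p in *; lra))).
  assert (B3 := is_RInt_ge g q L I3 (- (2 * F)) ltac:(unfold q; lra) J3 (fun t Ht => low t ltac:(unfold q in *; lra))).
  assert (B2 := is_RInt_ge g p q I2 (c * A ^ N - F) ltac:(unfold p, q; lra) J2
    (fun t Ht => high t ltac:(unfold p, q in *; lra) ltac:(apply Rabs_le; unfold p, q in *; lra))).
  replace (q - p) with eta in B2 by (unfold p, q; field).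
  assert (ce : 0 < c * eta) by nra.
  assert (AN2 : 2 * F * L + F * eta + 1 <= A ^ N * (c * eta)).
  { apply Rle_trans with ((2 * F * L + F * eta + 1) / (c * eta) * (c * eta)); [right; field; lra|].
    apply Rmult_le_compat_r; lra. }
  assert (F * p + F * (L - q) <= F * L) by (unfold p, q; nra).
  lra.
Qed.

(** The frequencies are real, so real and imaginary parts separate, and each sign of a part is
    excluded by [sine_complete_le]. The coefficient [n = 0] is trivially 0. *)
Lemma sine_complete (f : R -> C) L : 0 < L -> contR f ->
  (forall n : nat, n <> 0%nat -> sine_int L f (RtoC (INR n * (PI / L))) = 0) ->
  forall t, 0 <= t <= L -> f t = 0.
Proof.
  intros HL Cf H.
  assert (K : forall g : R -> R, (forall t, continuous g t) ->
    (forall n : nat, is_RInt (fun t => sin (INR n * (PI / L) * t) * g t) 0 L 0) ->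
    forall t, 0 <= t <= L -> g t = 0).
  { intros g Cg Hg.
    assert (inside : forall t, 0 < t < L -> g t = 0).
    { intros t Ht. apply Rle_antisym; [now apply (sine_complete_le g L)|].
      assert (X : - g t <= 0); [|lra]. apply (sine_complete_le (fun t => - g t) L); auto.
      - intros s. apply (continuous_opp (V := R_NormedModule)). apply Cg.
      - intros n. eapply is_RInt_ext_all; [|exact (is_RInt_scal_0 _ _ _ (-1) (Hg n))].
        intros s. cbv beta. ring. }
    intros t Ht. destruct (Req_dec (g t) 0) as [|n]; [assumption|exfalso].
    assert (P := Rabs_pos_lt _ n).
    destruct (Cg t _ (locally_ball (g t) (mkposreal _ P))) as [e He]. assert (e0 := cond_pos e).
    (* An endpoint is handled by continuity: [s] is [t] moved a little towards the midpoint, hence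
       interior. *)
    set (x := Rmin 1 (e / L)). assert (x1 : x <= 1) by apply Rmin_l.
    assert (xe : x * L <= e).
    { apply Rle_trans with (e / L * L); [|right; field; lra]. apply Rmult_le_compat_r; [lra|apply Rmin_r]. }
    assert (x0 : 0 < x) by (apply Rmin_glb_lt; [lra|apply Rdiv_lt_0_compat; lra]).
    set (s := t + (L / 2 - t) * x).
    assert (Hs : 0 < s < L) by (unfold s; nra).
    assert (B : ball (g t) (mkposreal _ P) (g s)).
    { apply He. change (Rabs (s - t) < e). apply Rabs_def1; unfold s; nra. }
    change (Rabs (g s - g t) < Rabs (g t)) in B. rewrite (inside s Hs), Rminus_0_l, Rabs_Ropp in B. lra. }
  assert (S : forall n : nat, IC (fun t => RtoC (sin (INR n * (PI / L) * t)) * f t)%C 0 L 0).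
  { intros n. destruct (Nat.eq_dec n 0) as [->|nz].
    - assert (X := IC_scal _ _ _ _ 0 (contR_IC f L Cf (Rlt_le _ _ HL))).
      rewrite Cmult_0_l in X. eapply IC_ext; [|exact X]. intros t. cbv beta. simpl. now rewrite !Rmult_0_l, sin_0.
    - assert (X := IC_sine_int L f (RtoC (INR n * (PI / L))) (Rlt_le _ _ HL) Cf). rewrite (H n nz) in X.
      eapply IC_ext; [|exact X]. intros t. cbv beta. f_equal. rewrite <- RtoC_mult.
      apply C_ext; simpl; rewrite ?cosh_0, ?sinh_0; ring. }
  intros t Ht. apply C_ext.
  - apply (K (fun t => Re (f t))); auto.
    + intros s. apply cw_True_continuous, Cf.
    + intros n. eapply is_RInt_ext_all; [|exact (proj1 (S n))]. intros s. simpl. unfold Re. ring.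
  - apply (K (fun t => Im (f t))); auto.
    + intros s. apply cw_True_continuous, Cf.
    + intros n. eapply is_RInt_ext_all; [|exact (proj2 (S n))]. intros s. simpl. unfold Im. ring.
Qed.

(** * From the potentials on [T] to the conclusion *)

Lemma contR_clip gamma a b q u v : continuous_T gamma a b q -> u <= v ->
  (forall s, seg u v s -> T gamma a b s) -> contR (fun s => q (clip u v s)).
Proof.
  intros Hq uv H t. destruct (clip_cont gamma a b q Hq u v uv H) as [A B].
  split; apply cw_cont; [apply A|apply B].
Qed.

Lemma contR_reverse f b : contR f -> contR (fun s => f (b - s)).
Proof.
  intros H t.
  assert (X : forall g : R -> R, continuous g (b - t) -> continuous (fun s => g (b - s)) t).
  { intros g Hg. apply (continuous_comp (fun s => b - s) g); [|exact Hg].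
    apply (continuous_minus (V := R_NormedModule)); [apply continuous_const|apply continuous_id]. }
  split; apply cw_cont.
  - apply (X (fun s => Re (f s))), cw_True_continuous, H.
  - apply (X (fun s => Im (f s))), cw_True_continuous, H.
Qed.

Lemma Csin_INR_PI n : Csin (RtoC (INR n * PI)) = 0.
Proof.
  assert (E : sin (INR n * PI) = 0) by (apply sin_eq_0_1; exists (Z.of_nat n); now rewrite <- INR_IZR_INZ).
  apply C_ext; simpl; rewrite ?E, ?sinh_0; ring.
Qed.

(** The zeros of [sin (rho * g)] are real, so a function vanishing off them
    vanishes everywhere by continuity. *)
Lemma Csin_mult_zero g (J : C -> C) rho : 0 < g -> (forall z, contC J z) ->
  (forall z, (Csin (z * g) * J z)%C = 0) -> J rho = 0.
Proof.
  intros Hg CJ H. destruct (Ceq_dec (J rho) 0) as [|nz]; [assumption|exfalso].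
  destruct (contC_neq0 J rho (CJ rho) nz) as [e [He E]].
  assert (P := proj1 (Cmod_gt_0 _) nz).
  assert (X : exists t, Rabs t < e /\ (Im rho + t) * g <> 0).
  { destruct (Req_dec (Im rho) 0) as [i0|i0].
    - exists (e / 2). rewrite Rabs_pos_eq by lra. split; [lra|]. nra.
    - exists 0. rewrite Rabs_R0. split; [exact He|]. rewrite Rplus_0_r. apply Rmult_integral_contrapositive. lra. }
  destruct X as [t [te ti]].
  assert (Y := E (t * Ci)%C ltac:(rewrite Cmod_mult, Cmod_R, Cmod_Ci; lra)).
  assert (nS : Csin ((rho + t * Ci) * g) <> 0).
  { intros Z. assert (Q := Cmod_Csin ((rho + t * Ci) * g)). rewrite Z, Cmod_0 in Q.
    replace (Im ((rho + t * Ci) * g)%C) with ((Im rho + t) * g) in Q by (simpl; unfold Im; ring).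
    assert (N : sinh ((Im rho + t) * g) <> 0).
    { rewrite <- sinh_0. intros W. destruct (Rtotal_order ((Im rho + t) * g) 0) as [L|[L|L]]; [|contradiction|];
        apply sinh_lt in L; lra. }
    assert (0 < sinh ((Im rho + t) * g) ^ 2) by nra.
    assert (V := pow2_ge_0 (sin (Re ((rho + t * Ci) * g)%C))). lra. }
  assert (nJ : J (rho + t * Ci)%C <> 0) by (apply Cmod_gt_0; lra).
  exact (Cmult_neq_0 _ _ nS nJ (H _)).
Qed.

Theorem theorem1 (gamma a b : R) (Hgamma : 0 < gamma) (Ha : gamma < a) (Hb : a < b)
    (q qt : R -> C)
    (Hq : continuous_T gamma a b q) (Hqt : continuous_T gamma a b qt)
    (lambda lambdat : nat -> C)
    (Hlambda : is_spectrum gamma a b q lambda)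
    (Hlambdat : is_spectrum gamma a b qt lambdat)
    (Hcs : forall mu : C,
       ~ (c2_fun gamma a b mu = RtoC 0 /\ s_fun gamma mu = RtoC 0))
    (Heq : same_multiset lambda lambdat) :
  forall t : R, T gamma a b t -> q t = qt t.
Proof.
  assert (S1 : forall s, seg 0 gamma s -> T gamma a b s) by (intros s Hs; left; exact Hs).
  assert (S2 : forall s, seg a b s -> T gamma a b s) by (intros s Hs; right; exact Hs).
  (* Each restriction is extended by its end values to a continuous function on the line; the second
     one is reversed, as the kernel [sin(rho (b - t))] requires. *)
  set (f1 := fun s => q (clip 0 gamma s)). set (f2 := fun s => q (clip a b (b - s))).
  set (f1' := fun s => qt (clip 0 gamma s)). set (f2' := fun s => qt (clip a b (b - s))).
  assert (C1 : contR f1) by (apply (contR_clip gamma a b); auto; lra).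
  assert (C1' : contR f1') by (apply (contR_clip gamma a b); auto; lra).
  assert (C2 : contR f2).
  { apply (contR_reverse (fun s => q (clip a b s))). apply (contR_clip gamma a b); auto; lra. }
  assert (C2' : contR f2').
  { apply (contR_reverse (fun s => qt (clip a b s))). apply (contR_clip gamma a b); auto; lra. }
  assert (bb : forall t, b - (b - t) = t) by (intros; ring).
  assert (E1 : forall t, 0 <= t <= gamma -> f1 t = q t) by (intros t Ht; unfold f1; now rewrite clip_id).
  assert (E1' : forall t, 0 <= t <= gamma -> f1' t = qt t) by (intros t Ht; unfold f1'; now rewrite clip_id).
  assert (E2 : forall t, a <= t <= b -> f2 (b - t) = q t) by (intros t Ht; unfold f2; now rewrite bb, clip_id).
  assert (E2' : forall t, a <= t <= b -> f2' (b - t) = qt t) by (intros t Ht; unfold f2'; now rewrite bb, clip_id).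
  set (d := a - gamma). set (l := b - a).
  assert (d0 : 0 < d) by (unfold d; lra). assert (l0 : 0 < l) by (unfold l; lra).
  assert (EE : forall rho, entire_char d l gamma (q gamma) f1 f2 rho = entire_char d l gamma (qt gamma) f1' f2' rho).
  { apply entire_char_unique; auto. intros z.
    destruct (proj2 Hlambda (z * z)%C) as [m [Om Zm]]. destruct (proj2 Hlambdat (z * z)%C) as [m' [Om' Zm']].
    rewrite <- (occurs_unique _ _ _ _ (occurs_same_multiset _ _ _ _ Heq Om) Om') in Zm'.
    destruct (zero_order_dominated _ _ _ _ Zm Zm') as [M HM]. exists M.
    apply (near0_sqr (fun w => Cmod (char_fun gamma a b q w) <= M * Cmod (char_fun gamma a b qt w))) in HM.
    revert HM. apply near0_imp. intros h Hh.
    unfold d, l. rewrite <- (char_fun_entire gamma a b q f1 f2), <- (char_fun_entire gamma a b qt f1' f2') by assumption.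
    rewrite !(Cmod_mult ((z + h) * (z + h))%C).
    assert (P := Cmod_ge_0 ((z + h) * (z + h))%C). nra. }
  assert (half1 : forall t, 0 <= t <= gamma -> q t = qt t).
  { intros t Ht. rewrite <- E1, <- E1' by exact Ht.
    assert (Z : (f1 t - f1' t = 0)%C).
    2:{ transitivity (f1 t - f1' t + f1' t)%C; [ring|rewrite Z; ring]. }
    revert t Ht. apply (sine_complete (fun t => f1 t - f1' t)%C gamma Hgamma).
    { intros t. now apply cwC_minus. }
    intros n nz. rewrite sine_int_minus by (auto; lra).
    set (rho := RtoC (INR n * (PI / gamma))).
    assert (nR : INR n * (PI / gamma) <> 0).
    { apply Rmult_integral_contrapositive. split; [now apply not_0_INR|].
      assert (P := Rdiv_lt_0_compat _ _ PI_RGT_0 Hgamma). lra. }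
    assert (rho0 : rho <> 0).
    { intros X. apply (f_equal Re) in X. exact (nR X). }
    assert (Sg : Csin (rho * gamma) = 0).
    { rewrite <- (Csin_INR_PI n). f_equal. unfold rho. rewrite <- RtoC_mult. f_equal. field. lra. }
    (* This is [rho * c2 (rho^2)]. Since [n <> 0], [rho^2] is a zero of [s], so the hypothesis on
       common zeros gives [k <> 0]. *)
    set (k := (d * rho * Ccos (rho * l) + (1 - d * d * (rho * rho)) * Csin (rho * l))%C).
    assert (k0 : k <> 0).
    { intros X. apply (Hcs (rho * rho)%C). split.
      - unfold c2_fun. rewrite cosr_sqr, sinr_sqr by exact rho0. fold d l.
        transitivity (k / rho)%C; [unfold k; simpl; field; exact rho0|]. rewrite X. unfold Cdiv. ring.
      - unfold s_fun. rewrite sinr_sqr, Sg by exact rho0. unfold Cdiv. ring. }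
    destruct (Ceq_dec (sine_int gamma f1 rho - sine_int gamma f1' rho)%C 0) as [|nJ]; [assumption|exfalso].
    apply (Cmult_neq_0 _ _ k0 nJ).
    assert (X := EE rho). unfold entire_char in X. fold k in X. rewrite Sg in X.
    transitivity (- ((- 0 * (rho * Ccos (rho * l) + (d * q gamma - d * (rho * rho)) * Csin (rho * l) + sine_int l f2 rho)
       - k * (rho * Ccos (rho * gamma) + sine_int gamma f1 rho))
      - (- 0 * (rho * Ccos (rho * l) + (d * qt gamma - d * (rho * rho)) * Csin (rho * l) + sine_int l f2' rho)
       - k * (rho * Ccos (rho * gamma) + sine_int gamma f1' rho))))%C; [ring|].
    rewrite X. ring. }
  intros t [Ht|Ht]; [now apply half1|].
  rewrite <- E2, <- E2' by exact Ht.
  assert (Z : (f2 (b - t)%R - f2' (b - t)%R = 0)%C).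
  2:{ transitivity (f2 (b - t)%R - f2' (b - t)%R + f2' (b - t)%R)%C; [ring|rewrite Z; ring]. }
  apply (sine_complete (fun t => f2 t - f2' t)%C l l0); [| |unfold l; lra].
  { intros s. now apply cwC_minus. }
  intros n _. rewrite sine_int_minus by (auto; lra).
  apply (Csin_mult_zero gamma (fun z => sine_int l f2 z - sine_int l f2' z)%C); [exact Hgamma| |].
  - intros z. apply taylor2_cont, taylor2_minus; apply taylor2_sine_int; auto; lra.
  - intros z. assert (X := EE z). unfold entire_char in X.
    assert (F1 : sine_int gamma f1' z = sine_int gamma f1 z).
    { apply IC_RInt. eapply IC_ext; [|apply (IC_sine_int gamma f1 z); [lra|exact C1]].
      intros s. cbv beta. unfold f1, f1'. rewrite half1; [reflexivity|]. apply clip_seg. lra. }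
    (* The potentials already agree at [gamma], so the two sides of [X] differ only in the transform
       over the second segment. *)
    rewrite F1, <- (half1 gamma) in X by lra.
    set (k := (d * z * Ccos (z * l) + (1 - d * d * (z * z)) * Csin (z * l))%C) in X.
    set (u := (z * Ccos (z * l) + (d * q gamma - d * (z * z)) * Csin (z * l))%C) in X.
    set (v := (k * (z * Ccos (z * gamma) + sine_int gamma f1 z))%C) in X.
    transitivity (- ((- Csin (z * gamma) * (u + sine_int l f2 z) - v) - (- Csin (z * gamma) * (u + sine_int l f2' z) - v)))%C; [ring|].
    rewrite X. ring.
Qed.
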